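(* Let $p_1, p_2, \gamma_1, \gamma_2$ be non-zero complex constants such that $\gamma_1\neq\gamma_2$ and $\frac{\gamma_2}{\gamma_1}\neq 2^{\pm 1}$ (i.e. $\gamma_2/\gamma_1\notin\{2,\tfrac12\}$). Then there is no transcendental entire function $f$ of finite order with $N\left(r,\frac{1}{f}\right)=S(r,f)$ that satisfies a differential equation $$f(z)f'(z)+Q(z,f)=p_1e^{\gamma_1 z}+p_2e^{\gamma_2 z},$$ where $Q(z,f)=\sum_{j=0}^{k}a_jf^{(j)}$ is a linear differential polynomial in $f$ whose coefficients $a_j$ are small functions of $f$.
   Context: Standard Nevanlinna theory notation is used: $T(r,f)$ is the Nevanlinna characteristic and $N(r,1/f)$ is the integrated counting function of zeros of $f$ (with multiplicity). The order of $f$ is $\rho(f)=\limsup_{r\to\infty}\frac{\log T(r,f)}{\log r}$. $S(r,f)$ denotes any quantity satisfying $S(r,f)=o(T(r,f))$ as $r\to\infty$ outside a possible exceptional set of finite linear measure (not necessarily the same at each occurrence). A meromorphic function $g$ is a small function of $f$ if $T(r,g)=S(r,f)$. *)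

(* Defs.v *)
From HB Require Import structures.
From mathcomp Require Import all_boot all_order all_algebra.
From mathcomp Require Import all_classical all_reals all_analysis.
From mathcomp Require Import complex.

Set Implicit Arguments.
Unset Strict Implicit.
Unset Printing Implicit Defensive.

Import Order.TTheory GRing.Theory Num.Theory.
Import numFieldNormedType.Exports.

Local Open Scope classical_set_scope.
Local Open Scope ring_scope.
Local Open Scope complex_scope.

(* R[i] as a normed module over itself, with the topology of its norm. *)
HB.instance Definition _ (R : rcfType) :=
  NormedModule.copy R[i] R[i]^o.

Section ComplexAnalysis.
Variable R : realType.
Local Notation C := R[i].
Implicit Types (f g h : C -> C) (z w : C) (r t : R).

Definition expC z : C :=
  (expR (complex.Re z))%:C * (cos (complex.Im z) +i* sin (complex.Im z)).

(* Scalars are complex here, so derivability in the direction 1 is complex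
   differentiability. *)
Definition holomorphic_at g z : Prop := \forall w \near z, derivable g w 1.

Definition entire f : Prop := forall z, holomorphic_at f z.

Definition transcendental_entire f : Prop :=
  entire f /\ ~ exists p : {poly C}, forall z, f z = p.[z].

Definition pole_of_order g z (n : nat) : Prop :=
  (0 < n)%N /\
  exists h, [/\ holomorphic_at h z, h z != 0 &
    \forall w \near z^', g w = h w / (w - z) ^+ n].

(* A meromorphic function on the plane is a total function; its value at a
   pole is irrelevant. *)
Definition meromorphic g : Prop :=
  forall z, holomorphic_at g z \/ exists n, pole_of_order g z n.

Definition pole_mult g z : nat := xget 0%N [set n | pole_of_order g z n].

Definition nevanlinna_n r g : R :=
  \sum_(z \in [set z : C | Normc.normc z <= r]) ((pole_mult g z)%:R : R).

Definition nevanlinna_N r g : R :=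
  (\int[lebesgue_measure]_(t in `]0, r])
     ((nevanlinna_n t g - nevanlinna_n 0 g) / t))
  + nevanlinna_n 0 g * ln r.

Definition lnp (x : R) : R := Num.max 0 (ln x).

Definition nevanlinna_m r g : R :=
  (2 * pi)^-1 * \int[lebesgue_measure]_(t in `[0, 2 * pi])
    lnp (Normc.normc (g (r%:C * expC (t *i)))).

Definition nevanlinna_T r g : R := nevanlinna_m r g + nevanlinna_N r g.

Definition growth_order f : \bar R :=
  limf_esup (fun r => (ln (nevanlinna_T r f) / ln r)%:E) +oo.

(* u(r) = S(r,f) *)
Definition is_S f (u : R -> R) : Prop :=
  exists E : set R, [/\ measurable E, (lebesgue_measure E < +oo)%E &
    forall e : R, 0 < e ->
      \forall r \near +oo, ~ E r -> `|u r| <= e * nevanlinna_T r f].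

Definition small_function f g : Prop :=
  meromorphic g /\ is_S f (fun r => nevanlinna_T r g).

End ComplexAnalysis.

(* Main.v *)
(* By Jensen's formula the mean of [ln |f|] over a circle is [N(r, 1/f) + O(1)],
   hence [o(r)]; the logarithmic derivatives [f^(j) / f], the quotient [f / f']
   and the ratio [f(w) / f(z)] for [|w - z| <= eps |z|] are bounded on suitable
   circles by [exp Err] with a small mean of [Err].  Say [|gamma2| <= |gamma1|]
   and put [F = f f'].  For a rotation [w] close to [1] consider the entire function
   [K(z) = F(w z) exp(gamma1 z) - F(z) exp(gamma1 w z)].  Everywhere
   [|K| <= |f|^2 |exp(gamma1 z)| exp(Err)], and on the sector where
   [p1 exp(gamma1 z)] dominates the equation there is an additional factor
   [exp(- s(z) / 2)] with [s] positively homogeneous of positive mean, because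
   [F - p1 exp(gamma1 z)] is relatively small there.  If [K] were not identically
   zero, Jensen's formula would bound the mean of [ln |K|] from below, a
   contradiction for large [r].  So [F / exp(gamma1 z)] is invariant under
   small rotations, hence constant; then [f^2] is a multiple of
   [exp(gamma1 z)], [f' = gamma1 f / 2], and putting this back in the equation
   forces [gamma2 = gamma1 / 2]. *)

Require Import Defs.
From mathcomp Require Import all_boot all_order all_algebra.
From mathcomp Require Import all_classical all_reals all_analysis.
From mathcomp Require Import complex.
From mathcomp Require Import ring lra.
Import Order.TTheory GRing.Theory Num.Theory.
Import numFieldNormedType.Exports.
Local Open Scope classical_set_scope.
Local Open Scope ring_scope.

Set Implicit Arguments.
Unset Strict Implicit.
Unset Printing Implicit Defensive.

(** Only means of [ln |f|] over circles are known, not the size of [f] at a point. Comparing [F]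
    with [p1 exp(gamma1 z)] directly would fail: away from the sector their difference is bounded
    only by the larger of two quantities, and the mean of a maximum is not controlled. In [K] both
    terms contain one factor [F] and one exponential, taken at points that differ by a small
    rotation. So both are comparable to [|f|^2 |exp(gamma1 z)|], whose logarithm has mean at most a
    small multiple of [r], since [Re(gamma1 z)] has mean zero. The gain on the sector, however
    narrow, then outweighs all other terms. As [K] is entire, nothing need be known about its zeros:
    Jensen's formula with [N >= 0] suffices. A rotation compares points of one circle, so the final
    estimates live on single circles, and these can avoid the exceptional set and the countably many
    radii that carry zeros or poles. The sector is nonempty because [gamma1 != gamma2] and
    [|gamma2| <= |gamma1|]. *)

Notation nc := Normc.normc.

(** * Complex derivatives *)

Section Basics.
Variable R : realType.
Local Notation C := R[i].
Implicit Types (z w h : C) (x y e d : R).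

Lemma normC_nc z : `|z| = (nc z)%:C%C. Proof. by rewrite normc_def; case: z. Qed.

Lemma nc_ge0 z : 0 <= nc z.
Proof. by case: z => a b; exact: sqrtr_ge0. Qed.

Lemma ncD z w : nc (z + w) <= nc z + nc w. Proof. exact: le_normcD. Qed.

Lemma ncN z : nc (- z) = nc z. Proof. exact: normcN. Qed.

Lemma ncB z w : nc (z - w) = nc (w - z). Proof. by rewrite -ncN opprB. Qed.

Lemma ncM z w : nc (z * w) = nc z * nc w. Proof. exact: Normc.normcM. Qed.

Lemma ncV z : nc z^-1 = (nc z)^-1. Proof. exact: Normc.normcV. Qed.

Lemma nc0 : nc (0 : C) = 0. Proof. exact: Normc.normc0. Qed.

Lemma nc1 : nc (1 : C) = 1. Proof. exact: Normc.normc1. Qed.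

Lemma ncX z n : nc (z ^+ n) = nc z ^+ n.
Proof. by elim: n => [|n IH]; rewrite ?expr0 ?nc1// !exprS ncM IH. Qed.

Lemma nc_eq0 z : (nc z == 0) = (z == 0).
Proof. by apply/eqP/eqP => [/Normc.eq0_normc//|->]; rewrite nc0. Qed.

Lemma nc_gt0 z : (0 < nc z) = (z != 0).
Proof. by rewrite lt_neqAle nc_ge0 andbT eq_sym nc_eq0. Qed.

Lemma nc_real x : nc x%:C%C = `|x|.
Proof. by rewrite /= expr0n /= addr0 sqrtr_sqr. Qed.

Lemma nc_pos x : 0 <= x -> nc x%:C%C = x.
Proof. by move=> x0; rewrite nc_real ger0_norm. Qed.

Lemma nc_nat n : nc (n%:R : C) = n%:R.
Proof.
have -> : (n%:R : C) = (n%:R : R)%:C%C by rewrite rmorph_nat.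
by rewrite nc_pos.
Qed.

Lemma ncBl z w : nc z - nc w <= nc (z - w).
Proof. by rewrite lerBlDr -{1}(subrK w z) ncD. Qed.

Lemma nc_sub_le z w : nc (z - w) <= nc z + nc w.
Proof. by rewrite -(ncN w) ncD. Qed.

Lemma nc_dist_tri u z w : nc (z - w) <= nc (z - u) + nc (u - w).
Proof. by rewrite -(subrKA u) ncD. Qed.

Lemma nc_sum (I : Type) (s : seq I) (P : pred I) (F : I -> C) :
  nc (\sum_(i <- s | P i) F i) <= \sum_(i <- s | P i) nc (F i).
Proof.
elim/big_ind2: _ => [|a b c d ab cd|//]; first by rewrite nc0.
by rewrite (le_trans (ncD _ _))// lerD.
Qed.

Lemma Re_le_nc z : `|complex.Re z| <= nc z.
Proof.
by case: z => a b /=; rewrite -(sqrtr_sqr a) ler_wsqrtr ?lerDl ?sqr_ge0//.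
Qed.

Lemma Im_le_nc z : `|complex.Im z| <= nc z.
Proof.
by case: z => a b /=; rewrite -(sqrtr_sqr b) ler_wsqrtr ?lerDr ?sqr_ge0//.
Qed.

Lemma nc_le_ReIm z : nc z <= `|complex.Re z| + `|complex.Im z|.
Proof.
case: z => a b /=; rewrite -[leRHS]ger0_norm ?addr_ge0//.
rewrite -[leRHS]sqrtr_sqr ler_wsqrtr// sqrrD !real_normK ?num_real//.
by rewrite lerD2r lerDl mulrn_wge0// mulr_ge0.
Qed.

Lemma cReD z w : complex.Re (z + w) = complex.Re z + complex.Re w.
Proof. by case: z w => [? ?] [? ?]. Qed.

Lemma cImD z w : complex.Im (z + w) = complex.Im z + complex.Im w.
Proof. by case: z w => [? ?] [? ?]. Qed.

Lemma cReN z : complex.Re (- z) = - complex.Re z. Proof. by case: z. Qed.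

Lemma cImN z : complex.Im (- z) = - complex.Im z. Proof. by case: z. Qed.

Lemma cReM z w : complex.Re (z * w) =
  complex.Re z * complex.Re w - complex.Im z * complex.Im w.
Proof. by case: z w => [? ?] [? ?]. Qed.

Lemma cImM z w : complex.Im (z * w) =
  complex.Re z * complex.Im w + complex.Im z * complex.Re w.
Proof. by case: z w => [? ?] [? ?]. Qed.

Lemma nc_conj z : nc (conjc z) = nc z.
Proof. by case: z => a b /=; rewrite sqrrN. Qed.

Lemma mul_conj z : z * conjc z = (nc z ^+ 2)%:C%C.
Proof.
case: z => a b /=; rewrite sqr_sqrtr ?addr_ge0 ?sqr_ge0//.
by apply/eqP; rewrite eq_complex /=; apply/andP; split; apply/eqP; ring.
Qed.

(** The norm of [R[i]] takes values in [R[i]], so radii of balls are complex numbers; a positive one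
    has zero imaginary part. From here on radii are real and distances are measured by [nc]. *)
Lemma nbhs_nc z (P : set C) :
  nbhs z P <-> exists2 e, 0 < e & forall w, nc (w - z) < e -> P w.
Proof.
split => [/nbhs_normP[e e0 eP]|[e e0 eP]].
  exists (complex.Re e); first by move: e0; rewrite /= ltcE => /andP[].
  move=> w we; apply: eP; rewrite /ball_ /= distrC normC_nc.
  by move: e0; rewrite /= ltcE => /andP[/eqP /= e0 _]; rewrite ltcE /= e0 eqxx.
apply/nbhs_normP; exists (e%:C)%C; first by rewrite /= ltcR.
by move=> w; rewrite /ball_ /= distrC normC_nc ltcR; exact: eP.
Qed.

Lemma cvgC_nc (T : Type) (F : set_system T) {FF : Filter F} (f : T -> C) z :
  f @ F --> z <-> forall e, 0 < e -> \forall t \near F, nc (f t - z) < e.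
Proof.
split => [fz e e0|H].
  by apply: (fz [set w | nc (w - z) < e]); apply/nbhs_nc; exists e.
by move=> A /nbhs_nc[e e0 eA]; near=> t; apply: eA; near: t; exact: H.
Unshelve. all: by end_near. Qed.

Lemma contCP (f : C -> C) z : {for z, continuous f} <->
  forall e, 0 < e -> exists2 d, 0 < d &
    forall w, nc (w - z) < d -> nc (f w - f z) < e.
Proof.
split => [fz e e0|H A /nbhs_nc[e e0 eA]].
  have /fz/nbhs_nc : nbhs (f z) [set w | nc (w - f z) < e].
    by apply/nbhs_nc; exists e.
  by move=> [d d0 dP]; exists d => // w /dP.
have [d d0 dP] := H _ e0; apply/nbhs_nc; exists d => // w /dP; exact: eA.
Qed.

Lemma contCR (f : C -> R) z : (forall e, 0 < e -> exists2 d, 0 < d &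
    forall w, nc (w - z) < d -> `|f w - f z| < e) -> {for z, continuous f}.
Proof.
move=> H A /nbhs_normP[e e0 eA].
have [d d0 dP] := H _ e0; apply/nbhs_nc; exists d => // w /dP wz.
by apply: eA; rewrite /ball_ /= distrC.
Qed.

Lemma contRC (f : R -> C) x : {for x, continuous f} <->
  forall e, 0 < e -> exists2 d, 0 < d &
    forall y, `|y - x| < d -> nc (f y - f x) < e.
Proof.
split => [fz e e0|H A /nbhs_nc[e e0 eA]].
  have /fz/nbhs_normP : nbhs (f x) [set w | nc (w - f x) < e].
    by apply/nbhs_nc; exists e.
  by move=> [d d0 dP]; exists d => // w wd; apply: dP; rewrite /ball_ /= distrC.
have [d d0 dP] := H _ e0; apply/nbhs_normP; exists d => // w.
by rewrite /ball_ /= distrC => /dP; exact: eA.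
Qed.

(** Linear approximation replaces the difference quotient. It also makes sense for [h = 0], which
    matters for composition, where the increment of the inner function may vanish. *)
Lemma is_deriveCP (f : C -> C) z (a : C) :
  is_derive z 1 f a <-> forall e, 0 < e -> exists2 d, 0 < d &
    forall h, nc h < d -> nc (f (z + h) - f z - a * h) <= e * nc h.
Proof.
pose g h := h^-1 *: (f (h *: (1:C) + z) - f z).
have gE h : h != 0 -> nc (g h - a) = nc (f (z + h) - f z - a * h) / nc h.
  move=> h0; rewrite /g -ncV -ncM -[h *: 1]/(h * 1) mulr1 (addrC h).
  by congr nc; rewrite -[_ *: _]/(_ * _); field.
have H : g @ 0^' --> a <-> forall e, 0 < e -> exists2 d, 0 < d &
    forall h, nc h < d -> nc (f (z + h) - f z - a * h) <= e * nc h.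
  split => [/cvgC_nc ga e e0|ga].
    have /nbhs_nc[d d0 dP] := ga _ e0; exists d => // h hd.
    have [->|h0] := eqVneq h 0.
      by rewrite addr0 subrr mulr0 subr0 nc0 mulr0.
    have := dP h; rewrite subr0 => /(_ hd h0); rewrite gE//.
    by rewrite ltr_pdivrMr ?nc_gt0// => /ltW.
  apply/cvgC_nc => e e0; have [|d d0 dP] := ga (e / 2); first by rewrite divr_gt0.
  apply/nbhs_nc; exists d => // h; rewrite subr0 => hd h0.
  rewrite gE// ltr_pdivrMr ?nc_gt0//; apply: le_lt_trans (dP _ hd) _.
  by rewrite ltr_pM2r ?nc_gt0//; lra.
rewrite -H; split => [[df <-]|ga]; first exact: df.
by split; [apply/cvg_ex; exists a|exact/cvg_lim].
Qed.

Lemma is_derive_eqf (f g : C -> C) z (a : C) : (forall w, f w = g w) ->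
  is_derive z 1 f a -> is_derive z 1 g a.
Proof. by move=> /funext ->. Qed.

Lemma derive1_is_derive (f : C -> C) z (a : C) :
  is_derive z 1 f a -> derive1 f z = a.
Proof. by move=> [_]; rewrite derive1E. Qed.

Lemma derivable_is_derive (f : C -> C) z :
  derivable f z 1 -> is_derive z 1 f (derive1 f z).
Proof. by rewrite derive1E; exact: derivableP. Qed.

Lemma is_deriveC_comp (f g : C -> C) z (a b : C) :
  is_derive z 1 f a -> is_derive (f z) 1 g b ->
  is_derive z 1 (fun w => g (f w)) (b * a).
Proof.
move=> /is_deriveCP fa /is_deriveCP gb; apply/is_deriveCP => e e0.
(* [M] is a local Lipschitz constant of [f] at [z], thanks to [e2 <= 1]. Half of [e] pays for the
   remainder of [g], the other half for the remainder of [f] multiplied by [b]. *)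
pose M := nc a + 1; have M0 : 0 < M by rewrite ltr_wpDl ?nc_ge0.
have e1 : 0 < e / (2 * M) by rewrite divr_gt0// mulr_gt0.
have [d1 d10 gP] := gb _ e1.
pose e2 := Num.min 1 (e / (2 * (nc b + 1))).
have b0 : 0 < nc b + 1 by rewrite ltr_wpDl ?nc_ge0.
have e20 : 0 < e2 by rewrite lt_min ltr01 divr_gt0// mulr_gt0.
have [d2 d20 fP] := fa _ e20.
exists (Num.min d2 (d1 / M)); first by rewrite lt_min d20 divr_gt0.
move=> h; rewrite lt_min => /andP[hd2 hd1].
have fh := fP _ hd2; set k := f (z + h) - f z in fh.
have kM : nc k <= M * nc h.
  have -> : k = (k - a * h) + a * h by ring.
  rewrite (le_trans (ncD _ _))// ncM mulrDl mul1r addrC lerD2l.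
  by rewrite (le_trans fh)// ler_piMl ?nc_ge0// ge_min lexx.
have kd : nc k < d1.
  by rewrite (le_lt_trans kM)// mulrC -ltr_pdivlMr.
have kE : f z + k = f (z + h) by rewrite /k addrC subrK.
have := gP _ kd; rewrite kE => gk.
have -> : g (f (z + h)) - g (f z) - b * a * h =
  (g (f (z + h)) - g (f z) - b * k) + b * (k - a * h) by ring.
rewrite (le_trans (ncD _ _))// ncM.
have -> : e * nc h = e / (2 * M) * (M * nc h) + e / 2 * nc h.
  by field; rewrite gt_eqF.
apply: lerD; first by rewrite (le_trans gk)// ler_wpM2l// ltW.
apply: (@le_trans _ _ ((nc b + 1) * (e / (2 * (nc b + 1)) * nc h))).
  apply: ler_pM; rewrite ?nc_ge0//; first by rewrite lerDl.
  by rewrite (le_trans fh)// ler_wpM2r ?nc_ge0// ge_min lexx orbT.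
by rewrite le_eqVlt; apply/orP; left; apply/eqP; field; rewrite gt_eqF.
Qed.

Lemma is_derive_contC (f : C -> C) z (a : C) :
  is_derive z 1 f a -> {for z, continuous f}.
Proof.
by move=> [df _]; apply: differentiable_continuous; exact/derivable1_diffP.
Qed.

Lemma is_deriveCD (f g : C -> C) z (a b : C) :
  is_derive z 1 f a -> is_derive z 1 g b ->
  is_derive z 1 (fun w => f w + g w) (a + b).
Proof. by move=> fa gb; exact: (@is_deriveD C C C f g). Qed.

Lemma is_deriveCB (f g : C -> C) z (a b : C) :
  is_derive z 1 f a -> is_derive z 1 g b ->
  is_derive z 1 (fun w => f w - g w) (a - b).
Proof. by move=> fa gb; exact: (@is_deriveB C C C f g). Qed.

Lemma is_deriveCM (f g : C -> C) z (a b : C) :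
  is_derive z 1 f a -> is_derive z 1 g b ->
  is_derive z 1 (fun w => f w * g w) (f z * b + g z * a).
Proof. by move=> fa gb; exact: (@is_deriveM C C f g). Qed.

Lemma is_deriveCZ (c : C) (f : C -> C) z (a : C) :
  is_derive z 1 f a -> is_derive z 1 (fun w => c * f w) (c * a).
Proof. by move=> fa; exact: (@is_deriveZ C C C f c). Qed.

Lemma is_deriveCV (f : C -> C) z (a : C) : f z != 0 ->
  is_derive z 1 f a -> is_derive z 1 (fun w => (f w)^-1) (- a / f z ^+ 2).
Proof.
move=> fz [df fa]; split; first exact: derivableV.
by rewrite deriveV// fa -[_ *: _]/(_ * _) mulrC mulNr mulrN.
Qed.

Lemma is_deriveC_cst (c : C) z : is_derive z 1 (fun _ : C => c) (0 : C).
Proof. exact: is_derive_cst. Qed.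

Lemma is_deriveC_id z : is_derive z 1 (fun w : C => w) (1 : C).
Proof. exact: is_derive_id. Qed.

Lemma is_deriveC_eq (f : C -> C) z (a b : C) : a = b ->
  is_derive z 1 f a -> is_derive z 1 f b.
Proof. by move=> ->. Qed.

Lemma is_deriveC_near (f g : C -> C) z (a : C) e : 0 < e ->
  (forall w, nc (w - z) < e -> f w = g w) ->
  is_derive z 1 f a -> is_derive z 1 g a.
Proof.
move=> e0 fg /is_deriveCP fa; apply/is_deriveCP => e' e'0.
have [d d0 H] := fa _ e'0.
exists (Num.min d e); first by rewrite lt_min d0.
move=> h; rewrite lt_min => /andP[hd he].
have <- : f z = g z by apply: fg; rewrite subrr nc0.
have <- : f (z + h) = g (z + h) by apply: fg; rewrite addrC addKr.
exact: H.
Qed.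

End Basics.

Arguments Normc.normc : simpl never.

(** * Integrals over real intervals *)

Section RealVariable.
Variable R : realType.
Local Notation C := R[i].
Implicit Types (a b c t x y e d : R) (z w : C).

Lemma is_deriveRP (f : R -> R) x a :
  is_derive x 1 f a <-> forall e, 0 < e -> exists2 d, 0 < d &
    forall h, `|h| < d -> `|f (x + h) - f x - a * h| <= e * `|h|.
Proof.
pose g h := h^-1 *: (f (h *: 1 + x) - f x).
have gE h : h != 0 -> `|g h - a| = `|f (x + h) - f x - a * h| / `|h|.
  move=> h0; rewrite /g -normfV -normrM -[h *: 1]/(h * 1) mulr1 (addrC h).
  by congr (`|_|); rewrite -[_ *: _]/(_ * _); field.
have H : g @ 0^' --> a <-> forall e, 0 < e -> exists2 d, 0 < d &
    forall h, `|h| < d -> `|f (x + h) - f x - a * h| <= e * `|h|.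
  split => [/cvgrPdist_lt ga e e0|ga].
    have /nbhs_normP[d d0 dP] := ga _ e0; exists d => // h hd.
    have [->|h0] := eqVneq h 0.
      by rewrite addr0 subrr mulr0 subr0 normr0 mulr0.
    have := dP h; rewrite /ball_/= sub0r normrN => /(_ hd h0).
    by rewrite distrC gE// ltr_pdivrMr ?normr_gt0// => /ltW.
  apply/cvgrPdist_lt => e e0; have [|d d0 dP] := ga (e / 2); first by rewrite divr_gt0.
  apply/nbhs_normP; exists d => // h; rewrite /ball_/= sub0r normrN => hd h0.
  rewrite distrC gE// ltr_pdivrMr ?normr_gt0//; apply: le_lt_trans (dP _ hd) _.
  by rewrite ltr_pM2r ?normr_gt0//; lra.
rewrite -H; split => [[df <-]|ga]; first exact: df.
by split; [apply/cvg_ex; exists a|exact/cvg_lim].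
Qed.

Lemma is_derive_Re_real (G : C -> C) t z : is_derive (t%:C)%C 1 G z ->
  is_derive t 1 (fun s => complex.Re (G s%:C%C)) (complex.Re z).
Proof.
move=> /is_deriveCP H; apply/is_deriveRP => e e0; have [d d0 dP] := H _ e0.
exists d => // h hd; have := dP (h%:C)%C; rewrite nc_real => /(_ hd).
apply: le_trans; apply: (le_trans _ (Re_le_nc _)); rewrite -rmorphD /=.
by rewrite !cReD !cReN cReM /= mulr0 subr0.
Qed.

Lemma is_derive_Im_real (G : C -> C) t z : is_derive (t%:C)%C 1 G z ->
  is_derive t 1 (fun s => complex.Im (G s%:C%C)) (complex.Im z).
Proof.
move=> /is_deriveCP H; apply/is_deriveRP => e e0; have [d d0 dP] := H _ e0.
exists d => // h hd; have := dP (h%:C)%C; rewrite nc_real => /(_ hd).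
apply: le_trans; apply: (le_trans _ (Im_le_nc _)); rewrite -rmorphD /=.
by rewrite !cImD !cImN cImM /= mulr0 add0r.
Qed.

Lemma Re_continuous : continuous (@complex.Re R : C -> R).
Proof.
move=> z; apply: contCR => e e0; exists e => // w wz.
by rewrite -cReN -cReD (le_lt_trans (Re_le_nc _)).
Qed.

Lemma Im_continuous : continuous (@complex.Im R : C -> R).
Proof.
move=> z; apply: contCR => e e0; exists e => // w wz.
by rewrite -cImN -cImD (le_lt_trans (Im_le_nc _)).
Qed.

Lemma nc_continuous : continuous (@nc R : C -> R).
Proof.
move=> z; apply: contCR => e e0; exists e => // w wz.
by rewrite (le_lt_trans _ wz)// ler_norml lerNl opprB ncBl andbT ncB ncBl.
Qed.

Lemma realC_continuous : continuous (fun t : R => (t%:C)%C : C).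
Proof.
move=> t; apply/contRC => e e0; exists e => // s.
by rewrite -(nc_real (s - t)) rmorphB.
Qed.

Lemma conjc_continuous : continuous (@conjc R : C -> C).
Proof.
move=> z; apply/contCP => e e0; exists e => // w.
by rewrite -rmorphB /= nc_conj.
Qed.

(** Continuity is two-sided, also at the end points: stronger than continuity within the segment,
    and it composes without any subspace topology. *)
Definition cont_on (T : topologicalType) a b (g : R -> T) :=
  forall t, a <= t <= b -> {for t, continuous g}.

Definition RI a b (g : R -> R) : R := \int[lebesgue_measure]_(t in `[a, b]) g t.

Lemma cont_on_within (T : topologicalType) a b (g : R -> T) :
  cont_on a b g -> {within `[a, b], continuous g}.
Proof.
move=> cg; apply: continuous_in_subspaceT => t /set_mem /=.
by rewrite in_itv; exact: cg.
Qed.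

Lemma cont_on_integrable a b (g : R -> R) : cont_on a b g ->
  lebesgue_measure.-integrable `[a, b] (EFin \o g).
Proof.
move=> /cont_on_within cg; apply: continuous_compact_integrable => //.
exact: segment_compact.
Qed.

Lemma eq_RI a b (g h : R -> R) : (forall t, a <= t <= b -> g t = h t) ->
  RI a b g = RI a b h.
Proof.
by move=> gh; apply: eq_Rintegral => t /set_mem /=; rewrite in_itv; exact: gh.
Qed.

Lemma RI_D a b (g h : R -> R) : cont_on a b g -> cont_on a b h ->
  RI a b (fun t => g t + h t) = RI a b g + RI a b h.
Proof. by move=> cg ch; rewrite /RI RintegralD//; exact: cont_on_integrable. Qed.

Lemma RI_B a b (g h : R -> R) : cont_on a b g -> cont_on a b h ->
  RI a b (fun t => g t - h t) = RI a b g - RI a b h.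
Proof. by move=> cg ch; rewrite /RI RintegralB//; exact: cont_on_integrable. Qed.

Lemma RI_Z a b c (g : R -> R) : cont_on a b g ->
  RI a b (fun t => c * g t) = c * RI a b g.
Proof. by move=> cg; rewrite /RI RintegralZl//; exact: cont_on_integrable. Qed.

Lemma RI_N a b (g : R -> R) : cont_on a b g ->
  RI a b (fun t => - g t) = - RI a b g.
Proof.
move=> cg; rewrite -[RHS]mulN1r -RI_Z//.
by apply: eq_RI => t _; rewrite mulN1r.
Qed.

Lemma RI_cst a b c : a <= b -> RI a b (fun _ => c) = c * (b - a).
Proof.
move=> ab; rewrite /RI Rintegral_cst//= lebesgue_measure_itv /= lte_fin.
by case: ltgtP ab => [ab _|//|-> _]; rewrite ?subrr ?mulr0.
Qed.

Lemma RI_le a b (g h : R -> R) : cont_on a b g -> cont_on a b h ->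
  (forall t, a <= t <= b -> g t <= h t) -> RI a b g <= RI a b h.
Proof.
move=> cg ch gh; apply: le_Rintegral => [//|||t /=]; try exact: cont_on_integrable.
by rewrite in_itv; exact: gh.
Qed.

Lemma RI_ge0 a b (g : R -> R) :
  (forall t, a <= t <= b -> 0 <= g t) -> 0 <= RI a b g.
Proof.
by move=> g0; apply: Rintegral_ge0 => t /=; rewrite in_itv; exact: g0.
Qed.

Lemma RI_split a c b (g : R -> R) : a <= c -> c <= b -> cont_on a b g ->
  RI a b g = RI a c g + RI c b g.
Proof.
move=> ac cb cg; apply/eqP; rewrite addrC -subr_eq; apply/eqP.
have ig := cont_on_integrable cg.
rewrite /RI Rintegral_itvB ?bnd_simp//.
rewrite Rintegral_itv_obnd_cbnd//.
by apply: (integrableS _ _ _ ig) => //; apply: subset_itvr; rewrite bnd_simp.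
Qed.

Lemma RI_FTC a b (G g : R -> R) : a <= b -> cont_on a b g ->
  (forall t, a <= t <= b -> is_derive t 1 G (g t)) -> RI a b g = G b - G a.
Proof.
rewrite le_eqVlt => /predU1P[<- _ _|ab cg dG].
  by rewrite /RI set_itv1 Rintegral_set1 subrr.
have Gc t : a <= t <= b -> {for t, continuous G}.
  move=> /dG[dGt _]; apply: differentiable_continuous.
  exact/derivable1_diffP.
rewrite /RI /Rintegral (@continuous_FTC2 _ g G)//.
- exact: cont_on_within.
- split => //.
  + move=> t; rewrite in_itv /= => /andP[/ltW at_ /ltW tb].
    by have [|] := dG t; first by rewrite at_.
  + by apply: cvg_at_right_filter; apply: Gc; rewrite lexx ltW.
  + by apply: cvg_at_left_filter; apply: Gc; rewrite lexx ltW.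
- move=> t; rewrite in_itv /= => /andP[/ltW at_ /ltW tb].
  have [|_ <-] := dG t; first by rewrite at_.
  by rewrite derive1E.
Qed.

Lemma RI_gt0 a b t0 (g : R -> R) : a < b -> a <= t0 <= b -> cont_on a b g ->
  (forall t, a <= t <= b -> 0 <= g t) -> 0 < g t0 -> 0 < RI a b g.
Proof.
move=> ab t0ab cg g0 gt0.
have /cvgrPdist_lt/(_ (g t0 / 2)) := cg _ t0ab.
rewrite divr_gt0// => /(_ isT)/nbhs_normP[d d0 dP].
move: d0 => /= d0; pose u := Num.max a (t0 - d / 2); pose v := Num.min b (t0 + d / 2).
have /andP[at0 t0b] := t0ab.
have uv : u < v by rewrite /u /v lt_min !gt_max ab /=; apply/andP; split; [|apply/andP; split]; lra.
have au : a <= u by rewrite le_max lexx.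
have vb : v <= b by rewrite ge_min lexx.
have sub1 s t x y : a <= s -> y <= b -> s <= x -> x <= y -> cont_on s y g.
  by move=> ? ? ? ? q /andP[sq qy]; apply: cg; apply/andP; split; lra.
rewrite (@RI_split a u b)//; [|lra]; rewrite (@RI_split u v b)//; [|lra|]; last first.
  by apply: (sub1 u u v) => //; lra.
apply: ltr_wpDl; first by apply: RI_ge0 => t /andP[? ?]; apply: g0; apply/andP; split; lra.
apply: ltr_pwDl; last first.
  by apply: RI_ge0 => t /andP[? ?]; apply: g0; apply/andP; split; lra.
apply: (@lt_le_trans _ _ (RI u v (fun _ => g t0 / 2))).
  by rewrite RI_cst ?ltW// mulr_gt0 ?divr_gt0// subr_gt0.
apply: RI_le => [t _||t /andP[ut tv]]; first exact: cst_continuous.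
  by apply: (sub1 u u u) => //; lra.
have : `|g t0 - g t| < g t0 / 2.
  apply: dP; rewrite /ball_/=.
  move: ut tv; rewrite ge_max le_min => /andP[? ?] /andP[? ?].
  by rewrite ltr_norml; apply/andP; split; lra.
by rewrite ltr_norml => /andP[? ?]; lra.
Qed.

Definition CI a b (g : R -> C) : C :=
  (RI a b (fun t => complex.Re (g t)) +i* RI a b (fun t => complex.Im (g t)))%C.

Lemma cont_on_Re a b (g : R -> C) : cont_on a b g ->
  cont_on a b (fun t => complex.Re (g t)).
Proof.
by move=> cg t /cg gt; apply: (continuous_comp gt); exact: Re_continuous.
Qed.

Lemma cont_on_Im a b (g : R -> C) : cont_on a b g ->
  cont_on a b (fun t => complex.Im (g t)).
Proof.
by move=> cg t /cg gt; apply: (continuous_comp gt); exact: Im_continuous.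
Qed.

Lemma eq_CI a b (g h : R -> C) : (forall t, a <= t <= b -> g t = h t) ->
  CI a b g = CI a b h.
Proof. by move=> gh; congr Complex; apply: eq_RI => t /gh ->. Qed.

Lemma CI_D a b (g h : R -> C) : cont_on a b g -> cont_on a b h ->
  CI a b (fun t => g t + h t) = CI a b g + CI a b h.
Proof.
move=> cg ch; apply/eqP; rewrite eq_complex cReD cImD /= -!RI_D;
  try exact: cont_on_Re; try exact: cont_on_Im.
by apply/andP; split; apply/eqP; apply: eq_RI => t _; rewrite ?cReD ?cImD.
Qed.

Lemma contM_cst (T : topologicalType) (g : T -> C) (u : T) z :
  {for u, continuous g} -> {for u, continuous (fun v => z * g v)}.
Proof. by move=> gu; apply: (@cvgM C T _ _ (fun _ => z) g _ _ _ gu); exact: cvg_cst. Qed.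

Lemma CI_Z a b z (g : R -> C) : cont_on a b g ->
  CI a b (fun t => z * g t) = z * CI a b g.
Proof.
move=> cg; have cr := cont_on_Re cg; have ci := cont_on_Im cg.
have crZ k : cont_on a b (fun t => k * complex.Re (g t)).
  by move=> t /cr gt; apply: cvgM => //; exact: cvg_cst.
have ciZ k : cont_on a b (fun t => k * complex.Im (g t)).
  by move=> t /ci gt; apply: cvgM => //; exact: cvg_cst.
apply/eqP; rewrite eq_complex cReM cImM /= -!RI_Z// -RI_B// -RI_D//.
by apply/andP; split; apply/eqP; apply: eq_RI => t _; rewrite ?cReM ?cImM.
Qed.

Lemma CI_B a b (g h : R -> C) : cont_on a b g -> cont_on a b h ->
  CI a b (fun t => g t - h t) = CI a b g - CI a b h.
Proof.
move=> cg ch; have := @CI_Z a b (-1) _ ch; rewrite mulN1r => <-.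
rewrite -CI_D; [by apply: eq_CI => t _; rewrite mulN1r|exact: cg|].
by move=> t /ch; exact: contM_cst.
Qed.

Lemma CI_split a c b (g : R -> C) : a <= c -> c <= b -> cont_on a b g ->
  CI a b g = CI a c g + CI c b g.
Proof.
move=> ac cb cg; apply/eqP; rewrite eq_complex cReD cImD /= -!RI_split// ?eqxx//.
- exact: cont_on_Im.
- exact: cont_on_Re.
Qed.

Lemma CI_cst a b z : a <= b -> CI a b (fun _ => z) = (b - a)%:C%C * z.
Proof.
move=> ab; apply/eqP; rewrite eq_complex cReM cImM /= !RI_cst// !mul0r subr0 addr0.
by rewrite ![_ * (b - a)]mulrC !eqxx.
Qed.

Lemma RI_norm a b (g : R -> R) : cont_on a b g ->
  `|RI a b g| <= RI a b (fun t => `|g t|).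
Proof. by move=> cg; apply: le_normr_Rintegral => //; exact: cont_on_integrable. Qed.

Lemma cont_on_norm a b (g : R -> R) : cont_on a b g ->
  cont_on a b (fun t => `|g t|).
Proof. by move=> cg t /cg gt; apply: cvg_norm. Qed.

Lemma CI_nc_le a b (g : R -> C) (k : R -> R) : cont_on a b g ->
  cont_on a b k -> (forall t, a <= t <= b -> nc (g t) <= k t) ->
  nc (CI a b g) <= 2 * RI a b k.
Proof.
move=> cg ck gk; have cr := cont_on_Re cg; have ci := cont_on_Im cg.
rewrite (le_trans (nc_le_ReIm _))//= mulrDl mul1r.
by apply: lerD; apply: (le_trans (RI_norm _)) => //;
  apply: RI_le => // [|t /gk]; try exact: cont_on_norm; apply: le_trans;
  rewrite ?Re_le_nc ?Im_le_nc.
Qed.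

Lemma CI_nc_le_cst a b (g : R -> C) k : a <= b -> cont_on a b g ->
  (forall t, a <= t <= b -> nc (g t) <= k) ->
  nc (CI a b g) <= 2 * (k * (b - a)).
Proof.
move=> ab cg gk; rewrite -RI_cst//; apply: CI_nc_le => // t _.
exact: cst_continuous.
Qed.

Lemma CI_FTC a b (G g : C -> C) : a <= b ->
  cont_on a b (fun t => g t%:C%C) ->
  (forall t, a <= t <= b -> is_derive (t%:C)%C 1 G (g t%:C%C)) ->
  CI a b (fun t => g t%:C%C) = G b%:C%C - G a%:C%C.
Proof.
move=> ab cg dG; apply/eqP; rewrite eq_complex cReD cImD cReN cImN /=.
have -> : RI a b (fun t => complex.Re (g t%:C%C)) =
    complex.Re (G b%:C%C) - complex.Re (G a%:C%C).
  apply: (@RI_FTC a b (fun t => complex.Re (G t%:C%C))) => //.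
    exact: cont_on_Re.
  by move=> t /dG; exact: is_derive_Re_real.
have -> : RI a b (fun t => complex.Im (g t%:C%C)) =
    complex.Im (G b%:C%C) - complex.Im (G a%:C%C).
  apply: (@RI_FTC a b (fun t => complex.Im (G t%:C%C))) => //.
    exact: cont_on_Im.
  by move=> t /dG; exact: is_derive_Im_real.
by rewrite !eqxx.
Qed.

End RealVariable.

(** * Cauchy's theorem for a deformed rectangle *)

Section Goursat.
Variable R : realType.
Local Notation C := R[i].
Implicit Types (P : R -> R -> C) (k : R -> C) (A B : C).

(* Total differentiability of a map of two real variables, with complex partial
   derivatives [A] and [B]. *)
Definition diff2 P (x0 y0 : R) A B := forall e : R, 0 < e -> exists2 d : R, 0 < d &
  forall x y, `|x - x0| < d -> `|y - y0| < d ->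
  nc (P x y - P x0 y0 - (A * (x - x0)%:C%C + B * (y - y0)%:C%C)) <=
    e * (`|x - x0| + `|y - y0|).

Lemma diff2_lip P x0 y0 A B : diff2 P x0 y0 A B -> exists2 d : R, 0 < d &
  forall x y, `|x - x0| < d -> `|y - y0| < d ->
  nc (P x y - P x0 y0) <= (nc A + nc B + 1) * (`|x - x0| + `|y - y0|).
Proof.
move=> H; have [d d0 dP] := H 1 ltr01; exists d => // x y xd yd.
have := dP x y xd yd; rewrite mul1r => h.
rewrite -[P x y - _](subrK (A * (x - x0)%:C%C + B * (y - y0)%:C%C)).
rewrite (le_trans (ncD _ _))// mulrDl mul1r addrC lerD//.
rewrite (le_trans (ncD _ _))// !ncM !nc_real mulrDr.
apply: lerD; apply: ler_wpM2r => //; rewrite ?lerDl ?lerDr ?nc_ge0//.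
Qed.

Lemma diff2_comp P x0 y0 A B (f : C -> C) (a : C) : diff2 P x0 y0 A B ->
  is_derive (P x0 y0) 1 f a -> diff2 (fun x y => f (P x y)) x0 y0 (a * A) (a * B).
Proof.
move=> dP /is_deriveCP df e e0.
have [d1 d10 lipP] := diff2_lip dP.
set L := nc A + nc B + 1 in lipP.
have L0 : 0 < L by rewrite ltr_wpDl ?addr_ge0 ?nc_ge0.
have [d2 d20 fP] := df (e / (2 * L)) (divr_gt0 e0 (mulr_gt0 (ltr0Sn R 1) L0)).
have M0 : 0 < nc a + 1 by rewrite ltr_wpDl ?nc_ge0.
have [d3 d30 PP] := dP (e / (2 * (nc a + 1))) (divr_gt0 e0 (mulr_gt0 (ltr0Sn R 1) M0)).
pose d := Num.min d1 (Num.min d3 (d2 / (2 * L))).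
have d0 : 0 < d by rewrite !lt_min d10 d30 divr_gt0// mulr_gt0.
exists d => // x y; rewrite !lt_min => /and3P[x1 x3 x2] /and3P[y1 y3 y2].
set s := `|x - x0| + `|y - y0|.
have s0 : 0 <= s by rewrite addr_ge0.
have lk := lipP _ _ x1 y1; set h := P x y - P x0 y0 in lk.
have hd : nc h < d2.
  rewrite (le_lt_trans lk)// mulrC -ltr_pdivlMr//.
  have -> : d2 / L = d2 / (2 * L) + d2 / (2 * L) by field; rewrite gt_eqF.
  by rewrite /s ltrD.
have := fP _ hd; have -> : P x0 y0 + h = P x y by rewrite addrC subrK.
move=> fh; have PPh := PP _ _ x3 y3; rewrite -/h -/s in PPh.
set l := A * _ + B * _ in PPh.
have -> : f (P x y) - f (P x0 y0) - (a * A * (x - x0)%:C%C + a * B * (y - y0)%:C%C)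
  = (f (P x y) - f (P x0 y0) - a * h) + a * (h - l) by rewrite /l; ring.
rewrite (le_trans (ncD _ _))// ncM.
have -> : e * s = e / (2 * L) * (L * s) + (nc a + 1) * (e / (2 * (nc a + 1)) * s).
  by field; rewrite !gt_eqF.
apply: lerD.
  by rewrite (le_trans fh)// ler_wpM2l// ltW// divr_gt0// mulr_gt0.
by apply: ler_pM => //; rewrite ?nc_ge0// lerDl.
Qed.

Lemma realC_subK (x y : R) : (y%:C + (x - y)%:C)%C = (x%:C)%C.
Proof. by rewrite -rmorphD addrC subrK. Qed.

Lemma diff2_mul (E H : C -> C) (x0 y0 : R) (a b : C) :
  is_derive (x0%:C)%C 1 E a -> is_derive (y0%:C)%C 1 H b ->
  diff2 (fun x y => E x%:C%C * H y%:C%C) x0 y0 (a * H y0%:C%C) (E x0%:C%C * b).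
Proof.
move=> /is_deriveCP dE dH e e0.
have cH := (contCP _ _).1 (is_derive_contC dH).
move/is_deriveCP in dH.
set h0 := H y0%:C%C; set e0' := E x0%:C%C.
pose K := nc h0 + 1 + nc a + 1 + nc e0' + 1.
have K0 : 0 < K by rewrite /K; have := nc_ge0 h0; have := nc_ge0 a; have := nc_ge0 e0'; lra.
pose e1 := Num.min 1 (e / K).
have e10 : 0 < e1 by rewrite lt_min ltr01 divr_gt0.
have [d1 d10 EP] := dE _ e10; have [d2 d20 HP] := dH _ e10.
have [d3 d30 cHP] := cH _ e10.
exists (Num.min d1 (Num.min d2 d3)); first by rewrite !lt_min d10 d20.
move=> x y; rewrite !lt_min => /and3P[x1 x2 x3] /and3P[y1 y2 y3].
have := EP (x - x0)%:C%C; rewrite realC_subK nc_real => /(_ x1) Ex.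
have := HP (y - y0)%:C%C; rewrite realC_subK nc_real => /(_ y2) Hy.
have := cHP y%:C%C; rewrite -rmorphB nc_real => /(_ y3) Hc.
rewrite -/h0 -/e0' in Ex Hy Hc *.
set dx := (x - x0)%:C%C in Ex *; set dy := (y - y0)%:C%C in Hy *.
set u := E x%:C%C in Ex *; set v := H y%:C%C in Hy Hc *.
have -> : u * v - e0' * h0 - (a * h0 * dx + e0' * b * dy) =
  (u - e0' - a * dx) * v + a * dx * (v - h0) + e0' * (v - h0 - b * dy) by ring.
have nv : nc v <= nc h0 + 1.
  rewrite -[v](subrK h0) addrC (le_trans (ncD _ _))// lerD2l (le_trans (ltW Hc))//.
  by rewrite ge_min lexx.
apply: (@le_trans _ _ (e1 * `|x - x0| * (nc h0 + 1) + nc a * `|x - x0| * e1 +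
   nc e0' * (e1 * `|y - y0|))).
  rewrite (le_trans (ncD _ _))// lerD//; last by rewrite ncM ler_wpM2l ?nc_ge0.
  rewrite (le_trans (ncD _ _))// !ncM lerD//.
    by apply: ler_pM => //; rewrite ?nc_ge0.
  by rewrite /dx nc_real ler_wpM2l ?mulr_ge0 ?nc_ge0// ltW.
apply: (@le_trans _ _ (e1 * (K * (`|x - x0| + `|y - y0|)))).
  have -> : e1 * `|x - x0| * (nc h0 + 1) + nc a * `|x - x0| * e1 + nc e0' * (e1 * `|y - y0|)
    = e1 * ((nc h0 + 1 + nc a) * `|x - x0| + nc e0' * `|y - y0|) by ring.
  rewrite ler_wpM2l ?(ltW e10)// mulrDr; apply: lerD; apply: ler_wpM2r => //;
   rewrite /K; have := nc_ge0 h0; have := nc_ge0 a; have := nc_ge0 e0'; lra.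
rewrite mulrA ler_wpM2r ?addr_ge0//.
have -> : e = e / K * K by rewrite divfK// gt_eqF.
by rewrite ler_wpM2r ?(ltW K0)// ge_min lexx orbT.
Qed.

Lemma diff2_contx P x0 y0 A B : diff2 P x0 y0 A B ->
  {for x0, continuous (fun x => P x y0)}.
Proof.
move=> /diff2_lip[d d0 dP]; apply/contRC => e e0.
set L := nc A + nc B + 1 in dP.
have L0 : 0 < L by rewrite ltr_wpDl ?addr_ge0 ?nc_ge0.
exists (Num.min d (e / L)); first by rewrite lt_min d0 divr_gt0.
move=> x; rewrite lt_min => /andP[xd xe].
have := dP x y0 xd; rewrite subrr normr0 addr0 => /(_ d0) H.
by rewrite (le_lt_trans H)// mulrC -ltr_pdivlMr.
Qed.

Lemma diff2_conty P x0 y0 A B : diff2 P x0 y0 A B ->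
  {for y0, continuous (fun y => P x0 y)}.
Proof.
move=> /diff2_lip[d d0 dP]; apply/contRC => e e0.
set L := nc A + nc B + 1 in dP.
have L0 : 0 < L by rewrite ltr_wpDl ?addr_ge0 ?nc_ge0.
exists (Num.min d (e / L)); first by rewrite lt_min d0 divr_gt0.
move=> y; rewrite lt_min => /andP[yd ye].
have := dP x0 y; rewrite subrr normr0 add0r => /(_ d0 yd) H.
by rewrite (le_lt_trans H)// mulrC -ltr_pdivlMr.
Qed.

Lemma nested_intervals (u v : nat -> R) :
  (forall n, u n <= u n.+1) -> (forall n, v n.+1 <= v n) ->
  (forall n, u n <= v n) -> exists X, forall n, u n <= X <= v n.
Proof.
move=> uS vS uv.
have uM m n : (m <= n)%N -> u m <= u n.
  by elim: n => [|n IH]; [rewrite leqn0 => /eqP ->|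
    rewrite leq_eqVlt => /predU1P[->//|/IH h]; exact: le_trans h (uS n)].
have vM m n : (m <= n)%N -> v n <= v m.
  by elim: n => [|n IH]; [rewrite leqn0 => /eqP ->|
    rewrite leq_eqVlt => /predU1P[->//|/IH h]; exact: le_trans (vS n) h].
have ub n : ubound (range u) (v n).
  move=> _ [m _ <-]; have [mn|nm] := leqP m n.
    exact: le_trans (uM _ _ mn) (uv n).
  exact: le_trans (uv m) (vM _ _ (ltnW nm)).
have hs : has_sup (range u) by split; [exists (u 0%N), 0%N|exists (v 0%N)].
exists (sup (range u)) => n; apply/andP; split.
  by apply: sup_upper_bound => //; exists n.
by apply: ge_sup => //; exists (u 0%N), 0%N.
Qed.

(** Goursat's argument needs only two properties of the boundary integral: additivity when a
    rectangle is cut in four, and smallness of higher order than the area near each point. [K] may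
    depend on the point but not on [e]. *)
Lemma goursat_bisection (J : R -> R -> R -> R -> C) (a b c d : R) :
  (forall x y u v, a <= x -> 0 <= u -> x + (u + u) <= b ->
    c <= y -> 0 <= v -> y + (v + v) <= d ->
    J x (x + (u + u)) y (y + (v + v)) =
      (J x (x + u) y (y + v) + J (x + u) (x + u + u) y (y + v)) +
      (J x (x + u) (y + v) (y + v + v) + J (x + u) (x + u + u) (y + v) (y + v + v))) ->
  (forall X Y, a <= X <= b -> c <= Y <= d -> exists2 K : R, 0 < K &
    forall e : R, 0 < e -> e <= 1 -> exists2 r : R, 0 < r & forall x1 x2 y1 y2,
    a <= x1 -> x1 <= X -> X <= x2 -> x2 <= b ->
    c <= y1 -> y1 <= Y -> Y <= y2 -> y2 <= d ->
    (x2 - x1) + (y2 - y1) < r ->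
    nc (J x1 x2 y1 y2) <= e * K * ((x2 - x1) + (y2 - y1)) ^+ 2) ->
  a <= b -> c <= d -> J a b c d = 0.
Proof.
move=> J4 Jsmall ab cd; apply/eqP; rewrite -nc_eq0.
apply: contraT => J0; exfalso.
set eta := nc (J a b c d) in J0.
have eta0 : 0 < eta by rewrite lt_neqAle nc_ge0 eq_sym J0.
pose w := b - a; pose h := d - c.
have w0 : 0 <= w by rewrite subr_ge0.
have h0 : 0 <= h by rewrite subr_ge0.
pose q n : R := 2^-1 ^+ n.
have q0 n : 0 < q n by rewrite exprn_gt0// invr_gt0.
have qS n : q n = q n.+1 + q n.+1 by rewrite /q exprSr; field.
(* [p] is the lower left corner of a rectangle of generation [n]; being bad means to carry at least
   the share [4^-n] of the total [eta]. One of the four quarters of a bad rectangle is bad again. *)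
pose bad n (p : R * R) := [/\ a <= p.1, p.1 + w * q n <= b, c <= p.2,
  p.2 + h * q n <= d & eta * q n ^+ 2 <=
   nc (J p.1 (p.1 + w * q n) p.2 (p.2 + h * q n))].
pose next n (p p' : R * R) := bad n.+1 p' /\
  [/\ p.1 <= p'.1, p'.1 + w * q n.+1 <= p.1 + w * q n,
     p.2 <= p'.2 & p'.2 + h * q n.+1 <= p.2 + h * q n].
have step n p : bad n p -> exists p', next n p p'.
  move: p => [x y] [/= ax xb cy yd Jb].
  have wq : 0 <= w * q n.+1 by rewrite mulr_ge0// ltW.
  have hq : 0 <= h * q n.+1 by rewrite mulr_ge0// ltW.
  have wE : w * q n = w * q n.+1 + w * q n.+1 by rewrite (qS n); ring.
  have hE : h * q n = h * q n.+1 + h * q n.+1 by rewrite (qS n); ring.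
  rewrite wE hE in xb yd Jb.
  set u := w * q n.+1 in wq wE xb Jb; set v := h * q n.+1 in hq hE yd Jb.
  have bad4 i j : 0 <= i <= u -> 0 <= j <= v -> eta * q n.+1 ^+ 2 <=
      nc (J (x + i) (x + i + u) (y + j) (y + j + v)) -> next n (x, y) (x + i, y + j).
    move=> /andP[i0 iu] /andP[j0 jv] Jp.
    have xiu : x + i + u <= x + (u + u) by rewrite -addrA lerD2l lerD2r.
    have yjv : y + j + v <= y + (v + v) by rewrite -addrA lerD2l lerD2r.
    have xi : x <= x + i by rewrite lerDl.
    have yj : y <= y + j by rewrite lerDl.
    split; split; rewrite /= -/u -/v ?wE ?hE //.
    - exact: le_trans xi.
    - exact: le_trans xb.
    - exact: le_trans yj.
    - exact: le_trans yd.
  have [H|H1] := leP (eta * q n.+1 ^+ 2) (nc (J x (x + u) y (y + v))).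
    by exists (x + 0, y + 0); apply: bad4; rewrite ?lexx ?addr0.
  have [H|H2] := leP (eta * q n.+1 ^+ 2) (nc (J (x + u) (x + u + u) y (y + v))).
    by exists (x + u, y + 0); apply: bad4; rewrite ?lexx ?addr0 ?wq.
  have [H|H3] := leP (eta * q n.+1 ^+ 2) (nc (J x (x + u) (y + v) (y + v + v))).
    by exists (x + 0, y + v); apply: bad4; rewrite ?lexx ?addr0 ?hq.
  have [H|H4] := leP (eta * q n.+1 ^+ 2)
      (nc (J (x + u) (x + u + u) (y + v) (y + v + v))).
    by exists (x + u, y + v); apply: bad4; rewrite ?lexx ?wq ?hq.
  exfalso; move: Jb; rewrite leNgt => /negP; apply.
  rewrite J4//.
  have -> : eta * q n ^+ 2 = (eta * q n.+1 ^+ 2 + eta * q n.+1 ^+ 2) +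
     (eta * q n.+1 ^+ 2 + eta * q n.+1 ^+ 2) by rewrite (qS n); ring.
  apply: le_lt_trans (ncD _ _) _; apply: ltrD.
    by apply: le_lt_trans (ncD _ _) _; exact: ltrD.
  by apply: le_lt_trans (ncD _ _) _; exact: ltrD.
have bad0 : bad 0%N (a, c).
  split; rewrite //= /q expr0 ?mulr1 ?expr1n ?mulr1 /w /h ?subrK//; try lra.
  by rewrite !(addrC _ (_ - _)) !subrK.
(* The default [(a, c)] is never taken along the sequence, because every bad rectangle has a
   successor by [step]. *)
pose nx n p := xget (a, c) [set p' | next n p p'].
pose s := fix s n := if n is m.+1 then nx m (s m) else (a, c).
have sb n : bad n (s n).
  elim: n => [//|n IH] /=; rewrite /nx.
  by case: xgetP => [p' _ []//|H]; have [p' /(H p')] := step _ _ IH.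
have sn n : next n (s n) (s n.+1).
  rewrite /= /nx; case: xgetP => [p' _ //|H].
  by have [p' /(H p')] := step _ _ (sb n).
have [||| X XP] := @nested_intervals (fun n => (s n).1) (fun n => (s n).1 + w * q n).
- by move=> n; have [_ []] := sn n.
- by move=> n; have [_ []] := sn n.
- by move=> n; rewrite lerDl mulr_ge0// ltW.
have [||| Y YP] := @nested_intervals (fun n => (s n).2) (fun n => (s n).2 + h * q n).
- by move=> n; have [_ []] := sn n.
- by move=> n; have [_ []] := sn n.
- by move=> n; rewrite lerDl mulr_ge0// ltW.
have XX : a <= X <= b.
  have := XP 0%N; rewrite /= /q expr0 mulr1 /w => /andP[? ?]; apply/andP; split; lra.
have YY : c <= Y <= d.
  have := YP 0%N; rewrite /= /q expr0 mulr1 /h => /andP[? ?]; apply/andP; split; lra.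
have [K0' K0'0 JK] := Jsmall X Y XX YY.
(* The added 1 keeps [K] positive for a degenerate rectangle. With [e * K <= eta / 2], a small bad
   rectangle around [(X, Y)] contradicts the local bound. *)
pose K := K0' * (w + h + 1) ^+ 2.
have wh1 : 0 < w + h + 1 by apply: ltr_wpDl => //; exact: addr_ge0.
have K0 : 0 < K by rewrite mulr_gt0 ?exprn_gt0.
pose e := Num.min 1 (eta / (2 * K)).
have e0 : 0 < e by rewrite lt_min ltr01 divr_gt0// mulr_gt0.
have [|r r0 rP] := JK e e0; first by rewrite ge_min lexx.
have [n nP] : exists n, (w + h) * q n < r.
  have : (fun n => (w + h) * q n) @ \oo --> (w + h) * 0.
    by apply: cvgMr; apply: cvg_expr; rewrite ger0_norm ?invf_lt1 ?ltr1n.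
  rewrite mulr0 => /cvgrPdist_lt/(_ _ r0)[n _ nP]; exists n.
  have := nP n (leqnn n); rewrite sub0r normrN ger0_norm//.
  by apply: mulr_ge0; [exact: addr_ge0|exact: ltW].
have [n1 n2 n3 n4 n5] := sb n; have /andP[n6 n7] := XP n; have /andP[n8 n9] := YP n.
have := rP _ _ _ _ n1 n6 n7 n2 n3 n8 n9 n4.
have -> : (s n).1 + w * q n - (s n).1 + ((s n).2 + h * q n - (s n).2) = (w + h) * q n.
  by ring.
move=> /(_ nP) /(le_trans n5).
have -> : e * K0' * ((w + h) * q n) ^+ 2 = e * K0' * (w + h) ^+ 2 * q n ^+ 2 by ring.
rewrite ler_pM2r ?exprn_gt0//.
apply/negP; rewrite -ltNge.
apply: (@le_lt_trans _ _ (e * K)).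
  have -> : e * K = e * K0' * (w + h + 1) ^+ 2 by rewrite /K; ring.
  rewrite ler_wpM2l//.
    by rewrite mulr_ge0 ?(ltW e0) ?(ltW K0'0).
  by rewrite ler_pXn2r// ?nnegrE ?(ltW wh1) ?lerDl//; exact: addr_ge0.
apply: (@le_lt_trans _ _ (eta / (2 * K) * K)).
  by rewrite ler_wpM2r ?(ltW K0)// ge_min lexx orbT.
have -> : eta / (2 * K) * K = eta / 2 by field; rewrite gt_eqF.
by rewrite ltr_pdivrMr// ltr_pMr// ltr1n.
Qed.

Section Rectangle.
Variables (P : R -> R -> C) (k : R -> C) (a b c d : R).
Hypothesis kc : continuous k.
Hypothesis dP : forall x y, a <= x <= b -> c <= y <= d ->
  exists A, diff2 P x y A (k y * A).

(** Boundary integral of the form [P dx + k(y) P dy], which is closed because the partial derivative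
    of [P] in [y] is [k(y)] times the one in [x]. *)
Let J x1 x2 y1 y2 := CI x1 x2 (fun x => P x y1 - P x y2) +
  CI y1 y2 (fun y => k y * (P x2 y - P x1 y)).

Let contx y x1 x2 : a <= x1 -> x2 <= b -> c <= y <= d ->
  cont_on x1 x2 (fun x => P x y).
Proof.
move=> ax xb yy x /andP[? ?].
have [|A /diff2_contx//] := dP (x := x) _ yy.
by apply/andP; split; lra.
Qed.

Let conty x y1 y2 : c <= y1 -> y2 <= d -> a <= x <= b ->
  cont_on y1 y2 (fun y => P x y).
Proof.
move=> ax xb xx y /andP[? ?].
have [|A /diff2_conty//] := dP (y := y) xx.
by apply/andP; split; lra.
Qed.

Let contB (f g : R -> C) x1 x2 : cont_on x1 x2 f -> cont_on x1 x2 g ->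
  cont_on x1 x2 (fun t => f t - g t).
Proof. by move=> cf cg t tt; apply: cvgB; [exact: cf|exact: cg]. Qed.

Let contk (f : R -> C) x1 x2 : cont_on x1 x2 f ->
  cont_on x1 x2 (fun t => k t * f t).
Proof. by move=> cf t tt; apply: (@cvgM C R); [exact: kc|exact: cf]. Qed.

Let J_h x1 m x2 y1 y2 : a <= x1 -> x1 <= m -> m <= x2 -> x2 <= b ->
  c <= y1 -> y1 <= y2 -> y2 <= d ->
  J x1 x2 y1 y2 = J x1 m y1 y2 + J m x2 y1 y2.
Proof.
move=> ? ? ? ? ? ? ?.
have yy1 : c <= y1 <= d by apply/andP; split; lra.
have yy2 : c <= y2 <= d by apply/andP; split; lra.
have xx1 : a <= x1 <= b by apply/andP; split; lra.
have xx2 : a <= x2 <= b by apply/andP; split; lra.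
have xxm : a <= m <= b by apply/andP; split; lra.
rewrite /J (@CI_split _ x1 m x2)//; last by apply: contB; exact: contx.
have -> : CI y1 y2 (fun y => k y * (P x2 y - P x1 y)) =
   CI y1 y2 (fun y => k y * (P m y - P x1 y)) +
   CI y1 y2 (fun y => k y * (P x2 y - P m y)).
  rewrite -CI_D; [|by apply: contk; apply: contB; exact: conty..].
  by apply: eq_CI => t _; ring.
by ring.
Qed.

Let J_v x1 x2 y1 m y2 : a <= x1 -> x1 <= x2 -> x2 <= b ->
  c <= y1 -> y1 <= m -> m <= y2 -> y2 <= d ->
  J x1 x2 y1 y2 = J x1 x2 y1 m + J x1 x2 m y2.
Proof.
move=> ? ? ? ? ? ? ?.
have yy1 : c <= y1 <= d by apply/andP; split; lra.
have yy2 : c <= y2 <= d by apply/andP; split; lra.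
have yym : c <= m <= d by apply/andP; split; lra.
have xx1 : a <= x1 <= b by apply/andP; split; lra.
have xx2 : a <= x2 <= b by apply/andP; split; lra.
rewrite /J (@CI_split _ y1 m y2)//; last by apply: contk; apply: contB; exact: conty.
have -> : CI x1 x2 (fun x => P x y1 - P x y2) =
   CI x1 x2 (fun x => P x y1 - P x m) + CI x1 x2 (fun x => P x m - P x y2).
  rewrite -CI_D; [|by apply: contB; exact: contx..].
  by apply: eq_CI => t _; ring.
by ring.
Qed.

(** The linear part of [P] at [(X, Y)] contributes [k(Y) A (x2 - x1) (y1 - y2)] through the
    horizontal sides and the opposite through the vertical ones. The remainders are [e * s] times a
    side, plus the oscillation of [k]; their sum gives the constant. *)
Let J_small X Y A (e : R) : a <= X <= b -> c <= Y <= d -> 0 < e -> e <= 1 ->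
  diff2 P X Y A (k Y * A) -> exists2 r, 0 < r & forall x1 x2 y1 y2,
  a <= x1 -> x1 <= X -> X <= x2 -> x2 <= b ->
  c <= y1 -> y1 <= Y -> Y <= y2 -> y2 <= d ->
  (x2 - x1) + (y2 - y1) < r ->
  nc (J x1 x2 y1 y2) <=
    e * (8 + 2 * nc A + 4 * nc (k Y)) * ((x2 - x1) + (y2 - y1)) ^+ 2.
Proof.
move=> XX YY e0 e1 dA.
have [r1 r10 r1P] := dA _ e0.
have [r2 r20 r2P] := (contRC _ _).1 (kc (x := Y)) _ e0.
exists (Num.min r1 r2); first by rewrite lt_min r10.
move=> x1 x2 y1 y2 ? ? ? ? ? ? ? ?; set s := (x2 - x1) + (y2 - y1).
rewrite lt_min => /andP[s1 s2].
have yy1 : c <= y1 <= d by apply/andP; split; lra.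
have yy2 : c <= y2 <= d by apply/andP; split; lra.
have xx1 : a <= x1 <= b by apply/andP; split; lra.
have xx2 : a <= x2 <= b by apply/andP; split; lra.
have x12 : x1 <= x2 by lra.
have y12 : y1 <= y2 by lra.
have pt x y : x1 <= x <= x2 -> y1 <= y <= y2 ->
  nc (P x y - P X Y - (A * (x - X)%:C%C + k Y * A * (y - Y)%:C%C)) <= e * s.
  move=> /andP[? ?] /andP[? ?].
  have hx : `|x - X| <= x2 - x1 by rewrite ler_norml; apply/andP; split; lra.
  have hy : `|y - Y| <= y2 - y1 by rewrite ler_norml; apply/andP; split; lra.
  apply: le_trans (r1P x y _ _) _.
  - by rewrite (le_lt_trans hx)//; rewrite /s in s1; lra.
  - by rewrite (le_lt_trans hy)//; rewrite /s in s1; lra.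
  - by rewrite ler_wpM2l ?(ltW e0)// /s; lra.
have E1 : nc (CI x1 x2 (fun x => P x y1 - P x y2) -
    (x2 - x1)%:C%C * (k Y * A * (y1 - y2)%:C%C)) <= 2 * (2 * (e * s) * (x2 - x1)).
  rewrite -CI_cst// -CI_B; last 2 first.
  - by apply: contB; exact: contx.
  - by move=> t _; exact: cst_continuous.
  apply: CI_nc_le_cst => //.
    apply: contB; first by apply: contB; exact: contx.
    by move=> t _; exact: cst_continuous.
  move=> x xx; have h1 := pt x y1 xx; have h2 := pt x y2 xx.
  have -> : P x y1 - P x y2 - k Y * A * (y1 - y2)%:C%C =
    (P x y1 - P X Y - (A * (x - X)%:C%C + k Y * A * (y1 - Y)%:C%C)) -
    (P x y2 - P X Y - (A * (x - X)%:C%C + k Y * A * (y2 - Y)%:C%C)).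
    by rewrite !rmorphB; ring.
  rewrite (le_trans (nc_sub_le _ _))// mulrDl !mul1r.
  by apply: lerD; [apply: h1; rewrite lexx|apply: h2; rewrite lexx andbT].
have E2 : nc (CI y1 y2 (fun y => k y * (P x2 y - P x1 y)) -
    (y2 - y1)%:C%C * (k Y * (A * (x2 - x1)%:C%C))) <=
    2 * ((e * (nc A * s) + (nc (k Y) + 1) * (2 * (e * s))) * (y2 - y1)).
  rewrite -CI_cst// -CI_B; last 2 first.
  - by apply: contk; apply: contB; exact: conty.
  - by move=> t _; exact: cst_continuous.
  apply: CI_nc_le_cst => //.
    apply: contB; first by apply: contk; apply: contB; exact: conty.
    by move=> t _; exact: cst_continuous.
  move=> y yy; have h1 : nc (P x1 y - _ - _) <= _ := pt x1 y _ yy.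
  have h2 : nc (P x2 y - _ - _) <= _ := pt x2 y _ yy.
  rewrite lexx in h1; rewrite lexx x12 in h2.
  have {}h1 := h1 x12; have {}h2 := h2 isT.
  have ky : nc (k y - k Y) < e.
    apply: r2P; rewrite ltr_norml; move: yy s2 => /andP[? ?]; rewrite /s => ?.
    by apply/andP; split; lra.
  have kM : nc (k y) <= nc (k Y) + 1.
    rewrite -[k y](subrK (k Y)) addrC (le_trans (ncD _ _))// lerD2l.
    by rewrite (le_trans (ltW ky)).
  have -> : k y * (P x2 y - P x1 y) - k Y * (A * (x2 - x1)%:C%C) =
    (k y - k Y) * (A * (x2 - x1)%:C%C) + k y *
    ((P x2 y - P X Y - (A * (x2 - X)%:C%C + k Y * A * (y - Y)%:C%C)) -
    (P x1 y - P X Y - (A * (x1 - X)%:C%C + k Y * A * (y - Y)%:C%C))).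
    by rewrite !rmorphB; ring.
  rewrite (le_trans (ncD _ _))// !ncM lerD//.
    apply: ler_pM; rewrite ?mulr_ge0 ?nc_ge0 ?(ltW ky)//.
    by rewrite ler_wpM2l ?nc_ge0// nc_pos /s; lra.
  apply: ler_pM; rewrite ?nc_ge0// (le_trans (nc_sub_le _ _))//.
  by rewrite mulrDl !mul1r lerD.
rewrite /J; set I1 := CI x1 x2 _ in E1 *; set I2 := CI y1 y2 _ in E2 *.
have -> : I1 + I2 = (I1 - (x2 - x1)%:C%C * (k Y * A * (y1 - y2)%:C%C)) +
  (I2 - (y2 - y1)%:C%C * (k Y * (A * (x2 - x1)%:C%C))) by rewrite !rmorphB; ring.
rewrite (le_trans (ncD _ _))// (le_trans (lerD E1 E2))//.
have s0 : 0 <= s by rewrite /s; lra.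
have sx : x2 - x1 <= s by rewrite /s; lra.
have sy : y2 - y1 <= s by rewrite /s; lra.
have -> : e * (8 + 2 * nc A + 4 * nc (k Y)) * s ^+ 2 =
  2 * (2 * (e * s) * s) + 2 * ((e * (nc A * s) + (nc (k Y) + 1) * (2 * (e * s))) * s).
  by ring.
apply: lerD; rewrite ler_wpM2l// ler_wpM2l// ?mulr_ge0// ?addr_ge0//;
  by rewrite ?mulr_ge0// ?addr_ge0// ?mulr_ge0// ?nc_ge0// ltW.
Qed.

Let J_4 x y u v : a <= x -> 0 <= u -> x + (u + u) <= b ->
  c <= y -> 0 <= v -> y + (v + v) <= d ->
  J x (x + (u + u)) y (y + (v + v)) =
    (J x (x + u) y (y + v) + J (x + u) (x + u + u) y (y + v)) +
    (J x (x + u) (y + v) (y + v + v) + J (x + u) (x + u + u) (y + v) (y + v + v)).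
Proof.
move=> ax u0 xb cy v0 yd.
have x1 : x <= x + u by rewrite lerDl.
have x2 : x + u <= x + (u + u) by rewrite lerD2l lerDl.
have y1 : y <= y + v by rewrite lerDl.
have y2 : y + v <= y + (v + v) by rewrite lerD2l lerDl.
have ax1 := le_trans ax x1; have x2b := le_trans x2 xb.
have cy1 := le_trans cy y1; have y2d := le_trans y2 yd.
rewrite (J_h ax x1 x2 xb cy (le_trans y1 y2) yd).
rewrite (J_v ax x1 x2b cy y1 y2 yd) (J_v ax1 x2 xb cy y1 y2 yd).
by rewrite -!(addrA x) -!(addrA y) addrACA.
Qed.

(* Goursat's argument for the pull-back of [f(z) dz] along a map whose partial
   derivative in [y] is [k(y)] times the one in [x]: bisecting the rectangle of
   parameters needs neither continuity of [f'] nor path integrals in the plane. *)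
Lemma goursat_rectangle : a <= b -> c <= d ->
  CI a b (fun x => P x c - P x d) + CI c d (fun y => k y * (P b y - P a y)) = 0.
Proof.
apply: (goursat_bisection J_4) => X Y XX YY; have [A dA] := dP XX YY.
exists (8 + 2 * nc A + 4 * nc (k Y)).
  by rewrite !ltr_wpDr// mulr_ge0// nc_ge0.
by move=> e e0 e1; exact: J_small.
Qed.

End Rectangle.
End Goursat.

(** * The exponential and circle means *)

Section Exponential.
Variable R : realType.
Local Notation C := R[i].
Implicit Types (z w h : C) (x y t r : R).

Lemma expCE z : expC z = (expR (complex.Re z) * cos (complex.Im z) +i*
  (expR (complex.Re z) * sin (complex.Im z)))%C.
Proof. by rewrite /expC /=; apply/eqP; rewrite eq_complex /= !mul0r subr0 addr0 !eqxx. Qed.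

Lemma expCD z w : expC (z + w) = expC z * expC w.
Proof.
rewrite !expCE; apply/eqP; rewrite eq_complex cReM cImM /= cReD cImD expRD cosD sinD.
by apply/andP; split; apply/eqP; ring.
Qed.

Lemma expC0 : expC (0 : C) = 1.
Proof. by rewrite expCE /= expR0 cos0 sin0 mulr1 mulr0. Qed.

Lemma nc_expC z : nc (expC z) = expR (complex.Re z).
Proof.
rewrite /expC ncM nc_pos ?expR_ge0// /Normc.normc cos2Dsin2 sqrtr1 mulr1.
by [].
Qed.

Lemma expC_neq0 z : expC z != 0.
Proof. by rewrite -nc_gt0 nc_expC expR_gt0. Qed.

Lemma expC_real x : expC (x%:C)%C = (expR x)%:C%C.
Proof. by rewrite expCE /= cos0 sin0 mulr1 mulr0. Qed.

Lemma is_derive_expC0 : is_derive (0 : C) 1 (@expC R) 1.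
Proof.
apply/is_deriveCP => e e0.
(* The error terms below add up to at most [9 * (e1 * m)], with weights 1, 3, 2 and 3. *)
pose e1 := Num.min 1 (e / 9).
have e10 : 0 < e1 by rewrite lt_min ltr01 divr_gt0.
have e1e : e1 <= e / 9 by rewrite ge_min lexx orbT.
have e11 : e1 <= 1 by rewrite ge_min lexx.
have [d1 d10 H1] := (is_deriveRP _ _ _).1 (is_derive_expR (0 : R)) _ e10.
have [d2 d20 H2] := (is_deriveRP _ _ _).1 (is_derive_cos (0 : R)) _ e10.
have [d3 d30 H3] := (is_deriveRP _ _ _).1 (is_derive_sin (0 : R)) _ e10.
exists (Num.min e1 (Num.min d1 (Num.min d2 d3))).
  by rewrite lt_min e10 lt_min d10 lt_min d20.
case=> x y; set m := nc _; rewrite !lt_min => /and4P[me m1 m2 m3].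
have {}me : m < e1 by rewrite lt_min.
have xm : `|x| <= m := Re_le_nc (x +i* y)%C.
have ym : `|y| <= m := Im_le_nc (x +i* y)%C.
have := H1 _ (le_lt_trans xm m1); rewrite add0r expR0 mul1r => a1.
have := H2 _ (le_lt_trans ym m2); rewrite add0r cos0 sin0 oppr0 mul0r subr0 => a2.
have := H3 _ (le_lt_trans ym m3); rewrite add0r cos0 sin0 subr0 mul1r => a3.
have m0 : 0 <= m := nc_ge0 _.
rewrite add0r expC0 mul1r expCE /=.
set E := expR x in a1 *; set c := cos y in a2 *; set s := sin y in a3 *.
have m1' : m <= 1 := le_trans (ltW me) e11.
have a1' : `|E - 1 - x| <= e1 * m by rewrite (le_trans a1)// ler_wpM2l// ltW.
have a2' : `|c - 1| <= e1 * m by rewrite (le_trans a2)// ler_wpM2l// ltW.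
have a3' : `|s - y| <= e1 * m by rewrite (le_trans a3)// ler_wpM2l// ltW.
have e1m : e1 * m <= m by rewrite ler_piMl.
have E1 : `|E - 1| <= 2 * m.
  have -> : E - 1 = (E - 1 - x) + x by ring.
  rewrite (le_trans (ler_normD _ _))// mulrDl mul1r lerD//.
  exact: le_trans e1m.
have E3 : `|E| <= 3.
  have -> : E = (E - 1) + 1 by ring.
  rewrite (le_trans (ler_normD _ _))// normr1 (_ : 3 = 2 + 1) ?lerD2r; last by ring.
  by rewrite (le_trans E1)// ler_piMr.
apply: le_trans (nc_le_ReIm _) _; rewrite /=.
have -> : E * c - 1 - x = (E - 1 - x) + E * (c - 1) by ring.
have -> : E * s - 0 - y = (E - 1) * y + E * (s - y) by ring.
apply: (@le_trans _ _ ((e1 * m + 3 * (e1 * m)) + (2 * m * m + 3 * (e1 * m)))).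
  apply: lerD; apply: le_trans (ler_normD _ _) _; apply: lerD => //;
    by rewrite normrM ler_pM.
have : m * m <= e1 * m by rewrite ler_wpM2r// ltW.
have : e1 * m <= e / 9 * m by rewrite ler_wpM2r.
clear -m0; set p := e1 * m; set q := m * m; set k := e / 9 * m => pk qp.
have -> : e * m = 9 * k by rewrite /k; field.
have -> : 2 * m * m = 2 * q by rewrite /q mulrA.
by clearbody p q k; lra.
Qed.

Lemma is_derive_expC z : is_derive z 1 (@expC R) (expC z).
Proof.
have H : is_derive (z - z) 1 (@expC R) 1.
  by rewrite subrr; exact: is_derive_expC0.
have Hz : is_derive z 1 (fun w : C => w - z) (1 - 0).
  exact: is_deriveCB (is_deriveC_id z) (is_deriveC_cst z z).
have := is_deriveCZ (expC z) (is_deriveC_comp Hz H).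
rewrite subr0 !mulr1; apply: is_derive_eqf => w.
by rewrite -expCD addrC subrK.
Qed.

Lemma is_derive_expCM (c : C) z : is_derive z 1 (fun w => expC (c * w)) (c * expC (c * z)).
Proof.
have := is_deriveC_comp (is_deriveCZ c (is_deriveC_id z)) (is_derive_expC (c * z)).
by rewrite mulr1 mulrC.
Qed.

Lemma conjcM z w : conjc (z * w) = conjc z * conjc w.
Proof. exact: (rmorphM (@conjc R)). Qed.

Definition circ r t : C := (r%:C * expC (t *i))%C.

Lemma circE r t : circ r t = (r%:C)%C * expC ('i%C * (t%:C)%C).
Proof.
rewrite /circ; congr (_ * expC _); apply/eqP.
by rewrite eq_complex /=; apply/andP; split; apply/eqP; ring.
Qed.

Lemma nc_circ r t : 0 <= r -> nc (circ r t) = r.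
Proof. by move=> r0; rewrite /circ ncM nc_pos// nc_expC /= expR0 mulr1. Qed.

Lemma circ0 r : circ r 0 = (r%:C)%C.
Proof. by rewrite circE mulr0 expC0 mulr1. Qed.

Lemma circ2pi r : circ r (2 * pi) = circ r 0.
Proof.
congr (_ * _); rewrite !expCE /= !expR0 !mul1r mulr_natl cos2pi sin2pi.
by rewrite cos0 sin0.
Qed.

Lemma circD r s t : circ r (s + t) = expC (s *i)%C * circ r t.
Proof.
rewrite /circ [RHS]mulrCA -expCD; congr (_ * expC _).
by apply/eqP; rewrite eq_complex /= addr0 !eqxx.
Qed.

Lemma is_derive_circ r z :
  is_derive z 1 (fun w => (r%:C)%C * expC ('i%C * w))
    ((r%:C)%C * ('i%C * expC ('i%C * z))).
Proof. exact/is_deriveCZ/is_derive_expCM. Qed.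

Lemma circ_continuous r : continuous (circ r).
Proof.
move=> t; have := is_derive_contC (is_derive_circ r (t%:C)%C).
move=> H; have := continuous_comp (@realC_continuous R t) H.
by rewrite (_ : _ \o _ = circ r)//; apply/funext => s /=; rewrite circE.
Qed.

Definition cont_circ (T : topologicalType) r (F : C -> T) :=
  forall z, nc z = r -> {for z, continuous F}.

Lemma cont_circ_on (T : topologicalType) r (F : C -> T) a b : 0 <= r ->
  cont_circ r F -> cont_on a b (fun t => F (circ r t)).
Proof.
move=> r0 cF t _; apply: (continuous_comp (@circ_continuous r t)).
by apply: cF; rewrite nc_circ.
Qed.

Definition mean r (g : C -> R) : R :=
  (2 * pi)^-1 * RI 0 (2 * pi) (fun t => g (circ r t)).

Definition cmean r (F : C -> C) : C :=
  ((2 * pi)^-1)%:C%C * CI 0 (2 * pi) (fun t => F (circ r t)).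

Lemma twopi_gt0 : 0 < 2 * pi :> R. Proof. by rewrite mulr_gt0// pi_gt0. Qed.

Section Means.
Variable r : R.
Hypothesis r0 : 0 <= r.
Let p0 := ltW twopi_gt0.

Lemma mean_le (g h : C -> R) : cont_circ r g -> cont_circ r h ->
  (forall z, nc z = r -> g z <= h z) -> mean r g <= mean r h.
Proof.
move=> cg ch gh; rewrite /mean ler_wpM2l ?invr_ge0//.
apply: RI_le => [||t _]; try exact: cont_circ_on.
by apply: gh; rewrite nc_circ.
Qed.

Lemma mean_ge0 (g : C -> R) : (forall z, nc z = r -> 0 <= g z) -> 0 <= mean r g.
Proof.
move=> g0; rewrite /mean mulr_ge0 ?invr_ge0//; apply: RI_ge0 => t _.
by apply: g0; rewrite nc_circ.
Qed.

Lemma eq_mean (g h : C -> R) : (forall z, nc z = r -> g z = h z) -> mean r g = mean r h.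
Proof.
by move=> gh; congr (_ * _); apply: eq_RI => t _; apply: gh; rewrite nc_circ.
Qed.

Lemma meanD (g h : C -> R) : cont_circ r g -> cont_circ r h ->
  mean r (fun z => g z + h z) = mean r g + mean r h.
Proof. by move=> cg ch; rewrite /mean RI_D ?mulrDr//; exact: cont_circ_on. Qed.

Lemma meanB (g h : C -> R) : cont_circ r g -> cont_circ r h ->
  mean r (fun z => g z - h z) = mean r g - mean r h.
Proof. by move=> cg ch; rewrite /mean RI_B ?mulrBr//; exact: cont_circ_on. Qed.

Lemma meanZ k (g : C -> R) : cont_circ r g ->
  mean r (fun z => k * g z) = k * mean r g.
Proof. by move=> cg; rewrite /mean RI_Z 1?mulrCA//; exact: cont_circ_on. Qed.

Lemma mean_cst k : mean r (fun _ => k) = k.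
Proof. by rewrite /mean RI_cst// subr0 mulrCA mulVf ?mulr1// gt_eqF// twopi_gt0. Qed.

Lemma eq_cmean (g h : C -> C) : (forall z, nc z = r -> g z = h z) ->
  cmean r g = cmean r h.
Proof.
by move=> gh; congr (_ * _); apply: eq_CI => t _; apply: gh; rewrite nc_circ.
Qed.

Lemma cmeanD (g h : C -> C) : cont_circ r g -> cont_circ r h ->
  cmean r (fun z => g z + h z) = cmean r g + cmean r h.
Proof. by move=> cg ch; rewrite /cmean CI_D ?mulrDr//; exact: cont_circ_on. Qed.

Lemma cmeanB (g h : C -> C) : cont_circ r g -> cont_circ r h ->
  cmean r (fun z => g z - h z) = cmean r g - cmean r h.
Proof. by move=> cg ch; rewrite /cmean CI_B ?mulrBr//; exact: cont_circ_on. Qed.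

Lemma cmeanZ k (g : C -> C) : cont_circ r g ->
  cmean r (fun z => k * g z) = k * cmean r g.
Proof. by move=> cg; rewrite /cmean CI_Z 1?mulrCA//; exact: cont_circ_on. Qed.

Lemma cmean_cst k : cmean r (fun _ => k) = k.
Proof.
rewrite /cmean CI_cst// subr0 mulrA -rmorphM mulVf ?mul1r// gt_eqF//.
exact: twopi_gt0.
Qed.

Lemma cmean_conj (g : C -> C) : cont_circ r g ->
  cmean r (fun z => conjc (g z)) = conjc (cmean r g).
Proof.
move=> cg; rewrite /cmean conjcM conjc_real; congr (_ * _).
apply/eqP; rewrite eq_complex /= -RI_N; last first.
  by apply: cont_on_Im; exact: cont_circ_on.
by apply/andP; split; apply/eqP; apply: eq_RI => t _; case: (g _).
Qed.

Lemma nc_cmean_le (g : C -> C) (k : C -> R) : cont_circ r g -> cont_circ r k ->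
  (forall z, nc z = r -> nc (g z) <= k z) -> nc (cmean r g) <= 2 * mean r k.
Proof.
move=> cg ck gk; rewrite /cmean ncM nc_pos ?invr_ge0// /mean mulrCA.
rewrite ler_wpM2l ?invr_ge0//; apply: CI_nc_le => [||t _]; try exact: cont_circ_on.
by apply: gk; rewrite nc_circ.
Qed.

Lemma nc_cmean_le_cst (g : C -> C) k : cont_circ r g ->
  (forall z, nc z = r -> nc (g z) <= k) -> nc (cmean r g) <= 2 * k.
Proof.
move=> cg gk; rewrite -(mean_cst k); apply: nc_cmean_le => // z _.
exact: cst_continuous.
Qed.

Lemma Re_cmean (g : C -> C) : complex.Re (cmean r g) = mean r (fun z => complex.Re (g z)).
Proof. by rewrite /cmean cReM /= mul0r subr0. Qed.

End Means.
End Exponential.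

(** * Continuity of algebraic expressions *)

Section Continuity.
Variables (R : realType) (T : topologicalType).
Local Notation C := R[i].
Implicit Types (f g : T -> C) (u : T).

Lemma contC_D f g u : {for u, continuous f} -> {for u, continuous g} ->
  {for u, continuous (fun v => f v + g v)}.
Proof. by move=> fu gu; exact: (@cvgD C C T _ _ f g _ _ fu gu). Qed.

Lemma contC_B f g u : {for u, continuous f} -> {for u, continuous g} ->
  {for u, continuous (fun v => f v - g v)}.
Proof. by move=> fu gu; exact: (@cvgB C C T _ _ f g _ _ fu gu). Qed.

Lemma contC_M f g u : {for u, continuous f} -> {for u, continuous g} ->
  {for u, continuous (fun v => f v * g v)}.
Proof. by move=> fu gu; exact: (@cvgM C T _ _ f g _ _ fu gu). Qed.

Lemma contC_V f u : f u != 0 -> {for u, continuous f} ->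
  {for u, continuous (fun v => (f v)^-1)}.
Proof. by move=> fu0 fu; exact: (@cvgV C T _ _ f _ fu0 fu). Qed.

Lemma contC_cst (c : C) u : {for u, continuous (fun _ : T => c)}.
Proof. exact: cst_continuous. Qed.

Lemma contC_X f n u : {for u, continuous f} -> {for u, continuous (fun v => f v ^+ n)}.
Proof.
move=> fu; elim: n => [|n IH]; first exact: contC_cst.
have -> : (fun v => f v ^+ n.+1) = (fun v => f v * f v ^+ n).
  by apply/funext => v; rewrite exprS.
exact: contC_M.
Qed.

Lemma contC_conj f u : {for u, continuous f} -> {for u, continuous (fun v => conjc (f v))}.
Proof. by move=> fu; apply: (continuous_comp fu); exact: conjc_continuous. Qed.

Lemma contC_nc f u : {for u, continuous f} -> {for u, continuous (fun v => nc (f v))}.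
Proof. by move=> fu; apply: (continuous_comp fu); exact: nc_continuous. Qed.

Lemma contC_Re f u : {for u, continuous f} ->
  {for u, continuous (fun v => complex.Re (f v))}.
Proof. by move=> fu; apply: (continuous_comp fu); exact: Re_continuous. Qed.

Lemma contR_D (f g : T -> R) u : {for u, continuous f} -> {for u, continuous g} ->
  {for u, continuous (fun v => f v + g v)}.
Proof. by move=> fu gu; exact: (@cvgD R R T _ _ f g _ _ fu gu). Qed.

Lemma contR_B (f g : T -> R) u : {for u, continuous f} -> {for u, continuous g} ->
  {for u, continuous (fun v => f v - g v)}.
Proof. by move=> fu gu; exact: (@cvgB R R T _ _ f g _ _ fu gu). Qed.

Lemma contR_M (f g : T -> R) u : {for u, continuous f} -> {for u, continuous g} ->
  {for u, continuous (fun v => f v * g v)}.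
Proof. by move=> fu gu; exact: (@cvgM R T _ _ f g _ _ fu gu). Qed.

Lemma contR_cst (c : R) u : {for u, continuous (fun _ : T => c)}.
Proof. exact: cst_continuous. Qed.

Lemma contR_norm (f : T -> R) u : {for u, continuous f} ->
  {for u, continuous (fun v => `|f v|)}.
Proof. by move=> fu; exact: (@cvg_norm R R T _ _ f _ fu). Qed.

Lemma contR_sum (I : Type) (s : seq I) (F : I -> T -> R) u :
  (forall i, {for u, continuous (F i)}) ->
  {for u, continuous (fun v => \sum_(i <- s) F i v)}.
Proof.
move=> Fu; elim: s => [|i s IH].
  by rewrite (_ : (fun _ => _) = fun _ => 0) ?funeqE => [|v]; [exact: contR_cst|rewrite big_nil].
rewrite (_ : (fun _ => _) = fun v => F i v + \sum_(j <- s) F j v); last first.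
  by apply/funext => v; rewrite big_cons.
exact: contR_D.
Qed.

Lemma contR_ln (f : T -> R) u : 0 < f u -> {for u, continuous f} ->
  {for u, continuous (fun v => ln (f v))}.
Proof. by move=> fu0 fu; apply: (continuous_comp fu); exact: continuous_ln. Qed.

End Continuity.

(** * Cauchy's formula *)

Section Cauchy.
Variable R : realType.
Local Notation C := R[i].
Implicit Types (f g : C -> C) (w z a : C) (r rho : R).

(** Only discs centred at the origin occur; other centres are reached by translating the
    function. *)
Definition holD rho f := forall z, nc z < rho -> derivable f z 1.

Lemma contC_id z : {for z, continuous (fun v : C => v)}.
Proof. by []. Qed.

Lemma derivable_contC f z : derivable f z 1 -> {for z, continuous f}.
Proof. by move=> /derivable_is_derive/is_derive_contC. Qed.

Lemma holD_cont_circ rho r f : r < rho -> holD rho f -> cont_circ r f.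
Proof. by move=> rr hf z zr; apply: derivable_contC; apply: hf; rewrite zr. Qed.

Lemma circ_neq r z w : nc z = r -> nc w < r -> z - w != 0.
Proof.
by move=> zr; apply: contraTneq => /subr0_eq <-; rewrite zr ltxx.
Qed.

Lemma cont_kernel r w : nc w < r -> cont_circ r (fun z => (z - w)^-1).
Proof.
move=> wr z zr; apply: contC_V; first exact: circ_neq wr.
by apply: contC_B; [exact: contC_id|exact: contC_cst].
Qed.

Lemma kernel_bound r z w : nc z = r -> nc w < r -> nc (z - w)^-1 <= (r - nc w)^-1.
Proof.
move=> zr wr; rewrite ncV lef_pV2 ?posrE ?subr_gt0 ?nc_gt0 ?(circ_neq zr)//.
by rewrite -zr ncBl.
Qed.

Lemma nc_segment r (t : R) z w : 0 <= t -> t <= 1 -> nc w <= r -> nc z <= r ->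
  nc (w + (t%:C)%C * (z - w)) <= r.
Proof.
move=> t0 t1 wr zr.
have -> : w + (t%:C)%C * (z - w) = (1 - t)%:C%C * w + (t%:C)%C * z.
  by rewrite rmorphB rmorph1; ring.
rewrite (le_trans (ncD _ _))// !ncM !nc_pos ?subr_ge0//.
have -> : r = (1 - t) * r + t * r by ring.
by apply: lerD; rewrite ler_wpM2l ?subr_ge0.
Qed.

(* The contraction [w + exp(x) (circ r y - w)] of the circle towards [w]; the
   value at [w] is reached as [x0] tends to [-oo]. *)
Lemma cauchy_deformation rho r f w : r < rho -> holD rho f -> nc w < r ->
  forall x0 : R, x0 <= 0 ->
  CI 0 (2 * pi) (fun y => 'i%C * circ r y / (circ r y - w) *
    (f (circ r y) - f (w + (expR x0)%:C%C * (circ r y - w)))) = 0.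
Proof.
move=> rr hf wr x0 x00.
have r0 : 0 <= r by rewrite (le_trans (nc_ge0 w))// ltW.
have cw y : circ r y - w != 0 by apply: circ_neq wr; rewrite nc_circ.
pose H s : C := (r%:C)%C * expC ('i%C * s) - w.
have HE y : H (y%:C)%C = circ r y - w by rewrite /H circE.
pose P (x y : R) := f (w + expC (x%:C)%C * H (y%:C)%C).
(* [k] is the logarithmic derivative of [H]. For [z = w + exp(x) H(y)] one has
   [dz / (z - w) = dx + k(y) dy], so [P dx + k(y) P dy] is the pull-back of [f(z) dz / (z - w)]. *)
pose k y := 'i%C * circ r y / (circ r y - w).
have kc y : {for y, continuous k}.
  apply: contC_M; first apply: contC_M.
  - exact: contC_cst.
  - exact: circ_continuous.
  - apply: contC_V => //; apply: contC_B; first exact: circ_continuous.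
    exact: contC_cst.
have dP x y : x0 <= x <= 0 -> 0 <= y <= 2 * pi ->
    exists A, diff2 P x y A (k y * A).
  move=> /andP[_ xle] _.
  have dH : is_derive (y%:C)%C 1 H ((r%:C)%C * ('i%C * expC ('i%C * (y%:C)%C)) - 0).
    exact: is_deriveCB (is_derive_circ r _) (is_deriveC_cst w _).
  have d2 := diff2_mul (is_derive_expC (x%:C)%C) dH.
  have dw : is_derive (expC (x%:C)%C * H (y%:C)%C) 1 (fun v : C => w + v) (0 + 1).
    exact: is_deriveCD (is_deriveC_cst w _) (is_deriveC_id _).
  have {d2 dw} d2 := diff2_comp d2 dw.
  have df : derivable f (w + expC (x%:C)%C * H (y%:C)%C) 1.
    apply: hf; rewrite HE expC_real (le_lt_trans _ rr)// nc_segment ?expR_ge0//.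
    - by rewrite -expR0 ler_expR.
    - exact: ltW.
    - by rewrite nc_circ.
  have {d2} d2 := diff2_comp d2 (derivable_is_derive df).
  set f1 := derive1 _ _ in d2.
  exists (f1 * ((0 + 1) * (expC (x%:C)%C * H (y%:C)%C))).
  have -> : k y * (f1 * ((0 + 1) * (expC (x%:C)%C * H (y%:C)%C))) =
    f1 * ((0 + 1) * (expC (x%:C)%C *
      ((r%:C)%C * ('i%C * expC ('i%C * (y%:C)%C)) - 0))).
    rewrite HE /k circE; field.
    by rewrite -circE.
  exact: d2.
(* The sides [y = 0] and [y = 2 * pi] have the same image and cancel; the circle and its contraction
   remain. *)
have := goursat_rectangle kc dP x00 (ltW (twopi_gt0 R)).
rewrite (_ : CI x0 0 _ = 0) ?add0r; last first.
  have -> : CI x0 0 (fun x => P x 0 - P x (2 * pi)) = CI x0 0 (fun _ => 0).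
    by apply: eq_CI => x _; rewrite /P !HE circ2pi subrr.
  by rewrite CI_cst// mulr0.
move=> <-; apply: eq_CI => y _; rewrite /k /P !HE !expC_real expR0 mul1r.
have -> : w + (circ r y - w) = circ r y by rewrite addrC subrK.
by [].
Qed.

(** The circle is contracted until [f] differs from [f w] by less than a given [e] on its image.
    Continuity of [f] at [w] thus replaces any discussion of the removable singularity. *)
Lemma cmean_kernel_diff rho r f w : r < rho -> holD rho f -> nc w < r ->
  cmean r (fun z => z / (z - w) * (f z - f w)) = 0.
Proof.
move=> rr hf wr.
have r0 : 0 < r by rewrite (le_lt_trans (nc_ge0 w)).
have cc := @circ_continuous R r.
have cw y : circ r y - w != 0 by apply: circ_neq wr; rewrite nc_circ// ltW.
have ck : cont_circ r (fun z => z / (z - w)).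
  move=> z zr; apply: contC_M; first exact: contC_id.
  exact: cont_kernel zr.
have cf := holD_cont_circ rr hf.
have cg : cont_circ r (fun z => z / (z - w) * (f z - f w)).
  move=> z zr; apply: contC_M; first exact: ck.
  by apply: contC_B; [exact: cf|exact: contC_cst].
have cg' := cont_circ_on (a := 0) (b := 2 * pi) (ltW r0) cg.
suff : CI 0 (2 * pi) (fun y => circ r y / (circ r y - w) * (f (circ r y) - f w)) = 0.
  by move=> H; rewrite /cmean H mulr0.
set I0 := CI _ _ _; apply/eqP; rewrite -nc_eq0 eq_le nc_ge0 andbT.
apply/ler_addgt0Pr => e e0; rewrite add0r.
pose K := r / (r - nc w).
have rw0 : 0 < r - nc w by rewrite subr_gt0.
have K0 : 0 < K by rewrite divr_gt0.
have e10 : 0 < e / (2 * (K * (2 * pi))).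
  apply: divr_gt0 => //; apply: mulr_gt0 => //; apply: mulr_gt0 => //.
  exact: twopi_gt0.
have dfw : derivable f w 1 by apply: hf; exact: lt_trans rr.
have [d d0 dP] := (contCP _ _).1 (derivable_contC dfw) _ e10.
(* Points of the circle lie within [2 * r] of [w], so the contracted ones lie within [d / 2]. The
   bound 0 makes the map a contraction. *)
pose x0 := Num.min 0 (ln (d / (4 * r))).
have x00 : x0 <= 0 by rewrite ge_min lexx.
have ex0 : expR x0 <= d / (4 * r).
  rewrite -[leRHS]lnK ?posrE ?divr_gt0 ?mulr_gt0// ler_expR ge_min lexx orbT.
  by [].
have := cauchy_deformation rr hf wr x00.
set G := fun y => w + (expR x0)%:C%C * (circ r y - w).
have Gw y : nc (G y - w) < d.
  rewrite /G [w + _]addrC addrK ncM nc_pos ?expR_ge0//.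
  apply: (@le_lt_trans _ _ (d / (4 * r) * (2 * r))).
    apply: ler_pM; rewrite ?expR_ge0 ?nc_ge0//.
    rewrite (le_trans (nc_sub_le _ _))// nc_circ ?(ltW r0)// mulrDl mul1r lerD2l.
    exact: ltW.
  have -> : d / (4 * r) * (2 * r) = d / 2 by field; rewrite gt_eqF.
  by rewrite ltr_pdivrMr// ltr_pMr// ltr1n.
have cG y : {for y, continuous G}.
  apply: contC_D; first exact: contC_cst.
  apply: contC_M; first exact: contC_cst.
  by apply: contC_B; [exact: cc|exact: contC_cst].
have GD y : nc (G y) < rho.
  rewrite /G (le_lt_trans _ rr)// nc_segment ?expR_ge0//.
  - by rewrite -expR0 ler_expR.
  - exact: ltW.
  - by rewrite nc_circ ?(ltW r0).
have cfG y : {for y, continuous (fun y => f (G y))}.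
  apply: (continuous_comp (cG y)); apply: derivable_contC.
  exact: hf.
have ckc y : {for y, continuous (fun y => circ r y / (circ r y - w))}.
  apply: contC_M; first exact: cc.
  apply: contC_V; first exact: cw.
  by apply: contC_B; [exact: cc|exact: contC_cst].
have cd2 : cont_on 0 (2 * pi) (fun y => circ r y / (circ r y - w) * (f (G y) - f w)).
  move=> y _; apply: contC_M; first exact: ckc.
  by apply: contC_B; [exact: cfG|exact: contC_cst].
move=> D0.
have -> : I0 = CI 0 (2 * pi) (fun y => circ r y / (circ r y - w) * (f (G y) - f w)).
  apply/eqP; rewrite -subr_eq0; apply/eqP.
  rewrite /I0 -CI_B//; apply: (@mulfI _ 'i%C).
    by rewrite eq_complex /= oner_eq0 andbF.
  rewrite mulr0 -CI_Z; last by move=> y yy; apply: contC_B; [exact: cg'|exact: cd2].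
  by rewrite -[RHS]D0; apply: eq_CI => y _; rewrite -/(G y); ring.
rewrite (_ : e = 2 * (K * (e / (2 * (K * (2 * pi)))) * (2 * pi - 0))); last first.
  rewrite subr0; set L := 2 * (K * (2 * pi)).
  have L0 : L != 0.
    apply/lt0r_neq0; rewrite /L; apply: mulr_gt0 => //; apply: mulr_gt0 => //.
    exact: twopi_gt0.
  have -> : 2 * (K * (e / L) * (2 * pi)) = e / L * L.
    by set t := e / L; rewrite /L; clearbody t; ring.
  by rewrite divfK.
apply: CI_nc_le_cst => //; first exact/ltW/twopi_gt0.
move=> y _; rewrite ncM; apply: ler_pM; rewrite ?nc_ge0//; last exact/ltW/dP/Gw.
rewrite ncM nc_circ ?(ltW r0)// ler_wpM2l ?(ltW r0)//.
by apply: kernel_bound => //; rewrite nc_circ// ltW.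
Qed.

Lemma cmean_center rho r f : 0 < r -> r < rho -> holD rho f -> cmean r f = f 0.
Proof.
move=> r0 rr hf; have cf := holD_cont_circ rr hf.
have w0 : nc (0 : C) < r by rewrite nc0.
have := cmean_kernel_diff rr hf w0.
have -> : cmean r (fun z => z / (z - 0) * (f z - f 0)) = cmean r (fun z => f z - f 0).
  apply: eq_cmean; first exact: ltW.
  move=> z zr; rewrite subr0 divff ?mul1r// -nc_gt0 zr//.
rewrite (cmeanB (ltW r0) cf); last by move=> z _; exact: contC_cst.
by rewrite cmean_cst ?(ltW r0)// => /subr0_eq.
Qed.

Lemma circ_conj r z : 0 < r -> nc z = r -> conjc z = ((r ^+ 2)%:C)%C / z.
Proof.
move=> r0 zr; have z0 : z != 0 by rewrite -nc_gt0 zr.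
by apply: (mulIf z0); rewrite divfK// mulrC mul_conj zr.
Qed.

Lemma conjcV z : conjc z^-1 = (conjc z)^-1.
Proof. exact: conjc_inv. Qed.

Lemma conjcB z w : conjc (z - w) = conjc z - conjc w.
Proof. exact: (rmorphB (@conjc R)). Qed.

(* [rho'] is any radius with [r < rho'] and [nc w * rho' < r ^ 2]. *)
Lemma reflected_neq0 r w z : 0 < r -> nc w < r -> nc z < 2 * r ^+ 2 / (r + nc w) ->
  ((r ^+ 2)%:C)%C - conjc w * z != 0.
Proof.
move=> r0 wr zr; rewrite subr_eq0; apply/eqP => H.
have : nc (((r ^+ 2)%:C)%C : C) = nc (conjc w * z) by rewrite H.
rewrite nc_pos ?sqr_ge0// ncM nc_conj => E.
have rw : 0 < r + nc w by rewrite ltr_pwDl ?nc_ge0.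
rewrite ltr_pdivlMr// in zr.
have [w0|w0] := eqVneq (nc w) 0.
  by move: E; rewrite w0 mul0r => /eqP; rewrite gt_eqF// exprn_gt0.
have wp : 0 < nc w by rewrite lt_neqAle eq_sym w0 nc_ge0.
have : nc w * (nc z * (r + nc w)) < nc w * (2 * r ^+ 2) by rewrite ltr_pM2l.
rewrite mulrA -E => H2.
have : r ^+ 2 * (r + nc w) < r ^+ 2 * (2 * nc w) by rewrite (lt_le_trans H2)// le_eqVlt; apply/orP; left; apply/eqP; ring.
by rewrite ltr_pM2l ?exprn_gt0// mulr_natl mulr2n ltrD2r ltNge (ltW wr).
Qed.

Lemma reflected_radius r w : 0 < r -> nc w < r -> r < 2 * r ^+ 2 / (r + nc w).
Proof.
move=> r0 wr; rewrite ltr_pdivlMr ?ltr_pwDl ?nc_ge0//.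
rewrite expr2 mulrCA ltr_pM2l// mulr_natl mulr2n ltrD2l//.
Qed.

Lemma is_derive_affV (u v : C) z : u - v * z != 0 ->
  is_derive z 1 (fun y : C => (u - v * y)^-1) (v / (u - v * z) ^+ 2).
Proof.
move=> uv0; have := is_deriveCV (f := fun y => u - v * y) uv0
  (is_deriveCB (is_deriveC_cst u z) (is_deriveCZ v (is_deriveC_id z))).
apply: is_deriveC_eq.
by rewrite mulr1 sub0r opprK.
Qed.

(** On the circle [conjc z = r^2 / z], so the kernel is the conjugate of
    [r^2 / (r^2 - conjc w * z)], which is holomorphic on a larger disc and equals 1 at the
    centre. *)
Lemma cmean_kernel r w : nc w < r -> cmean r (fun z => z / (z - w)) = 1.
Proof.
move=> wr; have r0 : 0 < r by rewrite (le_lt_trans (nc_ge0 w)).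
pose g z : C := ((r ^+ 2)%:C)%C * (((r ^+ 2)%:C)%C - conjc w * z)^-1.
have hg : holD (2 * r ^+ 2 / (r + nc w)) g.
  move=> z zr; have := is_deriveCZ ((r ^+ 2)%:C)%C
    (is_derive_affV (reflected_neq0 r0 wr zr)).
  by case.
have cg := holD_cont_circ (reflected_radius r0 wr) hg.
have H := cmean_center r0 (reflected_radius r0 wr) hg.
have -> : cmean r (fun z => z / (z - w)) = conjc (cmean r g).
  rewrite -cmean_conj ?(ltW r0)//; apply: eq_cmean; first exact: ltW.
  move=> z zr; have z0 : z != 0 by rewrite -nc_gt0 zr.
  have zw := circ_neq zr wr.
  rewrite /g conjcM conjcV conjcB conjcM conjcK conjc_real (circ_conj r0 zr).
  have -> : ((r ^+ 2)%:C)%C - w * (((r ^+ 2)%:C)%C / z) = ((r ^+ 2)%:C)%C * ((z - w) / z).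
    by field.
  rewrite invfM invf_div mulrA divff ?mul1r//.
  by rewrite -nc_gt0 nc_pos ?sqr_ge0// exprn_gt0.
by rewrite H /g mulr0 subr0 divff ?conjc1// -nc_gt0 nc_pos ?sqr_ge0// exprn_gt0.
Qed.

Lemma cauchy_formula rho r f w : r < rho -> holD rho f -> nc w < r ->
  cmean r (fun z => f z * z / (z - w)) = f w.
Proof.
move=> rr hf wr; have r0 : 0 < r by rewrite (le_lt_trans (nc_ge0 w)).
have ck : cont_circ r (fun z => z / (z - w)).
  move=> z zr; apply: contC_M; first exact: contC_id.
  exact: cont_kernel zr.
have cf := holD_cont_circ rr hf.
have := cmean_kernel_diff rr hf wr.
have -> : cmean r (fun z => z / (z - w) * (f z - f w)) =
    cmean r (fun z => f z * z / (z - w) - f w * (z / (z - w))).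
  by apply: eq_cmean; [exact: ltW|move=> z _; ring].
rewrite (cmeanB (ltW r0)).
- by rewrite (cmeanZ (ltW r0) _ ck) cmean_kernel// mulr1 => /subr0_eq.
- move=> z zr; apply: contC_M; first by apply: contC_M; [exact: cf|exact: contC_id].
  exact: cont_kernel zr.
- by move=> z zr; apply: contC_M; [exact: contC_cst|exact: ck].
Qed.

End Cauchy.

(** * Entire functions *)

Section Entire.
Variable R : realType.
Local Notation C := R[i].
Implicit Types (f g phi : C -> C) (w z a : C) (r rho : R).

Lemma is_derive_quadratic f z a (d M : R) : 0 < d -> 0 <= M ->
  (forall h, nc h < d -> nc (f (z + h) - f z - a * h) <= M * nc h ^+ 2) ->
  is_derive z 1 f a.
Proof.
move=> d0 M0 H; apply/is_deriveCP => e e0.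
have M1 : 0 < M + 1 by rewrite ltr_wpDl.
exists (Num.min d (e / (M + 1))); first by rewrite lt_min d0 divr_gt0.
move=> h; rewrite lt_min => /andP[hd he]; apply: le_trans (H _ hd) _.
rewrite expr2 mulrA ler_wpM2r ?nc_ge0//.
move: he; rewrite ltr_pdivlMr// => /ltW he; apply: le_trans he.
by rewrite mulrC ler_wpM2l ?nc_ge0// lerDl.
Qed.

(** * Differentiation of Cauchy transforms *)

Section CauchyTransform.
Variables (r : R) (phi : C -> C) (w : C).
Hypotheses (cphi : cont_circ r phi) (wr : nc w < r).
Let r0 : 0 <= r := ltW (le_lt_trans (nc_ge0 w) wr).
Let K := 2 / (r - nc w).
Let d := (r - nc w) / 2.

Let rw0 : 0 < r - nc w. Proof. by rewrite subr_gt0. Qed.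

Let K0 : 0 < K. Proof. by rewrite divr_gt0. Qed.

Let wh h : nc h < d -> nc (w + h) < r.
Proof.
move=> hd; rewrite (le_lt_trans (ncD _ _))// -ltrBrDl (lt_trans hd)//.
by rewrite ltr_pdivrMr// ltr_pMr// ltr1n.
Qed.

Let kx z : nc z = r -> nc (z - w)^-1 <= K.
Proof.
move=> zr; rewrite (le_trans (kernel_bound zr wr))// /K -[leLHS]mul1r.
by rewrite ler_wpM2r ?invr_ge0 ?(ltW rw0)// ler1n.
Qed.

Let ky h z : nc h < d -> nc z = r -> nc (z - (w + h))^-1 <= K.
Proof.
move=> hd zr; rewrite (le_trans (kernel_bound zr (wh hd)))// /K.
rewrite -[2 / _]invf_div lef_pV2 ?posrE ?divr_gt0 ?subr_gt0 ?wh//.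
rewrite -/d lerBrDl (le_trans (lerD (ncD _ _) (lexx _)))//.
have -> : r = nc w + d + d by rewrite /d; field.
by rewrite lerD2r lerD2l ltW.
Qed.

Let cker h n : nc h < d ->
  cont_circ r (fun z => phi z * (z - (w + h))^-1 ^+ n).
Proof.
move=> hd z zr; apply: contC_M; first exact: cphi.
by apply: contC_X; exact: (cont_kernel (wh hd) zr).
Qed.

Let cker0 n : cont_circ r (fun z => phi z * (z - w)^-1 ^+ n).
Proof.
move=> z zr; apply: contC_M; first exact: cphi.
by apply: contC_X; exact: (cont_kernel wr zr).
Qed.

Let transform_bound h (E : C -> C) (B : R) : nc h < d -> 0 <= B ->
  cont_circ r (fun z => phi z * E z) ->
  (forall z, nc z = r -> nc (E z) <= B) ->
  nc (cmean r (fun z => phi z * E z)) <= 2 * mean r (fun z => nc (phi z)) * B.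
Proof.
move=> hd B0 cE EB; rewrite -mulrA [_ * B]mulrC -(meanZ r0); last first.
  by move=> z zr; apply: contC_nc; exact: cphi.
apply: (nc_cmean_le r0 cE) => z zr.
  by apply: contR_M; [exact: contR_cst|apply: contC_nc; exact: cphi].
by rewrite ncM mulrC ler_wpM2r ?nc_ge0 ?EB.
Qed.

(** The second-order remainder of [(z - w)^-1] is exactly [h^2 / ((z - w)^2 (z - w - h))]. The
    constant is explicit because [holD_quadratic] needs it uniformly in [w]. *)
Lemma cauchy1_quadratic h : nc h < d ->
  nc (cmean r (fun z => phi z * (z - (w + h))^-1 ^+ 1) -
      cmean r (fun z => phi z * (z - w)^-1 ^+ 1) -
      cmean r (fun z => phi z * (z - w)^-1 ^+ 2) * h) <=
    2 * mean r (fun z => nc (phi z)) * K ^+ 3 * nc h ^+ 2.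
Proof.
move=> hd; rewrite [_ * h]mulrC -(cmeanZ r0); last exact: cker0.
have cE : cont_circ r (fun z => h * (phi z * (z - w)^-1 ^+ 2)).
  by move=> z zr; apply: contC_M; [exact: contC_cst|exact: cker0].
have cD : cont_circ r (fun z => phi z * (z - (w + h))^-1 ^+ 1 - phi z * (z - w)^-1 ^+ 1).
  by move=> z zr; apply: contC_B; [exact: cker|exact: cker0].
rewrite -(cmeanB r0 (@cker h 1 hd) (@cker0 1)) -(cmeanB r0 cD cE).
set E := fun z => h ^+ 2 * ((z - w)^-1 ^+ 2 * (z - (w + h))^-1).
have EE z : nc z = r -> phi z * (z - (w + h))^-1 ^+ 1 - phi z * (z - w)^-1 ^+ 1 -
    h * (phi z * (z - w)^-1 ^+ 2) = phi z * E z.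
  move=> zr; have := circ_neq zr wr; have := circ_neq zr (wh hd).
  by rewrite /E => a b; field; rewrite a b.
rewrite (eq_cmean r0 EE) -mulrA [K ^+ 3 * _]mulrC; apply: (transform_bound hd).
- by rewrite mulr_ge0 ?exprn_ge0 ?nc_ge0 ?(ltW K0).
- move=> z zr; apply: contC_M; first exact: cphi.
  apply: contC_M; first exact: contC_cst.
  apply: contC_M; last exact: (cont_kernel (wh hd) zr).
  by apply: contC_X; exact: (cont_kernel wr zr).
- move=> z zr; rewrite /E ncM ncX ler_wpM2l ?exprn_ge0 ?nc_ge0//.
  rewrite ncM ncX [K ^+ 3]exprSr; apply: ler_pM; rewrite ?exprn_ge0 ?nc_ge0 ?ky//.
  by rewrite ler_pXn2r ?nnegrE ?nc_ge0 ?(ltW K0) ?kx.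
Qed.

Lemma is_derive_cauchy1 :
  is_derive w 1 (fun v => cmean r (fun z => phi z * (z - v)^-1 ^+ 1))
    (cmean r (fun z => phi z * (z - w)^-1 ^+ 2)).
Proof.
apply: is_derive_quadratic cauchy1_quadratic; first by rewrite divr_gt0.
rewrite mulr_ge0 ?exprn_ge0 ?(ltW K0)// mulr_ge0//.
by apply: mean_ge0 => // z _; exact: nc_ge0.
Qed.

Lemma is_derive_cauchy2 :
  is_derive w 1 (fun v => cmean r (fun z => phi z * (z - v)^-1 ^+ 2))
    (cmean r (fun z => 2 * (phi z * (z - w)^-1 ^+ 3))).
Proof.
apply: (@is_derive_quadratic _ _ _ d (2 * mean r (fun z => nc (phi z)) * (3 * K ^+ 4))).
- by rewrite divr_gt0.
- apply: mulr_ge0; last by rewrite mulr_ge0 ?exprn_ge0 ?(ltW K0).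
  rewrite mulr_ge0//; apply: mean_ge0 => // z _; exact: nc_ge0.
have c3 : cont_circ r (fun z => 2 * (phi z * (z - w)^-1 ^+ 3)).
  by move=> z zr; apply: contC_M; [exact: contC_cst|exact: cker0].
move=> h hd; rewrite [_ * h]mulrC -(cmeanZ r0 _ c3).
have cE : cont_circ r (fun z => h * (2 * (phi z * (z - w)^-1 ^+ 3))).
  by move=> z zr; apply: contC_M; [exact: contC_cst|exact: c3].
have cD : cont_circ r (fun z => phi z * (z - (w + h))^-1 ^+ 2 - phi z * (z - w)^-1 ^+ 2).
  by move=> z zr; apply: contC_B; [exact: cker|exact: cker0].
rewrite -(cmeanB r0 (@cker h 2 hd) (@cker0 2)) -(cmeanB r0 cD cE).
set E := fun z => h ^+ 2 * ((z - w)^-1 ^+ 2 * (z - (w + h))^-1 *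
  ((z - (w + h))^-1 + 2 * (z - w)^-1)).
have EE z : nc z = r -> phi z * (z - (w + h))^-1 ^+ 2 - phi z * (z - w)^-1 ^+ 2 -
    h * (2 * (phi z * (z - w)^-1 ^+ 3)) = phi z * E z.
  move=> zr; have := circ_neq zr wr; have := circ_neq zr (wh hd).
  by rewrite /E => a b; field; rewrite a b.
rewrite (eq_cmean r0 EE) -mulrA [3 * K ^+ 4 * _]mulrC; apply: (transform_bound hd).
- apply: mulr_ge0; first by rewrite exprn_ge0 ?nc_ge0.
  by apply: mulr_ge0 => //; rewrite exprn_ge0 ?(ltW K0).
- move=> z zr; apply: contC_M; first exact: cphi.
  have c1 := cont_kernel (wh hd) zr; have c2 := cont_kernel wr zr.
  apply: contC_M; first exact: contC_cst.
  apply: contC_M; first by apply: contC_M c1; exact: contC_X.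
  apply: contC_D; first exact: c1.
  by apply: contC_M; [exact: contC_cst|exact: c2].
- move=> z zr; rewrite /E ncM ncX ler_wpM2l ?exprn_ge0 ?nc_ge0//.
  have -> : 3 * K ^+ 4 = K ^+ 2 * K * (K + 2 * K) by ring.
  rewrite ncM (ncM (_ ^+ 2)) ncX; apply: ler_pM; rewrite ?mulr_ge0 ?exprn_ge0 ?nc_ge0//.
    apply: ler_pM; rewrite ?exprn_ge0 ?nc_ge0 ?ky//.
    by rewrite ler_pXn2r ?nnegrE ?nc_ge0 ?(ltW K0) ?kx.
  rewrite (le_trans (ncD _ _))// ncM nc_nat lerD ?ky//.
  by rewrite ler_wpM2l// kx.
Qed.

End CauchyTransform.

Lemma derive1_cauchy rho r f w : r < rho -> holD rho f -> nc w < r ->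
  derive1 f w = cmean r (fun z => f z * z * (z - w)^-1 ^+ 2).
Proof.
move=> rr hf wr.
have cphi : cont_circ r (fun z => f z * z).
  by move=> z zr; apply: contC_M; [exact: (holD_cont_circ rr hf)|exact: contC_id].
apply: derive1_is_derive; apply: (is_deriveC_near (e := r - nc w) _ _ (is_derive_cauchy1 cphi wr)).
  by rewrite subr_gt0.
move=> v vw; have vr : nc v < r.
  have -> : v = (v - w) + w by rewrite subrK.
  by rewrite (le_lt_trans (ncD _ _))// -ltrBrDr.
by rewrite -(cauchy_formula rr hf vr).
Qed.

(** By Cauchy's formula [f'] is the transform with the squared kernel, which is again differentiable
    in its parameter. *)
Lemma holD_derive1 rho f : holD rho f -> holD rho (derive1 f).
Proof.
move=> hf w wrho; pose r := (nc w + rho) / 2.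
have wr : nc w < r by rewrite /r ltr_pdivlMr// mulr_natr mulr2n ltrD2l.
have rr : r < rho by rewrite /r ltr_pdivrMr// mulr_natr mulr2n ltrD2r.
have cphi : cont_circ r (fun z => f z * z).
  by move=> z zr; apply: contC_M; [exact: (holD_cont_circ rr hf)|exact: contC_id].
suff [] : is_derive w 1 (derive1 f)
  (cmean r (fun z => 2 * (f z * z * (z - w)^-1 ^+ 3))) by [].
apply: (is_deriveC_near (e := r - nc w) _ _ (is_derive_cauchy2 cphi wr)).
  by rewrite subr_gt0.
move=> v vw; have vr : nc v < r.
  have -> : v = (v - w) + w by rewrite subrK.
  by rewrite (le_lt_trans (ncD _ _))// -ltrBrDr.
by rewrite (derive1_cauchy rr hf vr).
Qed.

Definition ent f := forall z, derivable f z 1.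

Lemma entire_ent f : entire f -> ent f.
Proof. by move=> ef z; have /nbhs_singleton := ef z. Qed.

Lemma ent_holD f rho : ent f -> holD rho f.
Proof. by move=> ef z _; exact: ef. Qed.

Lemma ent_is_derive f : (forall z, exists a, is_derive z 1 f a) -> ent f.
Proof. by move=> H z; have [a []] := H z. Qed.

Lemma ent_cont f z : ent f -> {for z, continuous f}.
Proof. by move=> /(_ z)/derivable_contC. Qed.

Lemma ent_derive1 f : ent f -> ent (derive1 f).
Proof.
move=> ef z; apply: (@holD_derive1 (nc z + 1)); first exact: ent_holD.
by rewrite ltrDl.
Qed.

Lemma ent_derive1n f n : ent f -> ent (derive1n n f).
Proof.
by move=> ef; elim: n => [//|n IH]; rewrite derive1nS; exact: ent_derive1.
Qed.

Lemma entM f g : ent f -> ent g -> ent (fun z => f z * g z).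
Proof.
move=> ef eg; apply: ent_is_derive => z; eexists.
by apply: is_deriveCM; apply: derivable_is_derive.
Qed.

Lemma entB f g : ent f -> ent g -> ent (fun z => f z - g z).
Proof.
move=> ef eg; apply: ent_is_derive => z; eexists.
by apply: is_deriveCB; apply: derivable_is_derive.
Qed.

Lemma ent_comp f g : ent f -> ent g -> ent (fun z => g (f z)).
Proof.
move=> ef eg; apply: ent_is_derive => z; eexists.
by apply: is_deriveC_comp; apply: derivable_is_derive.
Qed.

Lemma ent_cst (c : C) : ent (fun=> c).
Proof. by apply: ent_is_derive => z; exists 0; exact: is_deriveC_cst. Qed.

Lemma ent_scale (a : C) : ent (fun z => a * z).
Proof.
apply: ent_is_derive => z; exists (a * 1).
exact: (@is_deriveCZ R a (fun z => z) z 1 (is_deriveC_id z)).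
Qed.

Lemma ent_subC (a : C) : ent (fun z => z - a).
Proof.
apply: ent_is_derive => z; eexists.
exact: is_deriveCB (is_deriveC_id z) (is_deriveC_cst a z).
Qed.

Lemma ent_expCM (a : C) : ent (fun z => expC (a * z)).
Proof. by apply: ent_is_derive => z; eexists; exact: is_derive_expCM. Qed.

Lemma entX f n : ent f -> ent (fun z => f z ^+ n).
Proof.
move=> ef; elim: n => [|n IH]; first exact: ent_cst.
by under eq_fun do rewrite exprS; exact: entM.
Qed.

Lemma ent_prod (s : seq C) : ent (fun z => \prod_(a <- s) (z - a)).
Proof.
elim: s => [|a s IH]; first by under eq_fun do rewrite big_nil; exact: ent_cst.
under eq_fun do rewrite big_cons.
by apply: entM; [exact: ent_subC|exact: IH].
Qed.

Lemma is_derive_shift0 f (c a : C) : is_derive c 1 f a ->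
  is_derive (0 : C) 1 (fun z => f (z + c)) a.
Proof.
move=> fa; have H : is_derive (0 : C) 1 (fun z => z + c) (1 + 0).
  exact: is_deriveCD (is_deriveC_id _) (is_deriveC_cst c _).
have fa' : is_derive (0 + c) 1 f a by rewrite add0r.
by have := is_deriveC_comp H fa'; rewrite addr0 mulr1.
Qed.

Lemma ent_shift f (c : C) : ent f -> ent (fun z => f (z + c)).
Proof.
move=> ef; apply: (@ent_comp (fun z => z + c) f _ ef).
apply: ent_is_derive => z; exists (1 + 0).
exact: is_deriveCD (is_deriveC_id z) (is_deriveC_cst c z).
Qed.

Lemma cauchy_estimate f (c : C) (d M : R) : ent f -> 0 < d ->
  (forall z, nc (z - c) <= d -> nc (f z) <= M) -> nc (derive1 f c) <= 2 * M / d.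
Proof.
move=> ef d0 fM.
have <- : derive1 (fun z => f (z + c)) 0 = derive1 f c.
  apply: derive1_is_derive; apply: is_derive_shift0; exact: derivable_is_derive.
have d1 : d < d + 1 by rewrite ltrDl.
have wd : nc (0 : C) < d by rewrite nc0.
have es := @ent_shift f c ef.
rewrite (derive1_cauchy d1 (@ent_holD _ (d + 1) es) wd) -mulrA.
apply: (nc_cmean_le_cst (ltW d0)) => z zd.
  apply: contC_M; first by apply: contC_M; [exact: ent_cont|exact: contC_id].
  by apply: contC_X; exact: (cont_kernel wd zd).
have z0 : z != 0 by rewrite -nc_gt0 zd.
have -> : f (z + c) * z * (z - 0)^-1 ^+ 2 = f (z + c) * z^-1 by rewrite subr0; field.
by rewrite ncM ncV zd ler_wpM2r ?invr_ge0 ?(ltW d0)// fM// addrK zd.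
Qed.

(** The quotient is the Cauchy transform of [f(z) z / (z - a)]: partial fractions and [f a = 0] give
    this off [a], Cauchy's formula for [f'] gives it at [a]. Differentiability at [a] comes for
    free. *)
Lemma ent_divide f (a : C) : ent f -> f a = 0 ->
  exists2 g, ent g & forall z, f z = (z - a) * g z.
Proof.
move=> ef fa; pose g z := if z == a then derive1 f a else f z / (z - a).
exists g; last first.
  move=> z; rewrite /g; case: eqP => [->|/eqP za]; first by rewrite subrr mul0r.
  by rewrite mulrC divfK// subr_eq0.
move=> w; pose r := Num.max (nc w) (nc a) + 1.
have wr : nc w < r by rewrite /r ltr_pwDr// le_max lexx.
have ar : nc a < r by rewrite /r ltr_pwDr// le_max lexx orbT.
have r0 : 0 <= r by rewrite (le_trans (nc_ge0 w))// ltW.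
have rr : r < r + 1 by rewrite ltrDl.
have hf := @ent_holD _ (r + 1) ef.
pose phi z := f z * z * (z - a)^-1.
have cfz : cont_circ r (fun z => f z * z).
  by move=> z zr; apply: contC_M; [exact: ent_cont|exact: contC_id].
have cphi : cont_circ r phi.
  by move=> z zr; apply: contC_M; [exact: cfz|exact: (cont_kernel ar zr)].
suff [] : is_derive w 1 g (cmean r (fun z => phi z * (z - w)^-1 ^+ 2)) by [].
apply: (is_deriveC_near (e := r - nc w) _ _ (is_derive_cauchy1 cphi wr)).
  by rewrite subr_gt0.
move=> v vw; have vr : nc v < r.
  have -> : v = (v - w) + w by rewrite subrK.
  by rewrite (le_lt_trans (ncD _ _))// -ltrBrDr.
rewrite /g; case: eqP => [->|/eqP va].
  rewrite (derive1_cauchy rr hf ar); apply: eq_cmean => // z zr.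
  by rewrite /phi expr1 expr2 mulrA.
have va0 : v - a != 0 by rewrite subr_eq0.
apply: (mulfI va0); rewrite [RHS]mulrC divfK// -[RHS]subr0 -fa.
rewrite -(cauchy_formula rr hf vr) -[f a](cauchy_formula rr hf ar).
have cv := cont_kernel vr; have ca := cont_kernel ar.
rewrite -(cmeanB r0); last 2 first.
- by move=> z zr; apply: contC_M; [exact: cfz|exact: cv].
- by move=> z zr; apply: contC_M; [exact: cfz|exact: ca].
rewrite -(cmeanZ r0); last first.
  by move=> z zr; apply: contC_M; [exact: cphi|apply: contC_X; exact: cv].
apply: eq_cmean => // z zr; rewrite /phi expr1.
have := circ_neq zr ar; have := circ_neq zr vr => h1 h2.
by field; rewrite ?h1 ?h2.
Qed.

Lemma expr_small (e K : R) : 0 < e -> exists n : nat, K * 2^-1 ^+ n < e.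
Proof.
move=> e0; have : (fun n => K * 2^-1 ^+ n) @ \oo --> K * 0.
  by apply: cvgMr; apply: cvg_expr; rewrite ger0_norm ?invf_lt1 ?ltr1n.
rewrite mulr0 => /cvgrPdist_lt/(_ _ e0)[n _ nP]; exists n.
have := nP n (leqnn n); rewrite sub0r normrN; apply: le_lt_trans.
exact: ler_norm.
Qed.

(** If every power of [z] divided [f], Cauchy's formula for [f / z^n] at [w], on a circle of radius
    above [2 * nc w], would bound [f w] by a constant times [2^-n]. *)
Lemma ent_order0 f : ent f -> (exists z, f z != 0) ->
  exists m g, [/\ ent g, g 0 != 0 & forall z, f z = z ^+ m * g z].
Proof.
move=> ef [w fw]; apply: contrapT => H.
have step n : exists2 g, ent g & forall z, f z = z ^+ n * g z.
  elim: n => [|n [g eg fg]]; first by exists f => // z; rewrite expr0 mul1r.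
  have g0 : g 0 = 0 by apply: contrapT => /eqP g0; apply: H; exists n, g.
  have [h eh gh] := ent_divide eg g0; exists h => // z.
  by rewrite fg gh subr0 exprSr mulrA.
pose r := 2 * nc w + 1.
have wr : nc w < r by rewrite /r mulr_natl mulr2n -addrA ltr_pwDr// ltr_wpDl ?nc_ge0.
have r0 : 0 < r by rewrite (le_lt_trans (nc_ge0 w)).
have rr : r < r + 1 by rewrite ltrDl.
pose K := 2 * mean r (fun z => nc (f z)) * (r / (r - nc w)).
have [|n nP] := @expr_small (nc (f w)) K; first by rewrite nc_gt0.
move: nP; apply/negP; rewrite -leNgt.
have [g eg fg] := step n.
have hg := @ent_holD _ (r + 1) eg.
have cnf : cont_circ r (fun z => nc (f z)).
  by move=> z zr; apply: contC_nc; exact: ent_cont.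
have gw : nc (g w) <= 2 * (mean r (fun z => nc (f z)) * (r / (r - nc w)) / r ^+ n).
  rewrite -(cauchy_formula rr hg wr).
  have -> : mean r (fun z => nc (f z)) * (r / (r - nc w)) / r ^+ n =
     r / (r - nc w) / r ^+ n * mean r (fun z => nc (f z)) by ring.
  rewrite -(meanZ (ltW r0) _ cnf); apply: (nc_cmean_le (ltW r0)).
  - move=> z zr; apply: contC_M; last exact: (cont_kernel wr zr).
    by apply: contC_M; [exact: ent_cont|exact: contC_id].
  - by move=> z zr; apply: contR_M; [exact: contR_cst|exact: cnf].
  - move=> z zr; rewrite fg !ncM ncX zr.
    have -> : r / (r - nc w) / r ^+ n * (r ^+ n * nc (g z)) =
      nc (g z) * r * (r - nc w)^-1.
      have rn0 : r ^+ n != 0 by rewrite expf_neq0// gt_eqF.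
      have rw0 : r - nc w != 0 by rewrite subr_eq0 gt_eqF.
      by field; rewrite ?rn0 ?rw0.
    by rewrite ler_wpM2l ?kernel_bound// mulr_ge0 ?nc_ge0// ltW.
rewrite fg ncM ncX (le_trans (ler_wpM2l (exprn_ge0 _ (nc_ge0 _)) gw))//.
set m := mean r _ in K *.
have -> : nc w ^+ n * (2 * (m * (r / (r - nc w)) / r ^+ n)) = K * (nc w / r) ^+ n.
  by rewrite /K expr_div_n; ring.
rewrite ler_wpM2l//.
  rewrite /K mulr_ge0 ?divr_ge0 ?subr_ge0 ?(ltW wr) ?(ltW r0)// mulr_ge0//.
  by apply: mean_ge0; [exact: ltW|move=> z _; exact: nc_ge0].
rewrite lerXn2r ?nnegrE ?divr_ge0 ?nc_ge0 ?(ltW r0) ?invr_ge0//.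
by rewrite ler_pdivrMr// mulrC ler_pdivlMr// mulrC /r lerDl.
Qed.

Lemma ent_order f (a : C) : ent f -> (exists z, f z != 0) ->
  exists m g, [/\ ent g, g a != 0 & forall z, f z = (z - a) ^+ m * g z].
Proof.
move=> ef [w fw].
have [||m [g [eg g0 fg]]] := @ent_order0 (fun z => f (z + a)).
- exact: ent_shift.
- by exists (w - a); rewrite subrK.
exists m, (fun z => g (z + (- a))); split; first exact: ent_shift.
  by rewrite subrr.
by move=> z; rewrite -fg subrK.
Qed.

Lemma prod_nc_ge (s : seq C) (z : C) (c : R) : 0 <= c ->
  (forall a, a \in s -> c <= nc (z - a)) ->
  c ^+ size s <= nc (\prod_(a <- s) (z - a)).
Proof.
move=> c0; elim: s => [|a s IH] H; first by rewrite big_nil nc1 expr0.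
rewrite big_cons ncM exprS; apply: ler_pM; rewrite ?exprn_ge0//.
  by apply: H; rewrite mem_head.
by apply: IH => b bs; apply: H; rewrite inE bs orbT.
Qed.

Lemma prod_nc_le (s : seq C) (z : C) (c : R) :
  (forall a, a \in s -> nc (z - a) <= c) ->
  nc (\prod_(a <- s) (z - a)) <= c ^+ size s.
Proof.
elim: s => [|a s IH] H; first by rewrite big_nil nc1 expr0.
rewrite big_cons ncM exprS; apply: ler_pM; rewrite ?nc_ge0//.
  by apply: H; rewrite mem_head.
by apply: IH => b bs; apply: H; rewrite inE bs orbT.
Qed.

(** On the circle of radius [3 * rho] each factor has modulus at least [2 * rho], at the origin at
    most [rho]. So each zero halves the bound for [f 0]. *)
Lemma zero_count_bound f g (s : seq C) rho : ent f -> ent g -> 0 < rho ->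
  (forall a, a \in s -> nc a <= rho) ->
  (forall z, f z = \prod_(a <- s) (z - a) * g z) ->
  nc (f 0) <= 2 * mean (3 * rho) (fun z => nc (f z)) * 2^-1 ^+ size s.
Proof.
move=> ef eg rho0 srho fg; set n := size s.
pose r := 3 * rho; have r0 : 0 < r by rewrite mulr_gt0.
have cnf : cont_circ r (fun z => nc (f z)).
  by move=> z zr; apply: contC_nc; exact: ent_cont.
have rr : r < r + 1 by rewrite ltrDl.
have g0 : nc (g 0) <= 2 * ((2 * rho) ^- n * mean r (fun z => nc (f z))).
  rewrite -(cmean_center r0 rr (@ent_holD _ (r + 1) eg)).
  rewrite -(meanZ (ltW r0) _ cnf); apply: (nc_cmean_le (ltW r0)).
  - by move=> z zr; exact: ent_cont.
  - by move=> z zr; apply: contR_M; [exact: contR_cst|exact: cnf].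
  - move=> z zr; rewrite fg ncM mulrA ler_peMl ?nc_ge0//.
    rewrite mulrC ler_pdivlMr ?exprn_gt0 ?mulr_gt0// mul1r.
    apply: prod_nc_ge; first by rewrite mulr_ge0// ltW.
    move=> a /srho ar; apply: le_trans (ncBl _ _).
    rewrite zr /r lerBrDr (le_trans (lerD (lexx _) ar))//.
    by rewrite le_eqVlt; apply/orP; left; apply/eqP; ring.
rewrite fg ncM.
have p0 : nc (\prod_(a <- s) (0 - a)) <= rho ^+ n.
  by apply: prod_nc_le => a /srho; rewrite sub0r ncN.
apply: le_trans (ler_pM (nc_ge0 _) (nc_ge0 _) p0 g0) _.
rewrite -/r le_eqVlt; apply/orP; left; apply/eqP; rewrite exprMn exprVn; field.
by rewrite !expf_neq0// gt_eqF.
Qed.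

(** Zeros are divided out one by one, with multiplicity. The process stops, for otherwise
    [zero_count_bound] would force [f 0 = 0]. *)
Lemma ent_factor f rho : ent f -> f 0 != 0 -> 0 < rho ->
  exists s g, [/\ ent g, forall a, a \in s -> 0 < nc a <= rho,
    forall z, f z = \prod_(a <- s) (z - a) * g z &
    forall z, nc z <= rho -> g z != 0].
Proof.
move=> ef f0 rho0; apply: contrapT => H.
have step n : exists s g, [/\ size s = n, ent g, forall a, a \in s -> 0 < nc a <= rho &
    forall z, f z = \prod_(a <- s) (z - a) * g z].
  elim: n => [|n [s [g [sn eg srho fg]]]].
    by exists [::], f; split=> // z; rewrite big_nil mul1r.
  have [a [arho ga]] : exists a, nc a <= rho /\ g a = 0.
    apply: contrapT => K; apply: H; exists s, g; split=> // z zrho.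
    by apply/eqP => gz; apply: K; exists z.
  have [h eh gh] := ent_divide eg ga; exists (a :: s), h; split => //.
  - by rewrite /= sn.
  - move=> b; rewrite inE => /predU1P[->|/srho//].
    rewrite arho andbT nc_gt0; apply/eqP => a0; move/eqP: f0; apply.
    by rewrite fg -a0 ga mulr0.
  - by move=> z; rewrite fg gh big_cons; ring.
have [|n nP] := @expr_small (nc (f 0)) (2 * mean (3 * rho) (fun z => nc (f z))).
  by rewrite nc_gt0.
move: nP; apply/negP; rewrite -leNgt; have [s [g [sn eg srho fg]]] := step n.
rewrite -sn; apply: (zero_count_bound ef eg rho0 _ fg).
by move=> a /srho/andP[].
Qed.

End Entire.

(** * Logarithms and logarithmic means *)

Section Logarithm.
Variable R : realType.
Local Notation C := R[i].
Implicit Types (f g phi : C -> C) (w z a : C) (r rho : R).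

Lemma holD_lt rho rho' f : rho' <= rho -> holD rho f -> holD rho' f.
Proof. by move=> rr hf z zr; apply: hf; exact: lt_le_trans rr. Qed.

Lemma holDM rho f g : holD rho f -> holD rho g -> holD rho (fun z => f z * g z).
Proof.
move=> hf hg z zr; have df := derivable_is_derive (hf z zr).
have dg := derivable_is_derive (hg z zr).
by have [] := is_deriveCM df dg.
Qed.

Lemma holDV rho g : (forall z, nc z < rho -> g z != 0) -> holD rho g ->
  holD rho (fun z => (g z)^-1).
Proof.
move=> g0 hg z zr; have dg := derivable_is_derive (hg z zr).
by have [] := is_deriveCV (g0 z zr) dg.
Qed.

(** A Taylor remainder uniform over a smaller disc, as needed to differentiate under the integral
    sign along a whole ray. *)
Lemma holD_quadratic rho s f : 0 <= s -> s < rho -> holD rho f -> exists d M : R,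
  [/\ 0 < d, 0 <= M, (forall v h, nc v <= s -> nc h < d ->
    nc (f (v + h) - f v - derive1 f v * h) <= M * nc h ^+ 2) &
  forall v, nc v <= s -> nc (derive1 f v) <= M].
Proof.
move=> s0 srho hf; pose r := (s + rho) / 2.
have sr : s < r by rewrite /r ltr_pdivlMr// mulr_natr mulr2n ltrD2l.
have rr : r < rho by rewrite /r ltr_pdivrMr// mulr_natr mulr2n ltrD2r.
have r0 : 0 < r by exact: le_lt_trans sr.
pose phi z := f z * z.
have cphi : cont_circ r phi.
  by move=> z zr; apply: contC_M; [exact: (holD_cont_circ rr hf)|exact: contC_id].
have cnphi : cont_circ r (fun z => nc (phi z)).
  by move=> z zr; apply: contC_nc; exact: cphi.
have fE v : nc v < r -> f v = cmean r (fun z => phi z * (z - v)^-1 ^+ 1).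
  by move=> vr; rewrite -(cauchy_formula rr hf vr).
pose m := mean r (fun z => nc (phi z)).
have m0 : 0 <= m by apply: (mean_ge0 (ltW r0)) => z _; exact: nc_ge0.
have rs0 : 0 < r - s by rewrite subr_gt0.
pose K := 2 / (r - s); have K0 : 0 < K by rewrite divr_gt0.
have mK n : 0 <= 2 * m * K ^+ n.
  by apply: mulr_ge0; [rewrite mulr_ge0|rewrite exprn_ge0 ?(ltW K0)].
exists ((r - s) / 2), (2 * m * K ^+ 3 + 2 * m * K ^+ 2); split.
- by rewrite divr_gt0.
- by rewrite addr_ge0.
- move=> v h vs hd.
  have vr : nc v < r := le_lt_trans vs sr.
  have hd' : nc h < (r - nc v) / 2.
    by rewrite (lt_le_trans hd)// ler_wpM2r ?invr_ge0// lerB.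
  have vhr : nc (v + h) < r.
    rewrite (le_lt_trans (ncD _ _))// -ltrBrDl (lt_trans hd')//.
    by rewrite ltr_pdivrMr// ltr_pMr ?ltr1n// subr_gt0.
  rewrite (fE _ vr) (fE _ vhr) (derive1_cauchy rr hf vr).
  apply: le_trans (cauchy1_quadratic cphi vr hd') _.
  rewrite ler_wpM2r ?exprn_ge0 ?nc_ge0// -/m.
  apply: (@le_trans _ _ (2 * m * K ^+ 3)).
    apply: ler_wpM2l; first by rewrite mulr_ge0.
    apply: lerXn2r; rewrite ?nnegrE ?divr_ge0 ?subr_ge0 ?(ltW vr) ?(ltW sr)//.
    by rewrite ler_wpM2l// lef_pV2 ?posrE ?subr_gt0// lerB.
  by rewrite lerDl.
- move=> v vs; have vr : nc v < r := le_lt_trans vs sr.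
  rewrite (derive1_cauchy rr hf vr).
  apply: (@le_trans _ _ (2 * m * K ^+ 2)); last first.
    by rewrite lerDr.
  rewrite -mulrA [m * _]mulrC -(meanZ (ltW r0) _ cnphi); apply: (nc_cmean_le (ltW r0)).
  + move=> z zr; apply: contC_M; first exact: cphi.
    by apply: contC_X; exact: (cont_kernel vr zr).
  + by move=> z zr; apply: contR_M; [exact: contR_cst|exact: cnphi].
  + move=> z zr; rewrite ncM ncX mulrC ler_wpM2r ?nc_ge0//.
    rewrite lerXn2r ?nnegrE ?nc_ge0 ?(ltW K0)//.
    apply: le_trans (kernel_bound zr vr) _; rewrite /K -[leLHS]mul1r.
    by apply: ler_pM; rewrite ?ler1n ?invr_ge0 ?subr_ge0 ?(ltW vr)// lef_pV2 ?posrE ?subr_gt0// lerB.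
Qed.

Lemma nc_scale_le (t : R) w : 0 <= t <= 1 -> nc ((t%:C)%C * w) <= nc w.
Proof. by move=> /andP[t0 t1]; rewrite ncM nc_pos// ler_piMl ?nc_ge0. Qed.

Lemma is_derive_ray rho f w (t : R) : holD rho f -> nc w < rho -> 0 <= t <= 1 ->
  is_derive (t%:C)%C 1 (fun s : C => f (s * w)) (derive1 f ((t%:C)%C * w) * w).
Proof.
move=> hf wr t01; have ds : is_derive ((t%:C)%C : C) 1 (fun s : C => s * w)
    ((t%:C)%C * 0 + w * 1).
  exact: is_deriveCM (is_deriveC_id _) (is_deriveC_cst w _).
have df : is_derive ((t%:C)%C * w) 1 f (derive1 f ((t%:C)%C * w)).
  apply: derivable_is_derive; apply: hf.
  exact: le_lt_trans (nc_scale_le w t01) wr.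
by have := is_deriveC_comp ds df; rewrite mulr0 add0r mulr1.
Qed.

Lemma ray_cont rho f w : holD rho f -> nc w < rho ->
  cont_on 0 1 (fun t : R => f ((t%:C)%C * w)).
Proof.
move=> hf wr t t01; have := is_derive_contC (is_derive_ray hf wr t01).
exact: (continuous_comp (@realC_continuous R t)).
Qed.

Lemma derive0_cst rho f w : holD rho f ->
  (forall z, nc z < rho -> derive1 f z = 0) -> nc w < rho -> f w = f 0.
Proof.
move=> hf f0 wr; apply/eqP; rewrite -subr_eq0; apply/eqP.
have : CI 0 1 (fun=> 0) = f (1 * w) - f (0 * w).
  apply: (@CI_FTC R 0 1 (fun s => f (s * w)) (fun s => 0)) => //.
    by move=> t _; exact: contC_cst.
  move=> t t01; apply: is_deriveC_eq (is_derive_ray hf wr t01).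
  by rewrite f0 ?mul0r// (le_lt_trans (nc_scale_le w t01)).
by rewrite mul1r mul0r CI_cst// mulr0 => <-.
Qed.

(** The primitive is the integral of [f] along the segment from the origin, parametrised by
    [[0, 1]]. *)
Lemma primitive_exists rho f : holD rho f ->
  exists q, forall z, nc z < rho -> is_derive z 1 q (f z).
Proof.
move=> hf; exists (fun w => CI 0 1 (fun t => w * f ((t%:C)%C * w))) => w wr.
pose s := (nc w + rho) / 2.
have ws : nc w < s by rewrite /s ltr_pdivlMr// mulr_natr mulr2n ltrD2l.
have srho : s < rho by rewrite /s ltr_pdivrMr// mulr_natr mulr2n ltrD2r.
have s0 : 0 <= s by rewrite (le_trans (nc_ge0 w))// ltW.
have [d [M [d0 M0 fM f1M]]] := holD_quadratic s0 srho hf.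
have hf1 := holD_derive1 hf.
(* Integrating the derivative of [t * f(t w)] writes the expected derivative as an integral over the
   same segment, so remainders can be compared under the integral sign. *)
have fw : f w = CI 0 1 (fun t => f ((t%:C)%C * w) + (t%:C)%C * (derive1 f ((t%:C)%C * w) * w)).
  have -> : f w = 1 * f (1 * w) - 0 * f (0 * w) by rewrite !mul1r mul0r subr0.
  apply/esym/(@CI_FTC R 0 1 (fun u => u * f (u * w))
    (fun u => f (u * w) + u * (derive1 f (u * w) * w))) => //.
  - move=> t t01; apply: contC_D; first exact: (ray_cont hf wr t01).
    apply: contC_M; first exact: realC_continuous.
    by apply: contC_M; [exact: (ray_cont hf1 wr t01)|exact: contC_cst].
  - move=> t t01; have := is_deriveCM (is_deriveC_id _) (is_derive_ray hf wr t01).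
    by apply: is_deriveC_eq; rewrite mulr1 addrC.
apply: (@is_derive_quadratic R _ _ _ (Num.min d (s - nc w)) (2 * ((s + 1) * M))).
- by rewrite lt_min d0 subr_gt0.
- by rewrite !mulr_ge0// addr_ge0.
move=> h; rewrite lt_min => /andP[hd hs].
have whs : nc (w + h) <= s by rewrite (le_trans (ncD _ _))// -lerBrDl ltW.
have whr : nc (w + h) < rho := le_lt_trans whs srho.
have c1 : cont_on 0 1 (fun t : R => (w + h) * f ((t%:C)%C * (w + h))).
  by move=> t t01; apply: contC_M; [exact: contC_cst|exact: (ray_cont hf whr t01)].
have c2 : cont_on 0 1 (fun t : R => w * f ((t%:C)%C * w)).
  by move=> t t01; apply: contC_M; [exact: contC_cst|exact: (ray_cont hf wr t01)].
have c3 : cont_on 0 1 (fun t : R => f ((t%:C)%C * w) + (t%:C)%C * (derive1 f ((t%:C)%C * w) * w)).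
  move=> t t01; apply: contC_D; first exact: (ray_cont hf wr t01).
  apply: contC_M; first exact: realC_continuous.
  by apply: contC_M; [exact: (ray_cont hf1 wr t01)|exact: contC_cst].
have c4 : cont_on 0 1 (fun t : R => h * (f ((t%:C)%C * w) + (t%:C)%C * (derive1 f ((t%:C)%C * w) * w))).
  by move=> t t01; apply: contC_M; [exact: contC_cst|exact: c3].
have c12 : cont_on 0 1 (fun t : R => (w + h) * f ((t%:C)%C * (w + h)) - w * f ((t%:C)%C * w)).
  by move=> t t01; apply: contC_B; [exact: c1|exact: c2].
rewrite fw [_ * h]mulrC -(CI_Z _ c3) -(CI_B c1 c2) -(CI_B c12 c4).
have -> : 2 * ((s + 1) * M) * nc h ^+ 2 = 2 * ((s + 1) * M * nc h ^+ 2 * (1 - 0)).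
  by ring.
apply: CI_nc_le_cst; first exact: ler01.
  by move=> t t01; apply: contC_B; [exact: c12|exact: c4].
move=> t t01; set tc := (t%:C)%C.
have tw : nc (tc * w) <= s by rewrite (le_trans (nc_scale_le w t01))// ltW.
have th : nc (tc * h) <= nc h := nc_scale_le h t01.
have := fM _ _ tw (le_lt_trans th hd); rewrite -mulrDr.
set E := f (tc * (w + h)) - _ - _ => EM.
have -> : (w + h) * f (tc * (w + h)) - w * f (tc * w) -
    h * (f (tc * w) + tc * (derive1 f (tc * w) * w)) =
    (w + h) * E + tc * h ^+ 2 * derive1 f (tc * w) by rewrite /E; ring.
have -> : (s + 1) * M * nc h ^+ 2 = s * (M * nc h ^+ 2) + M * nc h ^+ 2 by ring.
apply: le_trans (ncD _ _) _; apply: lerD.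
  rewrite ncM; apply: ler_pM; rewrite ?nc_ge0//.
  by rewrite (le_trans EM)// ler_wpM2l// lerXn2r ?nnegrE ?nc_ge0.
rewrite ncM mulrC; apply: ler_pM; rewrite ?nc_ge0 ?f1M//.
rewrite expr2 mulrA ncM expr2; apply: ler_pM; rewrite ?nc_ge0//.
Qed.

(** With [q] a primitive of [g' / g], the function [g exp(-q)] is constant. Only the real part of a
    logarithm is needed, so the constant is absorbed through its modulus. *)
Lemma log_exists rho g : 0 < rho -> holD rho g ->
  (forall z, nc z < rho -> g z != 0) ->
  exists2 q, holD rho q & forall z, nc z < rho -> ln (nc (g z)) = complex.Re (q z).
Proof.
move=> rho0 hg g0.
have hl : holD rho (fun z => derive1 g z * (g z)^-1).
  by apply: holDM; [exact: holD_derive1|exact: holDV].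
have [q dq] := primitive_exists hl.
pose F z := g z * expC (- q z).
have dF z : nc z < rho -> is_derive z 1 F 0.
  move=> zr; have dN : is_derive z 1 (fun v => - q v) (- (derive1 g z * (g z)^-1)).
    have := is_deriveCZ (-1) (dq z zr); rewrite mulN1r.
    by apply: is_derive_eqf => v; rewrite mulN1r.
  have de := is_deriveC_comp dN (is_derive_expC (- q z)).
  have dg := derivable_is_derive (hg z zr).
  apply: is_deriveC_eq (is_deriveCM dg de).
  by have gz := g0 z zr; field.
have hF : holD rho F by move=> z /dF[].
have F00 : F 0 != 0 by rewrite mulf_neq0 ?expC_neq0// g0// nc0.
have gE z : nc z < rho -> g z = F 0 * expC (q z).
  move=> zr; rewrite -(derive0_cst hF _ zr) => [|v /dF]; last exact: derive1_is_derive.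
  by rewrite /F -mulrA -expCD addNr expC0 mulr1.
exists (fun z => q z + ((ln (nc (F 0)))%:C)%C).
  move=> z zr; have := is_deriveCD (dq z zr) (is_deriveC_cst ((ln (nc (F 0)))%:C)%C z).
  by case.
move=> z zr; rewrite (gE z zr) ncM nc_expC cReD /= addrC.
by rewrite lnM ?posrE ?nc_gt0 ?expR_gt0// expRK.
Qed.

Lemma cont_ln_nc g z : g z != 0 -> {for z, continuous g} ->
  {for z, continuous (fun v => ln (nc (g v)))}.
Proof. by move=> g0 gc; apply: contR_ln; [rewrite nc_gt0|exact: contC_nc]. Qed.

Lemma mean_ln_zerofree rho r g : 0 < r -> r < rho -> holD rho g ->
  (forall z, nc z < rho -> g z != 0) ->
  mean r (fun z => ln (nc (g z))) = ln (nc (g 0)).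
Proof.
move=> r0 rr hg g0; have rho0 := lt_trans r0 rr.
have [q hq qE] := log_exists rho0 hg g0.
rewrite (eq_mean (ltW r0) (h := fun z => complex.Re (q z))); last first.
  by move=> z zr; rewrite qE// zr.
by rewrite -Re_cmean (cmean_center r0 rr hq) qE// nc0.
Qed.

(** For [nc a < r] the zero is reflected outside: on the circle [r |z - a| = |r^2 - conjc a * z|],
    which is zero-free on a larger disc. The case [nc a = r], with its singular integrand, is
    avoided by the choice of radii. *)
Lemma mean_ln_sub r a : 0 < r -> nc a != r ->
  mean r (fun z => ln (nc (z - a))) = ln (Num.max r (nc a)).
Proof.
move=> r0 ar; case: (ltgtP (nc a) r) ar => // [ar|ra] _.
  pose g z := ((r ^+ 2)%:C)%C - conjc a * z.
  have hg : holD (2 * r ^+ 2 / (r + nc a)) g.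
    move=> z _.
    have := is_deriveCB (is_deriveC_cst ((r ^+ 2)%:C)%C z) (is_deriveCZ (conjc a) (is_deriveC_id z)).
    by case.
  have gn z := reflected_neq0 r0 ar (z := z).
  have rr := reflected_radius r0 ar.
  rewrite (eq_mean (ltW r0) (h := fun z => ln (nc (g z)) - ln r)); last first.
    move=> z zr; have z0 : z != 0 by rewrite -nc_gt0 zr.
    have za : z - a != 0 := circ_neq zr ar.
    have -> : g z = z * conjc (z - a).
      by rewrite /g conjcB (circ_conj r0 zr); field.
    by rewrite ncM nc_conj zr lnM ?posrE ?nc_gt0// [ln r + _]addrC addrK.
  rewrite (meanB (ltW r0)); last 2 first.
  - move=> z zr; have zg : nc z < 2 * r ^+ 2 / (r + nc a) by rewrite zr.
    by apply: cont_ln_nc; [exact: gn|apply: derivable_contC; exact: hg].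
  - by move=> z _; exact: contR_cst.
  rewrite mean_cst (mean_ln_zerofree r0 rr hg gn) /g mulr0 subr0.
  by rewrite nc_pos ?sqr_ge0// lnXn// mulr2n addrK.
have hg : holD (nc a) (fun z => z - a).
  by move=> z _; exact: ent_subC.
rewrite (mean_ln_zerofree r0 ra hg) ?sub0r ?ncN// => z za.
by apply: contraTneq za => /subr0_eq ->; rewrite ltxx.
Qed.

(** On the circle the integrand is the conjugate of a function that is holomorphic on a larger disc
    and vanishes at the origin, owing to the factor [r^2 * v]. *)
Lemma cmean_conj_kernel rho r q w z : 0 < r -> r < rho -> holD rho q ->
  nc w < r -> nc z < r ->
  cmean r (fun v => conjc (q v) * v * (v - w)^-1 * (v - z)^-1) = 0.
Proof.
move=> r0 rr hq wr zr.
pose rho' := Num.min rho (Num.min (2 * r ^+ 2 / (r + nc w)) (2 * r ^+ 2 / (r + nc z))).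
have rr' : r < rho' by rewrite !lt_min rr !reflected_radius.
pose G v := q v * ((r ^+ 2)%:C%C * v) * (((r ^+ 2)%:C)%C - conjc w * v)^-1 *
   (((r ^+ 2)%:C)%C - conjc z * v)^-1.
have hV u : nc u < r -> holD (2 * r ^+ 2 / (r + nc u))
    (fun v => (((r ^+ 2)%:C)%C - conjc u * v)^-1).
  by move=> ur v vu; have := is_derive_affV (reflected_neq0 r0 ur vu); case.
have hG : holD rho' G.
  apply: holDM; first apply: holDM; first apply: holDM.
  - by apply: holD_lt hq; rewrite ge_min lexx.
  - by move=> v _; exact: ent_scale.
  - by apply: holD_lt (hV _ wr); rewrite !ge_min lexx !orbT.
  - by apply: holD_lt (hV _ zr); rewrite !ge_min lexx !orbT.
have cG := holD_cont_circ rr' hG.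
have -> : cmean r (fun v => conjc (q v) * v * (v - w)^-1 * (v - z)^-1) = conjc (cmean r G).
  rewrite -(cmean_conj (ltW r0) cG); apply: (eq_cmean (ltW r0)) => v vr.
  have v0 : v != 0 by rewrite -nc_gt0 vr.
  have vw := circ_neq vr wr; have vz := circ_neq vr zr.
  rewrite /G !conjcM !conjcV !conjcB !conjcM !conjcK !conjc_real (circ_conj r0 vr).
  have r20 : ((r ^+ 2)%:C)%C != 0 :> C by rewrite -nc_gt0 nc_pos ?sqr_ge0// exprn_gt0.
  have E u : v - u != 0 -> ((r ^+ 2)%:C)%C - u * (((r ^+ 2)%:C)%C / v) =
     ((r ^+ 2)%:C)%C * ((v - u) / v) by move=> _; field.
  rewrite !E//; set k := ((r ^+ 2)%:C)%C in r20 *; field.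
  have rC : (r%:C)%C != 0 :> C by rewrite -nc_gt0 nc_pos// ltW.
  by apply/and4P; split => //; exact: rC.
by rewrite (cmean_center r0 rr' hG) /G mulr0 mulr0 !mul0r conjc0.
Qed.

(** In the difference of two Cauchy formulas for a logarithm [q], the conjugate term has integral
    zero and may be added; only [2 Re q] remains, hence only [ln |g|] on the circle. Then 16 is 2
    from this, 2 from [nc_cmean_le] and 4 from two kernels of size at most [2 / r]. The free shift
    [k] allows a normalisation of [g]. *)
Lemma log_oscillation rho r g w z (k : R) : 0 < r -> r < rho -> holD rho g ->
  (forall v, nc v < rho -> g v != 0) -> nc w <= r / 2 -> nc z <= r / 2 ->
  ln (nc (g w)) - ln (nc (g z)) <=
    16 * (nc (w - z) / r) * mean r (fun v => `|ln (nc (g v)) + k|).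
Proof.
move=> r0 rr hg g0 wr2 zr2; have rho0 := lt_trans r0 rr.
have r2r : r / 2 < r by rewrite ltr_pdivrMr// ltr_pMr// ltr1n.
have wr := le_lt_trans wr2 r2r; have zr := le_lt_trans zr2 r2r.
have [q0 hq0 q0E] := log_exists rho0 hg g0.
pose q v := q0 v + (k%:C)%C.
have hq : holD rho q.
  move=> v vr; have := is_deriveCD (derivable_is_derive (hq0 v vr))
    (is_deriveC_cst (k%:C)%C v).
  by case.
have qE v : nc v < rho -> ln (nc (g v)) + k = complex.Re (q v).
  by move=> vr; rewrite q0E// cReD.
have cq := holD_cont_circ rr hq.
have cKw := cont_kernel wr; have cKz := cont_kernel zr.
have ck (F : C -> C) : cont_circ r F ->
    cont_circ r (fun v => F v * v * (v - w)^-1 * (v - z)^-1).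
  move=> cF v vr; apply: contC_M; last exact: cKz.
  apply: contC_M; last exact: cKw.
  by apply: contC_M; [exact: cF|exact: contC_id].
have cu : cont_circ r (fun v => ((complex.Re (q v))%:C)%C).
  move=> v vr; apply: (continuous_comp (contC_Re (cq v vr))).
  exact: realC_continuous.
have D : q w - q z = (w - z) * (2 * cmean r (fun v =>
    ((complex.Re (q v))%:C)%C * v * (v - w)^-1 * (v - z)^-1)).
  have c1 := ck _ cq.
  have c2 : cont_circ r (fun v => conjc (q v) * v * (v - w)^-1 * (v - z)^-1).
    by apply: ck => v vr; apply: contC_conj; exact: cq.
  rewrite -(cauchy_formula rr hq wr) -(cauchy_formula rr hq zr).
  rewrite -(cmeanB (ltW r0)); last 2 first.
  - move=> v vr; apply: contC_M; last exact: cKw.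
    by apply: contC_M; [exact: cq|exact: contC_id].
  - move=> v vr; apply: contC_M; last exact: cKz.
    by apply: contC_M; [exact: cq|exact: contC_id].
  rewrite -(cmeanZ (ltW r0) 2 (ck _ cu)).
  have -> : cmean r (fun v => 2 * (((complex.Re (q v))%:C)%C * v * (v - w)^-1 * (v - z)^-1)) =
     cmean r (fun v => q v * v * (v - w)^-1 * (v - z)^-1 +
       conjc (q v) * v * (v - w)^-1 * (v - z)^-1).
    by apply: (eq_cmean (ltW r0)) => v _; rewrite -!mulrDl addcJ !mulrA.
  rewrite (cmeanD (ltW r0) c1 c2) (cmean_conj_kernel r0 rr hq wr zr) addr0.
  rewrite -(cmeanZ (ltW r0) _ c1); apply: (eq_cmean (ltW r0)) => v vr.
  have vw := circ_neq vr wr; have vz := circ_neq vr zr.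
  by field; rewrite vw vz.
have -> : ln (nc (g w)) - ln (nc (g z)) = complex.Re (q w - q z).
  by rewrite cReD cReN -!qE ?(lt_trans wr) ?(lt_trans zr)//; ring.
apply: (le_trans (ler_norm _)); apply: (le_trans (Re_le_nc _)).
rewrite D ncM ncM nc_nat.
have cabs : cont_circ r (fun v => `|ln (nc (g v)) + k|).
  move=> v vr; apply: contR_norm; apply: contR_D; last exact: contR_cst.
  have vrho : nc v < rho by rewrite vr.
  by apply: cont_ln_nc; [exact: g0|apply: derivable_contC; exact: hg].
have B : nc (cmean r (fun v => ((complex.Re (q v))%:C)%C * v * (v - w)^-1 * (v - z)^-1)) <=
    2 * (4 / r * mean r (fun v => `|ln (nc (g v)) + k|)).
  rewrite -(meanZ (ltW r0) _ cabs); apply: (nc_cmean_le (ltW r0)); first exact: ck.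
    by move=> v vr; apply: contR_M; [exact: contR_cst|exact: cabs].
  move=> v vr; rewrite !ncM nc_real -qE ?vr// mulrC.
  have half u : nc u <= r / 2 -> nc (v - u)^-1 <= 2 / r.
    move=> ur; have ur' := le_lt_trans ur r2r.
    apply: le_trans (kernel_bound vr ur') _.
    rewrite -[2 / r]invf_div lef_pV2 ?posrE ?divr_gt0 ?subr_gt0//.
    by rewrite lerBrDr -lerBrDl (le_trans ur)// le_eqVlt; apply/orP; left; apply/eqP; field.
  apply: (@le_trans _ _ (2 / r * (`|ln (nc (g v)) + k| * r * (2 / r)))).
    apply: ler_pM; rewrite ?nc_ge0 ?half//; first by rewrite !mulr_ge0 ?nc_ge0 ?(ltW r0).
    by rewrite ler_wpM2l ?half// mulr_ge0 ?(ltW r0).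
  by rewrite le_eqVlt; apply/orP; left; apply/eqP; field; rewrite gt_eqF.
set m := mean r _ in B *.
have -> : 16 * (nc (w - z) / r) * m = nc (w - z) * (2 * (2 * (4 / r * m))) by ring.
by rewrite ler_wpM2l ?nc_ge0// ler_wpM2l.
Qed.

End Logarithm.

(** * Counting functions and Jensen's formula *)

Section Poles.
Variable R : realType.
Local Notation C := R[i].
Implicit Types (f g h G : C -> C) (w z a : C) (r rho : R) (s : seq C).

Lemma near_punctured z (P : C -> Prop) : (\forall w \near z^', P w) <->
  exists2 e : R, 0 < e & forall w, nc (w - z) < e -> w != z -> P w.
Proof.
split; first by move=> /nbhs_nc[e e0 eP]; exists e.
by move=> [e e0 eP]; apply/nbhs_nc; exists e.
Qed.

Lemma holomorphic_atP g z : holomorphic_at g z <->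
  exists2 e : R, 0 < e & forall w, nc (w - z) < e -> derivable g w 1.
Proof. exact: nbhs_nc. Qed.

Lemma ent_holomorphic g z : ent g -> holomorphic_at g z.
Proof. by move=> eg; apply/holomorphic_atP; exists 1. Qed.

Lemma holomorphic_derivable g z : holomorphic_at g z -> derivable g z 1.
Proof. by move=> /holomorphic_atP[e e0 H]; apply: H; rewrite subrr nc0. Qed.

Lemma holomorphic_cont g z : holomorphic_at g z -> {for z, continuous g}.
Proof. by move=> /holomorphic_derivable/derivable_contC. Qed.

Lemma punctured_zero (D : C -> C) z (e : R) : 0 < e -> {for z, continuous D} ->
  (forall w, nc (w - z) < e -> w != z -> D w = 0) -> D z = 0.
Proof.
move=> e0 /contCP cD H; apply/eqP; rewrite -nc_eq0; apply: contraT => Dz.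
have Dz0 : 0 < nc (D z) by rewrite lt_neqAle eq_sym Dz nc_ge0.
have [d d0 dP] := cD _ Dz0.
pose k := Num.min d e / 2.
have m0 : 0 < Num.min d e by rewrite lt_min d0.
have k0 : 0 < k by rewrite divr_gt0.
have km : k < Num.min d e by rewrite /k ltr_pdivrMr// ltr_pMr// ltr1n.
pose w := z + (k%:C)%C.
have wz : nc (w - z) = k by rewrite /w addrC addKr nc_pos// ltW.
have wnz : w != z by rewrite -subr_eq0 -nc_gt0 wz.
move: km; rewrite lt_min => /andP[kd ke].
have := dP w; rewrite wz => /(_ kd).
by rewrite H ?wz// sub0r ncN ltxx.
Qed.

Lemma order_le z (n k : nat) h1 h2 : {for z, continuous h1} ->
  {for z, continuous h2} -> h2 z != 0 ->
  (\forall w \near z^', h1 w / (w - z) ^+ n = h2 w / (w - z) ^+ k) -> (k <= n)%N.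
Proof.
move=> c1 c2 h2z /near_punctured[e e0 H]; rewrite leqNgt; apply/negP => nk.
pose D w := h2 w - h1 w * (w - z) ^+ (k - n).
have cD : {for z, continuous D}.
  apply: contC_B; first exact: c2.
  apply: contC_M; first exact: c1.
  apply: contC_X; apply: contC_B; [exact: contC_id|exact: contC_cst].
have := @punctured_zero D z e e0 cD; rewrite /D subrr expr0n subn_eq0 leqNgt nk /=.
rewrite mulr0 subr0 => D0; move/eqP: h2z; apply; apply: D0 => w we wz.
have wz0 : w - z != 0 by rewrite subr_eq0.
apply/eqP; rewrite subr_eq0; apply/eqP.
apply: (mulIf (x := ((w - z) ^+ k)^-1)); first by rewrite invr_eq0 expf_neq0.
rewrite -(H w we wz) -mulrA; congr (_ * _).
by rewrite -{2}(subnK (ltnW nk)) exprD invfM mulrA divff ?mul1r// expf_neq0.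
Qed.

Lemma pole_mult_eq G z k h : holomorphic_at h z -> h z != 0 ->
  (\forall w \near z^', G w = h w / (w - z) ^+ k) -> pole_mult G z = k.
Proof.
move=> hh hz GE; rewrite /pole_mult.
have ch := holomorphic_cont hh.
case: xgetP => [n _ [n0 [h' [hh' h'z GE']]]|H].
  have ch' := holomorphic_cont hh'.
  apply/eqP; rewrite eqn_leq; apply/andP; split.
    apply: (order_le ch ch' h'z).
    by near=> w; rewrite -(near GE w)// -(near GE' w).
  apply: (order_le ch' ch hz).
  by near=> w; rewrite -(near GE w)// -(near GE' w).
(* For [k = 0] no order qualifies and the default 0 is the right value; for [k > 0] the order [k]
   itself qualifies. *)
case: k GE => // k GE; exfalso; apply: (H k.+1); split => //.
by exists h; split.
Unshelve. all: by end_near. Qed.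

Lemma pole_mult_holomorphic G z : holomorphic_at G z -> pole_mult G z = 0%N.
Proof.
move=> hG; rewrite /pole_mult; case: xgetP => // n _ [n0 [h [hh hz GE]]].
suff : (n <= 0)%N by rewrite leqNgt n0.
apply: (order_le (holomorphic_cont hG) (holomorphic_cont hh) hz).
by near=> w; rewrite expr0 divr1 (near GE w).
Unshelve. all: by end_near. Qed.

Lemma holomorphic_inv g z : ent g -> g z != 0 -> holomorphic_at (fun w => (g w)^-1) z.
Proof.
move=> eg gz; have gz0 : 0 < nc (g z) by rewrite nc_gt0.
have [d d0 dP] := (contCP _ _).1 (ent_cont (z := z) eg) _ gz0.
apply/holomorphic_atP; exists d => //.
move=> w wd; have gw : g w != 0.
  apply/eqP => gw; have := dP w wd.
  by rewrite gw sub0r ncN ltxx.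
by have [] := is_deriveCV gw (derivable_is_derive (eg w)).
Qed.

Lemma prod_count s z w : \prod_(a <- s) (w - a) =
  (w - z) ^+ count_mem z s * \prod_(a <- [seq a <- s | a != z]) (w - a).
Proof.
elim: s => [|b s IH]; first by rewrite !big_nil mulr1.
rewrite big_cons IH /=; case: eqVneq => [->|bz] /=.
  by rewrite add1n exprS mulrA.
by rewrite big_cons add0n; ring.
Qed.

Lemma pole_mult_inv f g s z : ent g -> g z != 0 ->
  (forall w, f w = \prod_(a <- s) (w - a) * g w) ->
  pole_mult (fun w => (f w)^-1) z = count_mem z s.
Proof.
move=> eg gz fg.
pose h w := \prod_(a <- [seq a <- s | a != z]) (w - a) * g w.
have eh : ent h by apply: entM; [exact: ent_prod|exact: eg].
have hz : h z != 0.
  rewrite mulf_neq0// prodf_seq_neq0; apply/allP => a.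
  by rewrite mem_filter => /andP[az _]; rewrite /= subr_eq0 eq_sym.
apply: (pole_mult_eq (holomorphic_inv eh hz)); first by rewrite invr_eq0.
by near=> w; rewrite fg (prod_count s z) -mulrA invfM mulrC.
Unshelve. all: by end_near. Qed.

(** A list of poles repeated by multiplicity turns the finitely supported sum into a sum over list
    entries, which can be exchanged with an integral. *)
Lemma nevanlinna_nE G s (t rho : R) :
  (forall z, nc z <= rho -> pole_mult G z = count_mem z s) -> t <= rho ->
  nevanlinna_n t G = \sum_(a <- s) (nc a <= t)%R%:R.
Proof.
move=> Gs trho; rewrite /nevanlinna_n.
set r := [seq a <- undup s | nc a <= t].
rewrite (fsbigE r); last 3 first.
- by rewrite filter_uniq// undup_uniq.
- by move=> z /=; rewrite mem_filter => /andP[].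
- move=> z /= zt; rewrite mem_filter zt /= mem_undup => zs.
  by rewrite Gs ?(le_trans zt)// (count_memPn zs).
have -> : \sum_(i <- r | i \in [set z | nc z <= t]) ((pole_mult G i)%:R : R) =
    \sum_(i <- r) \sum_(a <- s) (a == i)%:R.
  rewrite big_seq_cond [RHS]big_seq; apply: eq_big => [i|i].
    case ir : (i \in r) => //=; move: ir; rewrite mem_filter => /andP[it _].
    by apply/mem_set.
  rewrite mem_filter => /andP[/andP[it _] _].
  by rewrite Gs ?(le_trans it)// -sum1_count natr_sum big_mkcond /=;
    apply: eq_bigr => a _; case: eqP.
rewrite exchange_big /=; rewrite big_seq [RHS]big_seq; apply: eq_bigr => a as_.
have -> : \sum_(j <- r) ((a == j)%:R : R) = (count_mem a r)%:R.
  by rewrite -sum1_count natr_sum [RHS]big_mkcond /=; apply: eq_bigr => j _; rewrite eq_sym; case: eqP.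
by rewrite count_uniq_mem ?filter_uniq ?undup_uniq// mem_filter mem_undup as_ andbT.
Qed.

Lemma nevanlinna_N_ge0 G s r :
  (forall z, nc z <= r -> pole_mult G z = count_mem z s) -> 1 <= r ->
  0 <= nevanlinna_N r G.
Proof.
move=> Gs r1; have E0 := nevanlinna_nE Gs (le_trans ler01 r1).
rewrite /nevanlinna_N E0 addr_ge0//.
  apply: Rintegral_ge0 => t /=; rewrite in_itv /= => /andP[t0 tr].
  rewrite (nevanlinna_nE Gs tr) divr_ge0 ?(ltW t0)// subr_ge0.
  apply: ler_sum => a _; rewrite ler_nat.
  by case: (leP (nc a) 0) => // a0; rewrite (le_trans a0 (ltW t0)).
by rewrite mulr_ge0 ?ln_ge0// sumr_ge0.
Qed.

Lemma integral_invr (c r : R) : 0 < c -> 0 < r ->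
  lebesgue_measure.-integrable `]0, r]
    (EFin \o ((fun t : R => t^-1) \_ `[c, r])) /\
  \int[lebesgue_measure]_(t in `]0, r]) ((fun t : R => t^-1) \_ `[c, r]) t =
    if c <= r then ln r - ln c else 0.
Proof.
move=> c0 r0.
have I0 : `]0, r]%classic `&` `[c, r]%classic = `[c, r]%classic.
  apply/seteqP; split => t /=; rewrite !in_itv /=; first by case.
  by move=> /andP[ct tr]; rewrite (lt_le_trans c0 ct) tr ct.
have cinv : cont_on c r (fun t : R => t^-1).
  move=> t /andP[ct _]; apply: (@cvgV R R _ _ (fun t => t)) => //.
  by rewrite gt_eqF// (lt_le_trans c0).
split.
  rewrite -restrict_EFin; apply/(integrable_mkcond _ _).2 => //.
  rewrite -patch_setI I0; apply/(integrable_mkcond _ _).1 => //.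
  exact: cont_on_integrable.
rewrite -Rintegral_mkcondr I0; case: ifPn => cr.
  apply: (@RI_FTC _ _ _ (@ln R)) => // t /andP[ct _].
  by apply: is_derive1_ln; exact: lt_le_trans ct.
by rewrite set_itv_ge ?Rintegral_set0// bnd_simp.
Qed.

(** Contribution of a single pole to the integrated counting function: the integral of [1 / t] from
    [nc a] to [r], or the term [ln r] for a pole at the origin. *)
Definition jensen_term r a : R :=
  if a == 0 then ln r else if nc a <= r then ln r - ln (nc a) else 0.

Lemma nevanlinna_NE G s r :
  (forall z, nc z <= r -> pole_mult G z = count_mem z s) -> 0 < r ->
  nevanlinna_N r G = \sum_(a <- s) jensen_term r a.
Proof.
move=> Gs r0; rewrite /nevanlinna_N.
pose H a (t : R) : R := if a == 0 then 0 else ((fun t : R => t^-1) \_ `[nc a, r]) t.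
have HI a : lebesgue_measure.-integrable `]0, r] (EFin \o H a) /\
    \int[lebesgue_measure]_(t in `]0, r]) H a t =
    if a == 0 then 0 else if nc a <= r then ln r - ln (nc a) else 0.
  rewrite /H; case: eqP => [_|/eqP a0]; last by apply: integral_invr; rewrite ?nc_gt0.
  split; first exact: integrable0.
  by rewrite Rintegral_cst// mul0r.
have -> : \int[lebesgue_measure]_(t in `]0, r])
    ((nevanlinna_n t G - nevanlinna_n 0 G) / t) =
    \int[lebesgue_measure]_(t in `]0, r]) \sum_(a <- s) H a t.
  apply: eq_Rintegral => t /set_mem /=; rewrite in_itv /= => /andP[t0 tr].
  rewrite (nevanlinna_nE Gs tr) (nevanlinna_nE Gs (ltW r0)) -sumrB mulr_suml.
  apply: eq_bigr => a _; rewrite /H; case: eqP => [->|/eqP a0].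
    by rewrite nc0 lexx (ltW t0) subrr mul0r.
  rewrite patchE; have -> : (nc a <= 0) = false.
    by apply/negbTE; rewrite -ltNge nc_gt0.
  rewrite subr0; case: ifPn => [/set_mem /=|/negP tI].
    by rewrite in_itv /= => /andP[-> _]; rewrite mul1r.
  case: leP => at_; last by rewrite mul0r.
  by exfalso; apply: tI; apply/mem_set; rewrite /= in_itv /= at_.
have -> : \int[lebesgue_measure]_(t in `]0, r]) \sum_(a <- s) H a t =
    \sum_(a <- s) if a == 0 then 0 else if nc a <= r then ln r - ln (nc a) else 0.
  have int_sum s' : lebesgue_measure.-integrable `]0, r] (EFin \o (fun t => \sum_(a <- s') H a t)).
    rewrite (_ : _ \o _ = fun t => (\sum_(a <- s') (H a t)%:E)%E); last first.
      by apply/funext => t /=; rewrite sumEFin.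
    by apply: integrable_sum => // a _; have [] := HI a.
  elim: s {Gs} => [|a s IH].
    under eq_Rintegral do rewrite big_nil.
    by rewrite big_nil Rintegral_cst// mul0r.
  under eq_Rintegral do rewrite big_cons.
  rewrite big_cons RintegralD//; last by have [] := HI a.
  by rewrite IH; congr (_ + _); have [] := HI a.
rewrite (nevanlinna_nE Gs (ltW r0)) mulr_suml -big_split /=.
apply: eq_bigr => a _; rewrite /jensen_term; case: eqP => [->|/eqP a0].
  by rewrite nc0 lexx mul1r add0r.
have -> : (nc a <= 0) = false by apply/negbTE; rewrite -ltNge nc_gt0.
by rewrite mul0r addr0.
Qed.

End Poles.

(** * Jensen's formula *)

Section Jensen.
Variable R : realType.
Local Notation C := R[i].
Implicit Types (f g : C -> C) (w z a : C) (r rho : R) (s : seq C).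

(** [c] is the logarithm of the modulus of the first nonzero Taylor coefficient at the origin. It is
    thus independent of [rho], although [s] and [g] are not, and so is the constant in Jensen's
    formula. *)
Record zeros_upto f rho s g (c : R) : Prop := ZerosUpto {
  zu_ent : ent g;
  zu_le : forall a, a \in s -> nc a <= rho;
  zu_fact : forall z, f z = \prod_(a <- s) (z - a) * g z;
  zu_neq0 : forall z, nc z <= rho -> g z != 0;
  zu_cst : ln (nc (g 0)) + \sum_(a <- s | a != 0) ln (nc a) = c }.

Lemma ent_zeros f : ent f -> (exists z, f z != 0) ->
  exists c, forall rho, 0 < rho -> exists s g, zeros_upto f rho s g c.
Proof.
move=> ef fn0; have [m [f1 [ef1 f10 ff1]]] := ent_order0 ef fn0.
exists (ln (nc (f1 0))) => rho rho0.
have [s [g [eg srho f1g g0]]] := ent_factor ef1 f10 rho0.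
exists (nseq m 0 ++ s), g; split => //.
- move=> a; rewrite mem_cat => /orP[|/srho/andP[]//].
  by rewrite mem_nseq => /andP[_ /eqP ->]; rewrite nc0 ltW.
- move=> z; rewrite ff1 f1g big_cat /= mulrA; congr (_ * _ * _).
  by rewrite big_nseq subr0 iter_mulr_1.
- rewrite f1g ncM lnM ?posrE ?nc_gt0 ?g0 ?nc0 ?(ltW rho0)//; last first.
    rewrite prodf_seq_neq0; apply/allP => a /srho/andP[a0 _] /=.
    by rewrite sub0r oppr_eq0 -nc_gt0.
  rewrite addrC; congr (_ + _); rewrite big_cat /= big_nseq_cond eqxx /= add0r.
  elim: s srho {f1g} => [|a s IH] srho; first by rewrite !big_nil nc1 ln1.
  have /andP[a0 _] := srho a (mem_head _ _).
  rewrite !big_cons -nc_gt0 a0 IH; last by move=> b bs; apply: srho; rewrite inE bs orbT.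
  rewrite sub0r ncM ncN lnM ?posrE// nc_gt0 prodf_seq_neq0.
  apply/allP => b bs /=; rewrite sub0r oppr_eq0 -nc_gt0.
  have /srho/andP[] : b \in a :: s by rewrite inE bs orbT.
  by [].
Qed.

Lemma zeros_pole_mult f rho s g c z : zeros_upto f rho s g c -> nc z <= rho ->
  pole_mult (fun w => (f w)^-1) z = count_mem z s.
Proof. by move=> zu zr; apply: pole_mult_inv (zu_ent zu) (zu_neq0 zu zr) (zu_fact zu). Qed.

Lemma zeros_offcircle f rho s g c r : zeros_upto f rho s g c ->
  (forall z, nc z = r -> f z != 0) -> forall a, a \in s -> nc a != r.
Proof.
move=> zu fr a as_; apply/eqP => /fr; rewrite (zu_fact zu) (big_rem a)//=.
by rewrite subrr !mul0r eqxx.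
Qed.

Lemma cont_ln_prod s r : (forall a, a \in s -> nc a != r) ->
  cont_circ r (fun z : C => \sum_(a <- s) ln (nc (z - a))).
Proof.
move=> sr z zr; elim: s sr => [|a s IH] sr.
  rewrite (_ : (fun _ => _) = fun _ => 0); first exact: contR_cst.
  by apply/funext => w; rewrite big_nil.
rewrite (_ : (fun _ => _) = fun w => ln (nc (w - a)) + \sum_(b <- s) ln (nc (w - b))); last first.
  by apply/funext => w; rewrite big_cons.
apply: contR_D; last by apply: IH => b bs; apply: sr; rewrite inE bs orbT.
apply: cont_ln_nc; last by apply: contC_B; [exact: contC_id|exact: contC_cst].
have ar := sr a (mem_head _ _); rewrite subr_eq0; apply/eqP => za.
by move: ar; rewrite -za zr eqxx.
Qed.

Lemma mean_ln_prod s r : 0 < r -> (forall a, a \in s -> nc a != r) ->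
  mean r (fun z : C => \sum_(a <- s) ln (nc (z - a))) =
  \sum_(a <- s) ln (Num.max r (nc a)).
Proof.
move=> r0; elim: s => [|a s IH] sr.
  rewrite big_nil (eq_mean (ltW r0) (h := fun _ => 0)) ?mean_cst// => z _.
  by rewrite big_nil.
have sr' b : b \in s -> nc b != r by move=> bs; apply: sr; rewrite inE bs orbT.
have ar := sr a (mem_head _ _).
rewrite (eq_mean (ltW r0) (h := fun z => ln (nc (z - a)) + \sum_(b <- s) ln (nc (z - b)))); last first.
  by move=> z _; rewrite big_cons.
rewrite (meanD (ltW r0)); last 2 first.
- have := @cont_ln_prod [:: a] r; rewrite (_ : (fun _ => _) = fun w => ln (nc (w - a))).
    by apply=> b; rewrite inE => /eqP ->.
  by apply/funext => w; rewrite big_seq1.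
- exact: cont_ln_prod.
by rewrite big_cons (mean_ln_sub r0 ar) IH.
Qed.

Lemma ln_nc_prod s z : (forall a, a \in s -> z != a) ->
  ln (nc (\prod_(a <- s) (z - a))) = \sum_(a <- s) ln (nc (z - a)).
Proof.
elim: s => [|a s IH] sz; first by rewrite !big_nil nc1 ln1.
have sz' b : b \in s -> z != b by move=> bs; apply: sz; rewrite inE bs orbT.
rewrite !big_cons ncM lnM ?IH// posrE nc_gt0.
  by rewrite subr_eq0 sz// mem_head.
by rewrite prodf_seq_neq0; apply/allP => b /sz' zb /=; rewrite subr_eq0.
Qed.

(** Zeros are listed up to [2 * r], so that the cofactor is zero-free on a neighbourhood of the
    closed disc. A zero [a != 0] contributes [ln (max r |a|)], which is its [jensen_term] plus
    [ln |a|]; the terms [ln |a|] go into the constant. *)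
Theorem jensen f : ent f -> (exists z, f z != 0) -> exists c, forall r, 0 < r ->
  (forall z, nc z = r -> f z != 0) ->
  mean r (fun z => ln (nc (f z))) = nevanlinna_N r (fun z => (f z)^-1) + c.
Proof.
move=> ef fn0; have [c H] := ent_zeros ef fn0; exists c => r r0 fr.
have r20 : 0 < 2 * r by rewrite mulr_gt0.
have rr2 : r < 2 * r by rewrite ltr_pMl// ltr1n.
have [s [g zu]] := H _ r20.
have sr := zeros_offcircle zu fr.
rewrite (nevanlinna_NE (s := s) _ r0); last first.
  by move=> z zr; apply: (zeros_pole_mult zu); rewrite (le_trans zr)// ltW.
have eg := zu_ent zu.
have gr z : nc z < 2 * r -> g z != 0 by move=> zr; rewrite (zu_neq0 zu)// ltW.
rewrite (eq_mean (ltW r0) (h := fun z => \sum_(a <- s) ln (nc (z - a)) + ln (nc (g z)))); last first.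
  move=> z zr; have := fr z zr; rewrite (zu_fact zu) mulf_eq0 negb_or => /andP[p0 g0].
  rewrite ncM lnM ?posrE ?nc_gt0// ln_nc_prod// => a as_.
  by apply/eqP => za; have := sr a as_; rewrite -za zr eqxx.
rewrite (meanD (ltW r0)); last 2 first.
- exact: cont_ln_prod.
- by move=> z zr; apply: cont_ln_nc; [apply: gr; rewrite zr|exact: ent_cont].
rewrite (mean_ln_prod r0 sr) (mean_ln_zerofree r0 rr2 (ent_holD eg) gr).
rewrite -(zu_cst zu) [ln _ + _]addrC addrA; congr (_ + _).
rewrite [X in _ = _ + X]big_mkcond -big_split /=; apply: eq_big_seq => a as_.
have ar := sr a as_; rewrite /jensen_term; case: eqP => [->|/eqP a0] /=.
  by rewrite nc0 addr0 max_l// ltW.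
by case: (ltP r (nc a)) => ra; rewrite ?add0r ?subrK//.
Qed.

(** Each zero of modulus at most [rho] contributes at least [ln rho' - ln rho] to [N]; for a zero at
    the origin this uses [1 <= rho]. Smallness of [N] thus bounds the number of zeros. *)
Lemma zeros_count_le f rho rho' s s' g g' c c' : 1 <= rho -> rho <= rho' ->
  zeros_upto f rho s g c -> zeros_upto f rho' s' g' c' ->
  (size s)%:R * (ln rho' - ln rho) <= nevanlinna_N rho' (fun z => (f z)^-1).
Proof.
move=> rho1 rr zu zu'.
have rho0 : 0 < rho := lt_le_trans ltr01 rho1.
have rho'0 : 0 < rho' := lt_le_trans rho0 rr.
have P1 z : nc z <= rho -> _ := zeros_pole_mult zu (z := z).
have P2 z : nc z <= rho' -> _ := zeros_pole_mult zu' (z := z).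
have -> : (size s)%:R = \sum_(a <- s') ((nc a <= rho)%R%:R : R).
  rewrite -(nevanlinna_nE P2 rr) (nevanlinna_nE P1 (lexx _)).
  rewrite -sum1_size natr_sum big_seq [RHS]big_seq; apply: eq_bigr => a as_.
  by rewrite (zu_le zu).
rewrite (nevanlinna_NE P2 rho'0) mulr_suml big_seq [leRHS]big_seq.
apply: ler_sum => a as_; have ar' := zu_le zu' as_.
have l0 : 0 <= ln rho by exact: ln_ge0.
have l1 : ln rho <= ln rho' by rewrite ler_ln.
rewrite /jensen_term ar'; case: eqP => [->|/eqP a0].
  by rewrite nc0 (ltW rho0) mul1r lerBlDr lerDl.
have na0 : 0 < nc a by rewrite nc_gt0.
case: (leP (nc a) rho) => ar; rewrite ?mul1r ?mul0r.
  by rewrite lerB// ler_ln.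
by rewrite subr_ge0 ler_ln.
Qed.

End Jensen.

(** * Isolated points and exceptional radii *)

Section Isolated.
Variable R : realType.
Local Notation C := R[i].
Implicit Types (f g h G : C -> C) (w z a : C) (r rho : R) (P : C -> Prop).

Definition isolated P := forall z, exists2 e : R, 0 < e &
  forall w, nc (w - z) < e -> w != z -> ~ P w.

Lemma meromorphic_isolated G : meromorphic G ->
  isolated (fun z => ~ holomorphic_at G z).
Proof.
move=> mG z; suff [e e0 H] : exists2 e : R, 0 < e &
    forall w, nc (w - z) < e -> w != z -> derivable G w 1.
  exists e => // w we wz; apply; apply/holomorphic_atP.
  exists (Num.min (e - nc (w - z)) (nc (w - z))).
    by rewrite lt_min subr_gt0 we nc_gt0 subr_eq0.
  move=> v; rewrite lt_min => /andP[v1 v2]; apply: H.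
    by rewrite (le_lt_trans (nc_dist_tri w _ _))// -ltrBrDr.
  by apply/eqP => vz; move: v2; rewrite vz ncB ltxx.
have [/holomorphic_atP[e e0 H]|[n [n0 [h [/holomorphic_atP[e1 e10 H1] hz]]]]] := mG z.
  by exists e => // w we _; exact: H.
move=> /near_punctured[e2 e20 H2].
exists (Num.min e1 e2); first by rewrite lt_min e10.
move=> w; rewrite lt_min => /andP[w1 w2] wz.
have wz0 : w - z != 0 by rewrite subr_eq0.
have dd : is_derive w 1 (fun v => v - z) (1 - 0).
  exact: is_deriveCB (is_deriveC_id w) (is_deriveC_cst z w).
have [d hd] : exists d : C, is_derive w 1 (fun v => (v - z) ^+ n) d.
  exists (derive1 (fun v => (v - z) ^+ n) w); apply: derivable_is_derive.
  by apply: entX; exact: ent_subC.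
have pn0 : (w - z) ^+ n != 0 by rewrite expf_neq0.
have dG := is_deriveCM (derivable_is_derive (H1 w w1))
  (is_deriveCV (f := fun v => (v - z) ^+ n) pn0 hd).
pose e := Num.min (e2 - nc (w - z)) (nc (w - z)).
have e0 : 0 < e by rewrite lt_min subr_gt0 w2 nc_gt0.
suff [] : is_derive w 1 G (h w * (- d / ((w - z) ^+ n) ^+ 2) +
    ((w - z) ^+ n)^-1 * derive1 h w) by [].
apply: is_deriveC_near e0 _ dG.
move=> v; rewrite lt_min => /andP[v1 v2]; rewrite -H2//.
  by rewrite (le_lt_trans (nc_dist_tri w _ _))// -ltrBrDr.
by apply/eqP => vz; move: v2; rewrite vz ncB ltxx.
Qed.

Lemma zeros_isolated f : ent f -> (exists z, f z != 0) -> isolated (fun z => f z = 0).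
Proof.
move=> ef fn0 z; have [m [g [eg gz fg]]] := ent_order z ef fn0.
have gz0 : 0 < nc (g z) by rewrite nc_gt0.
have [d d0 dP] := (contCP _ _).1 (ent_cont (z := z) eg) _ gz0.
exists d => // w wd wz; rewrite fg => /eqP; rewrite mulf_eq0 expf_eq0 subr_eq0 (negbTE wz).
rewrite andbF /= => /eqP gw; have := dP w wd.
by rewrite gw sub0r ncN ltxx.
Qed.

(** The disc lies in a compact square, the continuous image of a product of segments. Each disc of
    the cover contains at most its centre from [P], so the centres of a finite subcover contain the
    whole set. *)
Lemma isolated_finite P rho : isolated P -> finite_set [set z | nc z <= rho /\ P z].
Proof.
move=> iP.
pose K : set (R * R) := `[- rho, rho]%classic `*` `[- rho, rho]%classic.
have cK : compact K by apply: compact_setX; exact: segment_compact.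
pose toC (p : R * R) : C := (p.1%:C)%C + 'i%C * (p.2%:C)%C.
have toCE z : toC (complex.Re z, complex.Im z) = z by rewrite /toC -complexE.
have ctoC p : {for p, continuous toC}.
  apply: contC_D.
    exact: (@continuous_comp _ _ _ fst _ _ cvg_fst (@realC_continuous R p.1)).
  apply: contC_M; first exact: contC_cst.
  exact: (@continuous_comp _ _ _ snd _ _ cvg_snd (@realC_continuous R p.2)).
have cKC : compact (toC @` K).
  by apply: continuous_compact => //; apply: continuous_subspaceT => p; exact: ctoC.
pose ep z : R := sval (cid2 (iP z)).
have ep0 z : 0 < ep z by rewrite /ep; case: cid2.
have epP z w : nc (w - z) < ep z -> w != z -> ~ P w.
  by rewrite /ep; case: cid2 => /= x _ H; exact: H.
pose U z : set C := [set w | nc (w - z) < ep z].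
have oU z : open (U z).
  rewrite openE => w wU; apply/nbhs_nc; exists (ep z - nc (w - z)).
    by rewrite subr_gt0.
  by move=> v vw; rewrite /U /= (le_lt_trans (nc_dist_tri w _ _))// -ltrBrDr.
have cov : cover_compact (toC @` K) by rewrite -compact_cover.
have [|z Kz|D' _ KD'] := cov C (toC @` K) U; first by move=> z _; exact: oU.
  by exists z => //; rewrite /U /= subrr nc0.
apply: sub_finite_set (finite_fset D').
move=> z [zr Pz].
have Kz : (toC @` K) z.
  exists (complex.Re z, complex.Im z) => //.
  by split; rewrite /= in_itv /= -ler_norml (le_trans _ zr) ?Re_le_nc ?Im_le_nc.
have [p pD' zp] := KD' _ Kz.
have [<-//|znp] := eqVneq p z; exfalso.
by apply: (epP p z zp) Pz; rewrite eq_sym.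
Qed.

(** Circles through zeros or poles thus have radii in a null set, and the integrals below are taken
    over other circles, where all integrands are continuous. *)
Lemma isolated_radii P : isolated P -> countable [set r | exists2 z, nc z = r & P z].
Proof.
move=> iP; apply: (@sub_countable _ _ _ (\bigcup_(n in [set: nat])
   [set nc z | z in [set z : C | nc z <= n%:R /\ P z]])).
  apply: subset_card_le => r [z zr Pz].
  exists (Num.truncn (nc z)).+1 => //; exists z => //; split => //.
  by rewrite ltW// truncnS_gt.
apply: bigcup_countable => // n _; apply: finite_set_countable.
exact/finite_image/isolated_finite.
Qed.

Lemma count_flatten_nseq (F : C -> nat) (l : seq C) z : uniq l ->
  count_mem z (flatten [seq nseq (F y) y | y <- l]) = ((z \in l) * F z)%N.
Proof.
elim: l => [|y l IH] //= /andP[yl ul]; rewrite count_cat IH// count_nseq /= inE eq_sym.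
by case: eqVneq => [->|_] //=; rewrite (negbTE yl) mul0n addn0.
Qed.

Lemma meromorphic_poles G rho : meromorphic G ->
  exists s : seq C, forall z, nc z <= rho -> pole_mult G z = count_mem z s.
Proof.
move=> /meromorphic_isolated/(isolated_finite rho)/finite_seqP[l lE].
exists (flatten [seq nseq (pole_mult G y) y | y <- undup l]) => z zr.
rewrite count_flatten_nseq ?undup_uniq// mem_undup.
case zl : (z \in l); first by rewrite mul1n.
rewrite mul0n pole_mult_holomorphic//; apply: contrapT => Gz.
have : [set` l] z by rewrite -lE.
by rewrite /= zl.
Qed.

End Isolated.

(** * Invariance of circle means under rotation *)

Section Rotation.
Variable R : realType.
Local Notation C := R[i].

Lemma is_derive_addl (G : R -> R) (x t d : R) : is_derive (x + t) 1 G d ->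
  is_derive t 1 (fun s => G (x + s)) d.
Proof.
move=> /is_deriveRP H; apply/is_deriveRP => e e0.
have [d' d'0 dP] := H _ e0; exists d' => // h hd.
by rewrite addrA; exact: dP.
Qed.

Lemma RI_periodic (phi : R -> R) (p x : R) : continuous phi ->
  (forall t, phi (p + t) = phi t) -> 0 <= p -> 0 <= x ->
  RI 0 p (fun t => phi (x + t)) = RI 0 p phi.
Proof.
move=> cphi per p0 x0.
(* The base point [-1] makes the primitive differentiable from both sides on the whole half-line
   from 0. *)
pose G y := RI (-1) y phi.
have dG (y : R) : 0 <= y -> is_derive y 1 G (phi y).
  move=> y0; have y1 : y < y + 1 by rewrite ltrDl.
  have [||Gd Gv] := @continuous_FTC1_closed R phi (-1) y (y + 1) y1 _ _ (cphi y).
  - by apply: cont_on_integrable => t _; exact: cphi.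
  - by rewrite (lt_le_trans _ y0)// oppr_lt0.
  by split; [exact: Gd|rewrite -derive1E; exact: Gv].
have FT a b z : 0 <= a -> a <= b -> 0 <= z ->
    RI a b (fun t => phi (z + t)) = G (z + b) - G (z + a).
  move=> a0 ab z0; apply: (@RI_FTC _ _ _ (fun t => G (z + t))) => //.
    move=> t _; apply: (@continuous_comp _ _ _ (fun t => z + t) phi); last exact: cphi.
    by apply: contR_D; [exact: contR_cst|].
  by move=> t /andP[at_ _]; apply: is_derive_addl; apply: dG; rewrite addr_ge0// (le_trans a0).
have F0 a b : 0 <= a -> a <= b -> RI a b phi = G b - G a.
  move=> a0 ab; have := FT a b 0 a0 ab (lexx _); rewrite !add0r => <-.
  by apply: eq_RI => t _; rewrite add0r.
rewrite FT// F0// addr0.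
have : RI 0 x (fun t => phi (p + t)) = RI 0 x phi by apply: eq_RI => t _; rewrite per.
rewrite FT// F0// addr0 => E; rewrite [x + p]addrC.
have -> : G (p + x) = G p + (G x - G 0) by rewrite -E; ring.
by ring.
Qed.

Lemma mean_rotation r (x : R) (g : C -> R) : 0 <= r -> 0 <= x -> cont_circ r g ->
  mean r (fun z => g (expC (x *i)%C * z)) = mean r g.
Proof.
move=> r0 x0 cg; congr (_ * _).
rewrite -(@RI_periodic (fun t => g (circ r t)) (2 * pi) x).
- by apply: eq_RI => t _; rewrite circD.
- move=> t; apply: (continuous_comp (@circ_continuous R r t)); apply: cg.
  by rewrite nc_circ.
- by move=> t; rewrite circD /expC /= expR0 mul1r mulr_natl cos2pi sin2pi mul1r.
- exact/ltW/twopi_gt0.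
- exact: x0.
Qed.

(** The mean value property, so that a factor [exp(c z)] costs nothing in the mean of a
    logarithm. *)
Lemma mean_Re_linear r (c : C) : 0 < r -> mean r (fun z => complex.Re (c * z)) = 0.
Proof.
move=> r0; have rr : r < r + 1 by rewrite ltrDl.
by rewrite -Re_cmean (cmean_center r0 rr (ent_holD (@ent_scale R c))) mulr0.
Qed.

End Rotation.

(** * Growth estimates *)

Section LogPlus.
Variable R : realType.
Local Notation C := R[i].
Implicit Types (x y r : R).

Lemma lnpE x : lnp x = ln (Num.max 1 x).
Proof.
rewrite /lnp; case: (leP 1 x) => x1; first by rewrite max_r// ln_ge0.
rewrite ln1; apply/max_idPl; have [x0|x0] := leP x 0; first by rewrite ln0.
by rewrite -ln1 ler_ln ?posrE// ltW.
Qed.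

Lemma lnp_ge0 x : 0 <= lnp x. Proof. by rewrite /lnp le_max lexx. Qed.

Lemma ln_le_lnp x : ln x <= lnp x. Proof. by rewrite /lnp le_max lexx orbT. Qed.

Lemma le_exp_lnp x : x <= expR (lnp x).
Proof.
have [x0|x0] := leP x 0; first by rewrite (le_trans x0)// expR_ge0.
by rewrite -{1}(lnK x0) ler_expR ln_le_lnp.
Qed.

Lemma lnp_le x y : 0 <= y -> x <= expR y -> lnp x <= y.
Proof.
move=> y0 xy; rewrite /lnp ge_max y0 /=.
have [x0|x0] := leP x 0; first by rewrite ln0.
by rewrite -(expRK y) ler_ln ?posrE ?expR_gt0.
Qed.

Lemma norm_ln x : `|ln x| = 2 * lnp x - ln x.
Proof.
rewrite /lnp; case: (leP 0 (ln x)) => l0; first by rewrite ger0_norm//; ring.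
by rewrite ltr0_norm//; ring.
Qed.

Lemma lnp_continuous : continuous (@lnp R).
Proof.
move=> x; have -> : @lnp R = fun y => ln (Num.max 1 y) by apply/funext => y; exact: lnpE.
apply: contR_ln; first by rewrite lt_max ltr01.
apply/cvgrPdist_lt => e e0; near=> y.
apply: (@le_lt_trans _ _ `|x - y|); last first.
  by near: y; apply/nbhs_normP; exists e.
rewrite /Num.max; case: (ltP 1 x) => x1; case: (ltP 1 y) => y1 //.
- rewrite !gtr0_norm ?subr_gt0 ?(le_lt_trans y1)//.
  by rewrite lerD2l lerN2.
- by rewrite !ltr0_norm ?subr_lt0 ?(le_lt_trans x1)// lerN2 lerD2r.
- by rewrite subrr normr0.
Unshelve. all: by end_near. Qed.

Lemma cont_lnp_nc (F : C -> C) z : {for z, continuous F} ->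
  {for z, continuous (fun v => lnp (nc (F v)))}.
Proof.
move=> cF; apply: (@continuous_comp _ _ _ (fun v => nc (F v)) (@lnp R)).
  exact: contC_nc.
exact: lnp_continuous.
Qed.

Lemma nevanlinna_T_ent r (f : C -> C) : ent f -> 0 < r ->
  nevanlinna_T r f = mean r (fun z => lnp (nc (f z))).
Proof.
move=> ef r0; rewrite /nevanlinna_T (nevanlinna_NE (s := [::]) _ r0); last first.
  by move=> z _; rewrite pole_mult_holomorphic//; exact: ent_holomorphic.
by rewrite big_nil addr0.
Qed.

Lemma nevanlinna_T_ent_ge0 r (f : C -> C) : ent f -> 0 < r -> 0 <= nevanlinna_T r f.
Proof.
move=> ef r0; rewrite nevanlinna_T_ent//; apply: mean_ge0; first exact: ltW.
by move=> z _; exact: lnp_ge0.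
Qed.

(** The proximity part is what enters estimates on a circle; the counting part is nonnegative once
    [ln r] is. *)
Lemma m_le_T r (G : C -> C) : meromorphic G -> 1 <= r ->
  mean r (fun z => lnp (nc (G z))) <= nevanlinna_T r G.
Proof.
move=> mG r1; have [s Gs] := meromorphic_poles r mG.
rewrite /nevanlinna_T; have := nevanlinna_N_ge0 Gs r1 => N0.
by rewrite -[leLHS]addr0 lerD2l.
Qed.

Lemma N_inv_ge0 r (f : C -> C) : ent f -> (exists z, f z != 0) -> 1 <= r ->
  0 <= nevanlinna_N r (fun z => (f z)^-1).
Proof.
move=> ef fn0 r1; have [c H] := ent_zeros ef fn0.
have [s [g zu]] := H r (lt_le_trans ltr01 r1).
by apply: (@nevanlinna_N_ge0 R _ s) => // z zr; exact: zeros_pole_mult zu zr.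
Qed.

End LogPlus.

(** * Ratios of values and logarithmic derivatives *)

Section Ratio.
Variable R : realType.
Local Notation C := R[i].
Implicit Types (f g : C -> C) (w z a : C) (r rho : R) (s : seq C).

(** Its exponential is the product of the [3 * rho / |z - a|]. Since [|w - a| <= 3 * rho] for the
    points and zeros considered, it bounds the ratio of [\prod (w - a)] to [\prod (z - a)]. *)
Definition zero_weight rho s z : R := \sum_(a <- s) (ln (3 * rho) - ln (nc (z - a))).

Lemma cont_zero_weight rho s r : (forall a, a \in s -> nc a != r) ->
  cont_circ r (zero_weight rho s).
Proof.
move=> sr z zr; rewrite /zero_weight.
rewrite (_ : (fun _ => _) = fun z => \sum_(a <- s) ln (3 * rho) - \sum_(a <- s) ln (nc (z - a))).
  by apply: contR_B; [exact: contR_cst|exact: (cont_ln_prod sr zr)].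
by apply/funext => w; rewrite sumrB.
Qed.

Lemma mean_zero_weight rho s r : 0 < r -> 0 < rho ->
  (forall a, a \in s -> nc a != r) ->
  mean r (zero_weight rho s) <= (size s)%:R * (ln (3 * rho) - ln r).
Proof.
move=> r0 rho0 sr.
rewrite (eq_mean (ltW r0) (h := fun z => \sum_(a <- s) ln (3 * rho) - \sum_(a <- s) ln (nc (z - a)))); last first.
  by move=> z _; rewrite /zero_weight sumrB.
rewrite (meanB (ltW r0)); last 2 first.
- by move=> z _; exact: contR_cst.
- exact: cont_ln_prod.
rewrite mean_cst (mean_ln_prod r0 sr) -sumrB -sum1_size natr_sum mulr_suml.
apply: ler_sum => a _; rewrite mul1r lerB// ler_ln ?posrE ?lt_max ?r0//.
by rewrite le_max lexx.
Qed.

Lemma zero_weight_ge0 rho s z : 0 < rho -> nc z <= rho ->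
  (forall a, a \in s -> nc a <= 2 * rho) -> (forall a, a \in s -> z != a) ->
  0 <= zero_weight rho s z.
Proof.
move=> rho0 zr sr sz; rewrite /zero_weight big_seq; apply: sumr_ge0 => a as_.
rewrite subr_ge0 ler_ln ?posrE ?mulr_gt0 ?nc_gt0 ?subr_eq0 ?sz//.
by rewrite (le_trans (nc_sub_le _ _))// (_ : 3 * rho = rho + 2 * rho) ?lerD ?sr//; ring.
Qed.

(** A quantity [x <= ln 3] satisfies [|x| <= 2 * ln 3 - x], and the mean of [x] is here nonnegative
    by [mean_ln_sub]. *)
Lemma mean_abs_ln_sub rho a : 0 < rho -> nc a <= 2 * rho -> nc a != rho ->
  mean rho (fun z => `|ln (nc (z - a)) - ln rho|) <= 2 * ln 3.
Proof.
move=> rho0 ar ar'.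
have ca : cont_circ rho (fun z => ln (nc (z - a))).
  have := @cont_ln_prod R [:: a] rho; rewrite (_ : (fun _ => _) = fun w => ln (nc (w - a))).
    by apply=> b; rewrite inE => /eqP ->.
  by apply/funext => w; rewrite big_seq1.
have cb : cont_circ rho (fun z => ln (nc (z - a)) - ln rho).
  by move=> z zr; apply: contR_B; [exact: ca|exact: contR_cst].
apply: (@le_trans _ _ (mean rho (fun z => 2 * ln 3 - (ln (nc (z - a)) - ln rho)))).
  apply: (mean_le (ltW rho0)).
  - by move=> z zr; apply: contR_norm; exact: cb.
  - by move=> z zr; apply: contR_B; [exact: contR_cst|exact: cb].
  move=> z zr; have za : 0 < nc (z - a).
    by rewrite nc_gt0 subr_eq0; apply/eqP => za; move: ar'; rewrite -za zr eqxx.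
  have l3 : ln (nc (z - a)) - ln rho <= ln 3.
    rewrite lerBlDr -lnM ?posrE// ler_ln ?posrE ?mulr_gt0//.
    by rewrite (le_trans (nc_sub_le _ _))// zr (_ : 3 * rho = rho + 2 * rho) ?lerD2l//; ring.
  have l30 : 0 <= ln 3 :> R by rewrite ln_ge0// ler1n.
  set x := _ - ln rho in l3 *; clearbody x.
  by rewrite ler_norml; apply/andP; split; lra.
rewrite (meanB (ltW rho0)); last 2 first.
- by move=> z _; exact: contR_cst.
- exact: cb.
rewrite mean_cst (meanB (ltW rho0) ca); last by move=> z _; exact: contR_cst.
rewrite mean_cst (mean_ln_sub rho0 ar') gerBl subr_ge0 ler_ln ?posrE ?lt_max ?rho0//.
by rewrite le_max lexx.
Qed.

(** Since [|ln t| = 2 ln+ t - ln t], the first term gives the characteristic and Jensen's formula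
    bounds the mean of the second from below. *)
Lemma mean_abs_ln_le f rho (c : R) : ent f -> (exists z, f z != 0) -> 1 <= rho ->
  (forall z, nc z = rho -> f z != 0) ->
  mean rho (fun z => ln (nc (f z))) = nevanlinna_N rho (fun z => (f z)^-1) + c ->
  mean rho (fun z => `|ln (nc (f z))|) <= 2 * nevanlinna_T rho f + `|c|.
Proof.
move=> ef fn0 rho1 fr Jc; have rho0 : 0 < rho := lt_le_trans ltr01 rho1.
rewrite (eq_mean (ltW rho0) (h := fun z => 2 * lnp (nc (f z)) - ln (nc (f z)))); last first.
  by move=> z _; exact: norm_ln.
have c1 : cont_circ rho (fun z => lnp (nc (f z))).
  by move=> z _; apply: cont_lnp_nc; exact: ent_cont.
have c2 : cont_circ rho (fun z => ln (nc (f z))).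
  by move=> z zr; apply: cont_ln_nc; [exact: fr|exact: ent_cont].
rewrite (meanB (ltW rho0) _ c2); last first.
  by move=> z zr; apply: contR_M; [exact: contR_cst|exact: c1].
rewrite (meanZ (ltW rho0) _ c1) Jc (nevanlinna_T_ent ef rho0) lerD2l.
rewrite opprD -[leRHS]add0r lerD ?oppr_le0 ?N_inv_ge0//.
by rewrite -normrN ler_norm.
Qed.

(** After division by the zeros up to [2 * rho], the cofactor is zero-free and its logarithm
    oscillates little between nearby points. The product of the linear factors costs [zero_weight],
    large near zeros of [f] but small in mean when zeros are few. *)
Lemma ratio_bound f rho s g (c c' r eps : R) w z :
  ent f -> (exists z, f z != 0) -> 1 <= rho ->
  zeros_upto f (2 * rho) s g c' -> (forall z, nc z = rho -> f z != 0) ->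
  mean rho (fun z => ln (nc (f z))) = nevanlinna_N rho (fun z => (f z)^-1) + c ->
  nc z <= rho / 2 -> nc w <= rho / 2 -> nc (w - z) <= eps * rho -> f z != 0 ->
  nc (f w) <= nc (f z) * expR (16 * eps *
    (2 * nevanlinna_T rho f + `|c| + (size s)%:R * (2 * ln 3)) + zero_weight rho s z).
Proof.
move=> ef fn0 rho1 zu fr Jc zr wr wz fz.
have rho0 : 0 < rho := lt_le_trans ltr01 rho1.
have rr2 : rho < 2 * rho by rewrite ltr_pMl// ltr1n.
have eg := zu_ent zu.
have g0 v : nc v < 2 * rho -> g v != 0 by move=> vr; rewrite (zu_neq0 zu)// ltW.
have half : rho / 2 < 2 * rho.
  by apply: lt_trans rr2; rewrite ltr_pdivrMr// ltr_pMr// ltr1n.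
have gz : g z != 0 by apply: g0; exact: le_lt_trans half.
have gw : g w != 0 by apply: g0; exact: le_lt_trans half.
have sr := zeros_offcircle zu fr.
have sle := zu_le zu.
set n := size s.
(* With this shift [ln |g| + k] equals [ln |f|] minus the sum of the [ln |v - a| - ln rho], each of
   mean absolute value at most [2 * ln 3]. *)
pose k := n%:R * ln rho.
have osc := log_oscillation k rho0 rr2 (ent_holD eg) g0 wr zr.
set A := mean rho _ in osc.
have AB : A <= 2 * nevanlinna_T rho f + `|c| + n%:R * (2 * ln 3).
  have csum : cont_circ rho (fun v => \sum_(a <- s) `|ln (nc (v - a)) - ln rho|).
    move=> v vr; rewrite (_ : (fun _ => _) = fun v => \sum_(i < size s) `|ln (nc (v - nth 0 s i)) - ln rho|); last first.
      by apply/funext => u; rewrite (big_nth 0) big_mkord.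
    apply: contR_sum => i; apply: contR_norm; apply: contR_B; last exact: contR_cst.
    have ir : nc (s`_i) != rho by apply: sr; exact: mem_nth.
    apply: cont_ln_nc; last by apply: contC_B; [exact: contC_id|exact: contC_cst].
    by rewrite subr_eq0; apply/eqP => va; move: ir; rewrite -va vr eqxx.
  have cf : cont_circ rho (fun v => `|ln (nc (f v))|).
    by move=> v vr; apply: contR_norm; apply: cont_ln_nc; [exact: fr|exact: ent_cont].
  have step1 : A <= mean rho (fun v => `|ln (nc (f v))| + \sum_(a <- s) `|ln (nc (v - a)) - ln rho|).
    apply: (mean_le (ltW rho0)).
    - move=> v vr; apply: contR_norm; apply: contR_D; last exact: contR_cst.
      by apply: cont_ln_nc; [apply: g0; rewrite vr|exact: ent_cont].
    - by move=> v vr; apply: contR_D; [exact: cf|exact: csum].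
    move=> v vr; have fv := fr v vr.
    have sv a : a \in s -> v != a.
      by move=> /sr ar; apply/eqP => va; move: ar; rewrite -va vr eqxx.
    have lnf : ln (nc (f v)) = \sum_(a <- s) ln (nc (v - a)) + ln (nc (g v)).
      move: fv; rewrite (zu_fact zu) mulf_eq0 negb_or => /andP[p0 gv].
      by rewrite ncM lnM ?posrE ?nc_gt0// ln_nc_prod.
    have -> : ln (nc (g v)) + k = ln (nc (f v)) - \sum_(a <- s) (ln (nc (v - a)) - ln rho).
      have E : \sum_(a <- s) ln rho = n%:R * ln rho.
        rewrite /n -sum1_size natr_sum mulr_suml.
        by apply: eq_bigr => a _; rewrite mul1r.
      by rewrite sumrB lnf E /k; ring.
    by rewrite (le_trans (ler_normB _ _))// lerD2l ler_norm_sum.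
  apply: (le_trans step1); rewrite (meanD (ltW rho0) cf csum) lerD//.
    exact: (mean_abs_ln_le ef fn0 rho1 fr Jc).
  rewrite /n; elim: s sr sle {zu csum step1 n k osc A} => [|a s IH] sr sle.
    rewrite mul0r (eq_mean (ltW rho0) (h := fun _ => 0)) ?mean_cst// => v _.
    by rewrite big_nil.
  rewrite (eq_mean (ltW rho0) (h := fun v => `|ln (nc (v - a)) - ln rho| +
     \sum_(b <- s) `|ln (nc (v - b)) - ln rho|)); last by move=> v _; rewrite big_cons.
  have sr' b : b \in s -> nc b != rho by move=> bs; apply: sr; rewrite inE bs orbT.
  have cc (b : C) v : nc b != rho -> nc v = rho ->
      {for v, continuous (fun v => `|ln (nc (v - b)) - ln rho|)}.
    move=> br vr; apply: contR_norm; apply: contR_B; last exact: contR_cst.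
    apply: cont_ln_nc; last by apply: contC_B; [exact: contC_id|exact: contC_cst].
    by rewrite subr_eq0; apply/eqP => vb; move: br; rewrite -vb vr eqxx.
  rewrite (meanD (ltW rho0)); last 2 first.
  - by move=> v vr; apply: cc vr; apply: sr; rewrite mem_head.
  - move=> v vr; rewrite (_ : (fun _ => _) = fun v => \sum_(i < size s) `|ln (nc (v - nth 0 s i)) - ln rho|); last first.
      by apply/funext => u; rewrite (big_nth 0) big_mkord.
    by apply: contR_sum => i; apply: cc vr; apply: sr'; exact: mem_nth.
  rewrite /= -natr1 mulrDl mul1r addrC; apply: lerD.
    by apply: IH => // b bs; apply: sle; rewrite inE bs orbT.
  by apply: mean_abs_ln_sub; rewrite ?sle ?sr ?mem_head.
have A0 : 0 <= A by apply: (mean_ge0 (ltW rho0)) => v _.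
set B := 2 * _ + _ + _ in AB *.
have ratio : ln (nc (g w)) - ln (nc (g z)) <= 16 * eps * B.
  apply: (le_trans osc); rewrite -(mulrA 16) -(mulrA 16) ler_wpM2l//.
  apply: ler_pM => //; first by rewrite divr_ge0 ?nc_ge0// ltW.
  by rewrite ler_pdivrMr.
rewrite (zu_fact zu w) (zu_fact zu z) !ncM expRD.
move: fz; rewrite (zu_fact zu) mulf_eq0 negb_or => /andP[pz _].
have sz a : a \in s -> z != a.
  move=> as_; apply/eqP => za; move: pz; rewrite (big_rem a)//= za subrr mul0r eqxx.
  by [].
have -> : nc (\prod_(a <- s) (z - a)) * nc (g z) * (expR (16 * eps * B) * expR (zero_weight rho s z)) =
  (nc (\prod_(a <- s) (z - a)) * expR (zero_weight rho s z)) * (nc (g z) * expR (16 * eps * B)) by ring.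
apply: ler_pM; rewrite ?nc_ge0//; last first.
  rewrite -ler_ln ?posrE ?mulr_gt0 ?nc_gt0 ?expR_gt0//.
  by rewrite lnM ?posrE ?nc_gt0 ?expR_gt0// expRK -lerBlDl.
rewrite /zero_weight; elim: s {zu sr n k osc A AB A0 B ratio pz} sle sz => [|a s IH] sle sz.
  by rewrite !big_nil expR0 mulr1.
have za : 0 < nc (z - a) by rewrite nc_gt0 subr_eq0 sz// mem_head.
rewrite !big_cons !ncM expRD mulrACA; apply: ler_pM; rewrite ?nc_ge0//; last first.
  by apply: IH => b bs; [apply: sle|apply: sz]; rewrite inE bs orbT.
rewrite expRB !lnK ?posrE ?mulr_gt0// mulrC divfK ?gt_eqF//.
rewrite (le_trans (nc_sub_le _ _))// (_ : 3 * rho = rho + 2 * rho); last by ring.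
rewrite lerD ?sle ?mem_head// (le_trans wr)//.
by rewrite ler_pdivrMr// ler_pMr// ler1n.
Qed.

(** On discs of radius 2 the Cauchy estimate, with its factor 2, reproduces the bound [M]. Each
    derivative costs two units of radius and nothing else. *)
Lemma derive1n_bound f j (c : C) (d M : R) : ent f -> (2 * j)%:R <= d ->
  (forall z, nc (z - c) <= d -> nc (f z) <= M) ->
  forall z, nc (z - c) <= d - (2 * j)%:R -> nc (derive1n j f z) <= M.
Proof.
move=> ef; elim: j => [|j IH] jd fM z.
  by rewrite muln0 subr0; exact: fM.
move=> zd; rewrite derive1nS.
have jd' : (2 * j)%:R <= d by rewrite (le_trans _ jd)// ler_nat leq_mul2l ltnW.
have := @cauchy_estimate R (derive1n j f) z 2 M (@ent_derive1n R f j ef) (ltr0Sn _ 1).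
rewrite mulrAC divff ?mul1r ?pnatr_eq0//; apply => v vz.
apply: IH => //; rewrite (le_trans (nc_dist_tri z _ _))//.
rewrite (le_trans (lerD vz zd))// mulnS natrD.
by rewrite le_eqVlt; apply/orP; left; apply/eqP; ring.
Qed.

End Ratio.

(** * Choice of good radii *)

Section Radii.
Variable R : realType.
Local Notation C := R[i].
Implicit Types (r x : R).

(** An interval longer than the measure of [E] is not covered by [E] and a countable set. *)
Lemma avoid_radii (E B : set R) : measurable E -> (lebesgue_measure E < +oo)%E ->
  countable B -> exists2 L : R, 0 < L & forall x, exists2 r, x <= r <= x + L & ~ E r /\ ~ B r.
Proof.
move=> mE Efin cB; pose L := fine (lebesgue_measure E) + 1.
have L0 : 0 < L by rewrite ltr_wpDl// fine_ge0.
exists L => // x; apply: contrapT => H.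
have mB : measurable B by apply: countable_measurable => // t; exact: measurable_set1.
have sub : `[x, x + L]%classic `<=` E `|` B.
  move=> r /=; rewrite in_itv /= => xr; apply: contrapT => /not_orP[nE nB].
  by apply: H; exists r.
have : (lebesgue_measure `[x, (x + L)%R]%classic <= lebesgue_measure E)%E.
  apply: (@le_trans _ _ (lebesgue_measure (E `|` B))).
    by apply: le_measure; rewrite ?inE//; exact: measurableU.
  apply: (@le_trans _ _ (lebesgue_measure E + lebesgue_measure B)%E).
    exact: measureU2.
  by rewrite (countable_lebesgue_measure0 cB) adde0.
rewrite lebesgue_measure_itv /= lte_fin ltrDl L0 -EFinD addrAC subrr add0r.
rewrite -(@fineK _ (lebesgue_measure E)) ?ge0_fin_numE// lee_fin /L.
by rewrite gerDl leNgt ltr01.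
Qed.

Lemma growth_order_bound (f : C -> C) : (growth_order f < +oo)%E ->
  exists (n : nat) (x : R), forall r, x < r -> nevanlinna_T r f <= r ^+ n.
Proof.
rewrite /growth_order limf_esupE => /ereal_inf_lt[_ [V [M [_ MV]] <-]] supV.
have [k kP] : exists k : R, forall r, M < r -> ln (nevanlinna_T r f) / ln r <= k.
  case E : (ereal_sup _) supV => [k| |] // _.
    exists k => r Mr; rewrite -lee_fin -E; apply: ereal_sup_ubound.
    by exists r => //; exact: MV.
  (* If the supremum is [-oo], any real number is an upper bound. *)
  exists 0 => r Mr; rewrite -lee_fin; apply: (@le_trans _ _ (-oo)%E); last exact: leNye.
  by rewrite -E; apply: ereal_sup_ubound; exists r => //; exact: MV.
exists (Num.truncn `|k|).+1, (Num.max M 1) => r.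
rewrite gt_max => /andP[Mr r1]; have r0 : 0 < r := lt_trans ltr01 r1.
have lr : 0 < ln r by rewrite ln_gt0.
set T := nevanlinna_T r f; have [T0|T0] := leP T 0.
  by rewrite (le_trans T0)// exprn_ge0// ltW.
rewrite -ler_ln ?posrE ?exprn_gt0// lnXn// -mulr_natr mulrC -ler_pdivrMr//.
rewrite (le_trans (kP r Mr))// (le_trans (ler_norm k))// ltW//.
exact: truncnS_gt.
Qed.

(* The only use of finite order: a sequence of polynomial growth in [4 ^ n] cannot
   increase by a fixed large factor at every step. *)
Lemma slow_growth (t : nat -> R) (s n1 : nat) : (forall n, 0 <= t n) ->
  (forall n, (n1 <= n)%N -> t n <= (2 * 4 ^+ n) ^+ s) -> forall n0, exists2 n, (n0 <= n)%N &
  t n.+1 <= 2 * 16 ^+ s * (t n + 1) /\ t n.+2 <= 2 * 16 ^+ s * (t n + 1).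
Proof.
move=> t0 tb n0; apply: contrapT => H.
(* Two steps multiply the polynomial bound by at most [(4^2)^s = 16^s]. Growth by [K] at least once
   in every two steps would then beat this bound by [2^j] after [j] rounds. *)
set K : R := 2 * 16 ^+ s in H.
have K0 : 0 < K by rewrite mulr_gt0// exprn_gt0.
pose m := maxn n0 n1.
have step n : (m <= n)%N -> exists2 n', (n < n' <= n.+2)%N & K * (t n + 1) < t n'.
  move=> mn; have n0n : (n0 <= n)%N by rewrite (leq_trans _ mn)// leq_maxl.
  have [h1|h1] := leP (t n.+1) (K * (t n + 1)); last by exists n.+1; rewrite ?ltnSn ?leqnSn.
  have [h2|h2] := leP (t n.+2) (K * (t n + 1)); last by exists n.+2; rewrite ?leqnn ?leqnSn.
  by exfalso; apply: H; exists n.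
have big j : exists2 n, (m <= n <= m + 2 * j)%N & K ^+ j <= t n + 1.
  elim: j => [|j [n /andP[mn nj] IH]].
    by exists m; rewrite ?leqnn ?muln0 ?addn0 ?leqnn// expr0 lerDr.
  have [n' /andP[nn' n'n] h] := step n mn; exists n'.
    rewrite (leq_trans mn (ltnW nn')) (leq_trans n'n)// mulnS addnCA.
    by rewrite !addSn add0n !ltnS.
  rewrite exprS (le_trans (ler_wpM2l (ltW K0) IH))// (le_trans (ltW h))//.
  by rewrite lerDl.
pose A : R := (2 * 4 ^+ m) ^+ s + 1.
have A0 : 0 <= A by rewrite addr_ge0// exprn_ge0// mulr_ge0// exprn_ge0.
have bound j : 2 ^+ j <= A.
  have [n /andP[mn nj] h] := big j.
  have h2 := tb n (leq_trans (leq_maxr _ _) mn).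
  have c16 : 1 <= (16 ^+ s) ^+ j :> R by rewrite !exprn_ege1// ler1n.
  have c0 : 0 < (16 ^+ s) ^+ j :> R by rewrite (lt_le_trans ltr01).
  rewrite -(ler_pM2r c0) -exprMn -/K (le_trans h)//.
  rewrite /A mulrDl mul1r; apply: lerD => //.
  rewrite (le_trans h2)// -exprM [(s * j)%N]mulnC exprM -exprMn.
  apply: lerXn2r; rewrite ?nnegrE ?mulr_ge0 ?exprn_ge0//.
  rewrite -mulrA ler_wpM2l// (_ : 16 = 4 ^+ 2); last by rewrite expr2; ring.
  by rewrite -exprM -exprD ler_weXn2l// ler1n.
pose j := (Num.truncn A).+1.
have : A < 2 ^+ j.
  apply: (lt_le_trans (truncnS_gt A)); rewrite -/j.
  rewrite -natrX ler_nat; exact/ltnW/ltn_expl.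
by rewrite ltNge bound.
Qed.

Lemma is_S_add (f : C -> C) (u v : R -> R) : is_S f u -> is_S f v ->
  is_S f (fun r => `|u r| + `|v r|).
Proof.
move=> [E1 [mE1 fE1 H1]] [E2 [mE2 fE2 H2]]; exists (E1 `|` E2); split.
- exact: measurableU.
- by apply: le_lt_trans; [exact: measureU2|rewrite lte_add_pinfty].
move=> e e0; have e20 : 0 < e / 2 by rewrite divr_gt0.
near=> r => /not_orP[n1 n2].
rewrite ger0_norm ?addr_ge0// [e]splitr mulrDl lerD//.
  by move: n1; near: r; exact: H1.
by move: n2; near: r; exact: H2.
Unshelve. all: by end_near. Qed.

Lemma is_S0 (f : C -> C) : ent f -> is_S f (fun=> 0).
Proof.
move=> ef; exists set0; split; [exact: measurable0|by rewrite measure0|].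
move=> e e0; near=> r => _; rewrite normr0 mulr_ge0 ?(ltW e0)// nevanlinna_T_ent_ge0//.
Unshelve. all: by end_near. Qed.

Lemma is_S_sum (f : C -> C) n (u : 'I_n -> R -> R) : ent f -> (forall i, is_S f (u i)) ->
  is_S f (fun r => \sum_(i < n) `|u i r|).
Proof.
move=> ef; elim: n u => [|n IH] u Hu.
  by under eq_fun do rewrite big_ord0; exact: is_S0.
under eq_fun do rewrite big_ord_recr /=.
have := is_S_add (IH _ (fun i => Hu (widen_ord (leqnSn n) i))) (Hu ord_max).
by under eq_fun do rewrite ger0_norm ?sumr_ge0//.
Qed.

(** The radii lie just above consecutive powers of 4. Estimates are wanted at [r]; oscillation is
    measured from [rho], and zeros up to [2 * rho] are counted from [sig]. [K] depends on the growth
    of [f] only, so that [d] may be chosen after it. *)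
Theorem good_radii (f : C -> C) (u : R -> R) : ent f ->
  (growth_order f < +oo)%E -> is_S f u ->
  exists2 K : R, 0 < K & forall (B : set R) (d x0 : R), countable B -> 0 < d ->
  exists r rho sig : R,
  [/\ x0 <= r, 3 * r <= rho <= 5 * r, 3 * rho <= sig, [/\ ~ B r, ~ B rho & ~ B sig] &
   [/\ nevanlinna_T rho f <= K * (nevanlinna_T r f + 1),
       nevanlinna_T sig f <= K * (nevanlinna_T r f + 1),
       `|u r| <= d * nevanlinna_T r f, `|u rho| <= d * nevanlinna_T rho f &
       `|u sig| <= d * nevanlinna_T sig f]].
Proof.
move=> ef /growth_order_bound[s [x1 gb]] [E [mE fE HE]].
exists (2 * 16 ^+ s); first by rewrite mulr_gt0// exprn_gt0.
move=> B d x0 cB d0.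
have [L L0 HL] := avoid_radii mE fE cB.
have ch n : { r : R | (4 ^+ n <= r <= 4 ^+ n + L) /\ (~ E r /\ ~ B r) }.
  by apply: cid; have [r rL rEB] := HL (4 ^+ n); exists r.
pose rr n := sval (ch n).
have rr1 n : 4 ^+ n <= rr n by have [/andP[]] := svalP (ch n).
have rr2 n : rr n <= 4 ^+ n + L by have [/andP[]] := svalP (ch n).
have rrE n : ~ E (rr n) by have [_ []] := svalP (ch n).
have rrB n : ~ B (rr n) by have [_ []] := svalP (ch n).
have p4 n : 0 < 4 ^+ n :> R by rewrite exprn_gt0.
have rr0 n : 0 < rr n by rewrite (lt_le_trans (p4 n)).
have large (x : R) : exists n0, forall n, (n0 <= n)%N -> x <= 4 ^+ n.
  exists (Num.truncn x).+1 => n xn.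
  apply: (le_trans (ltW (truncnS_gt x))).
  rewrite -natrX ler_nat; apply: (leq_trans xn); exact/ltnW/ltn_expl.
(* From [nL] on, the displacement [L] is at most a quarter of [4 ^+ n], which keeps the ratio of
   consecutive radii between 3 and 5. *)
have [nL nLP] := large (4 * L).
have [nx nxP] := large (x1 + 1).
have rr3 n : (nL <= n)%N -> 4 * rr n <= 5 * 4 ^+ n.
  move=> /nLP h; apply: (le_trans (ler_wpM2l _ (rr2 n))) => //.
  have -> : 5 * 4 ^+ n = 4 * 4 ^+ n + 4 ^+ n :> R by ring.
  by rewrite mulrDr lerD2l.
have [M [_ MP]] := HE d d0.
have [n0 n0P] := large (Num.max x0 (M + 1)).
have T0 n : 0 <= nevanlinna_T (rr n) f by apply: nevanlinna_T_ent_ge0.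
have Tb n : (maxn nL nx <= n)%N -> nevanlinna_T (rr n) f <= (2 * 4 ^+ n) ^+ s.
  rewrite geq_max => /andP[/nLP hL /nxP hx].
  apply: (le_trans (gb _ _)).
    by rewrite (lt_le_trans _ (rr1 n))// (lt_le_trans _ hx)// ltrDl.
  apply: lerXn2r; rewrite ?nnegrE ?(ltW (rr0 n)) ?mulr_ge0 ?(ltW (p4 n))//.
  rewrite (le_trans (rr2 n))// mulrDl mul1r lerD2l (le_trans _ hL)//.
  by rewrite ler_peMl ?(ltW L0)// ler1n.
have [n nn [g1 g2]] := slow_growth T0 Tb (maxn nL n0).
move: nn; rewrite geq_max => /andP[nLn n0n].
have uP k : (n <= k)%N -> `|u (rr k)| <= d * nevanlinna_T (rr k) f.
  move=> nk; apply: MP => //.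
  have := n0P k (leq_trans n0n nk); rewrite ge_max => /andP[_ h].
  by rewrite (lt_le_trans _ (rr1 k))// (lt_le_trans _ h)// ltrDl.
have ratio k : (n <= k)%N -> 3 * rr k <= rr k.+1.
  move=> nk; apply: (le_trans _ (rr1 _)); have := rr3 k (leq_trans nLn nk).
  have := p4 k; rewrite exprS; move: (4 ^+ k) (rr k) => a b a0 ab; lra.
have ratio' : rr n.+1 <= 5 * rr n.
  have := rr3 n.+1 (leq_trans nLn (leqnSn n)); have := rr1 n; rewrite exprS.
  by move: (4 ^+ n) (rr n) (rr n.+1) => a b c ab h; lra.
exists (rr n), (rr n.+1), (rr n.+2); split => //.
- apply: (le_trans _ (rr1 n)); have := n0P n n0n.
  by rewrite ge_max => /andP[].
- by rewrite ratio ?ratio'.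
- by apply: ratio; exact: leqnSn.
- by split => //; apply: uP; rewrite ?leqnn ?leqnSn ?(leq_trans (leqnSn n)).
Qed.

End Radii.

Lemma quarter_bound (R : realFieldType) (t u : R) :
  0 < u -> t <= 4^-1 * u -> (t + u) * 2 <= 3 * u.
Proof. by lra. Qed.

Lemma countableU T (A B : set T) : countable A -> countable B -> countable (A `|` B).
Proof.
move=> cA cB; rewrite -bigcup2E; apply: bigcup_countable => // -[|[|i]] _ //=.
Qed.

(** * The error function on a good circle *)

Section Control.
Variable R : realType.
Local Notation C := R[i].
Implicit Types (w z : C) (r : R).

Lemma mean_sum r (I : Type) (s : seq I) (F : I -> C -> R) : 0 <= r ->
  (forall i, cont_circ r (F i)) ->
  mean r (fun z => \sum_(i <- s) F i z) = \sum_(i <- s) mean r (F i).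
Proof.
move=> r0 cF; elim: s => [|i s IH].
  by rewrite big_nil (eq_mean r0 (h := fun _ => 0)) ?mean_cst// => z _; rewrite big_nil.
rewrite (eq_mean r0 (h := fun z => F i z + \sum_(j <- s) F j z)); last first.
  by move=> z _; rewrite big_cons.
rewrite (meanD r0 (cF i)) ?big_cons ?IH// => z zr.
by apply: contR_sum => j; exact: cF.
Qed.

Variables (f : C -> C) (k : nat) (a : 'I_k.+1 -> C -> C).

(* [Err] stands for all the error terms of Nevanlinna theory on one circle. *)
Record controlled r (eps : R) (Err : C -> R) : Prop := Controlled {
  ct_r : 1 <= r;
  ct_f : forall z, nc z = r -> f z != 0;
  ct_f1 : forall z, nc z = r -> derive1 f z != 0;
  ct_a : forall z, nc z = r -> forall j, holomorphic_at (a j) z;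
  ct_cont : cont_circ r Err;
  ct_ge0 : forall z, nc z = r -> 0 <= Err z;
  ct_aj : forall z j, nc z = r -> nc (a j z) <= expR (Err z);
  ct_fj : forall z j, nc z = r -> (j <= k)%N ->
    nc (derive1n j f z) <= nc (f z) * expR (Err z);
  ct_log : forall z, nc z = r -> nc (derive1 f z) <= nc (f z) * expR (Err z);
  ct_invlog : forall z, nc z = r -> nc (f z) <= nc (derive1 f z) * expR (Err z);
  ct_near : forall z w, nc z = r -> nc (w - z) <= eps * r ->
    nc (f w) <= nc (f z) * expR (Err z) }.

Hypotheses (ef : ent f) (f1n0 : exists z, derive1 f z != 0).
Hypothesis order_f : (growth_order f < +oo)%E.
Hypothesis SN : is_S f (fun r => nevanlinna_N r (fun z => (f z)^-1)).
Hypothesis small_a : forall j, small_function f (a j).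

Lemma derive1_neq0_neq0 : exists z, f z != 0.
Proof.
apply: contrapT => H; have [z /eqP] := f1n0; apply.
have f0 : f = fun=> 0.
  by apply/funext => w; apply/eqP; apply: contrapT => /negP fw; apply: H; exists w.
by rewrite f0; apply: derive1_is_derive; exact: is_deriveC_cst.
Qed.

(** [Err] is a sum of three nonnegative terms: [X] for the coefficients, [W] for the ratios
    [f(w) / f(z)] and hence for [f^(j) / f], and [V] for [f / f']. [eps] is fixed before the avoided
    set [B], since [B] will depend on a rotation that is [eps]-close to 1. *)
Lemma control_T : exists2 C0 : R, 0 <= C0 & forall eta : R, 0 < eta ->
  exists2 eps : R, 0 < eps & forall (B : set R) (x0 : R), countable B ->
  exists r Err, [/\ x0 <= r, ~ B r, controlled r eps Err,
    mean r Err <= eta * (nevanlinna_T r f + 1) + C0 &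
    mean r (fun z => ln (nc (f z))) <= eta * (nevanlinna_T r f + 1) + C0].
Proof.
have fn0 := derive1_neq0_neq0.
have ef1 := ent_derive1 ef.
have [cf Jf] := jensen ef fn0; have [cf1 Jf1] := jensen ef1 f1n0.
have Su := is_S_add SN (is_S_sum ef (fun j => (small_a j).2)).
have [K K0 radii] := good_radii ef order_f Su.
pose l : R := ln (3 / 2).
have l0 : 0 < l.
  by rewrite ln_gt0// ltr_pdivlMr// mul1r ltr_nat.
have l3 : 0 <= ln 3 :> R by rewrite ln_ge0// ler1n.
have l15 : 0 <= ln 15 :> R by rewrite ln_ge0// ler1n.
(* [P] and [Q] collect the coefficients of [d * (T + 1)] and [eps * (T + 1)] in the mean of [Err];
   each group receives half of [eta]. Here [3 / 2] is the least ratio of [sig] to [2 * rho], and 15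
   the largest of [3 * rho] to [r]. *)
pose P := 2 + 2 * (K / l) * ln 15; pose Q := 32 * (2 * K + K / l * (2 * ln 3)).
have Kl : 0 < K / l by rewrite divr_gt0.
have Kl' := ltW Kl.
have P2 : 2 <= P by rewrite lerDl; apply: mulr_ge0 => //; exact: mulr_ge0.
have P0 : 0 < P by rewrite (lt_le_trans _ P2).
have Q0 : 0 < Q.
  apply: mulr_gt0 => //; apply: ltr_pwDl; first exact: mulr_gt0.
  by apply: mulr_ge0 => //; exact: mulr_ge0.
exists (33 * `|cf| + `|cf1|); first by rewrite addr_ge0// mulr_ge0.
move=> eta eta0.
(* With [eps <= 1 / 4], points within [eps * r] of the circle have modulus at most [5 / 4 * r],
   hence at most [rho / 2]. *)
pose d := Num.min 1 (eta / (2 * P)); pose eps := Num.min (4^-1) (eta / (2 * Q)).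
have d0 : 0 < d by rewrite lt_min ltr01 divr_gt0// mulr_gt0.
have eps0 : 0 < eps by rewrite lt_min invr_gt0 ltr0Sn divr_gt0// mulr_gt0.
have d1 : d <= 1 by rewrite ge_min lexx.
have eps4 : eps <= 4^-1 by rewrite ge_min lexx.
have eps1 : eps <= 1 by rewrite (le_trans eps4)// invf_le1// ler1n.
have dP : d * P <= eta / 2.
  rewrite -ler_pdivlMr// -mulrA -invfM ge_min; apply/orP; right.
  by rewrite invfM.
have eQ : eps * Q <= eta / 2.
  rewrite -ler_pdivlMr// -mulrA -invfM ge_min; apply/orP; right.
  by rewrite invfM.
exists eps => // B x0 cB.
pose B' := B `|` [set r | exists2 z, nc z = r & f z = 0]
   `|` [set r | exists2 z, nc z = r & derive1 f z = 0]
   `|` \bigcup_(j in [set: 'I_k.+1]) [set r | exists2 z, nc z = r & ~ holomorphic_at (a j) z].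
have cB' : countable B'.
  apply: countableU; last first.
    apply: bigcup_countable => // j _; apply: isolated_radii.
    by apply: meromorphic_isolated; have [] := small_a j.
  apply: countableU; last by apply: isolated_radii; exact: zeros_isolated.
  apply: countableU => //; by apply: isolated_radii; exact: zeros_isolated.
(* Then [eps * r] leaves room for [k + 1] Cauchy estimates on discs of radius 2. One more than [k],
   so that [f'] is covered even for [k = 0]. *)
pose x1 := Num.max x0 (Num.max 1 ((2 * k.+1)%:R / eps)).
have [r [rho [sig [x1r /andP[rr1 rr2] rs [nBr nBrho nBsig] [T1 T2 u1 u2 u3]]]]] :=
  radii B' d x1 cB' d0.
have /and3P[x0r r1 r2] : [&& x0 <= r, 1 <= r & (2 * k.+1)%:R / eps <= r].
  by rewrite -!ge_max.
have r0 : 0 < r by rewrite (lt_le_trans ltr01).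
have rho1 : 1 <= rho.
  by rewrite (le_trans _ rr1)// (le_trans r1)// ler_peMl ?(ltW r0)// ler1n.
have rho0 : 0 < rho by rewrite (lt_le_trans ltr01).
have sig0 : 0 < sig by rewrite (lt_le_trans _ rs)// mulr_gt0.
have good t : ~ B' t -> [/\ ~ B t, forall z, nc z = t -> f z != 0,
    forall z, nc z = t -> derive1 f z != 0 &
    forall z, nc z = t -> forall j, holomorphic_at (a j) z].
  move=> nB; split.
  - by move=> Bt; apply: nB; left; left; left.
  - by move=> z zt; apply/eqP => fz; apply: nB; left; left; right; exists z.
  - by move=> z zt; apply/eqP => fz; apply: nB; left; right; exists z.
  - move=> z zt j; apply: contrapT => H; apply: nB; right.
    by exists j => //; exists z.
have [nBr' fr f1r ar] := good _ nBr.
have [_ frho _ _] := good _ nBrho.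
have [c' zer] := ent_zeros ef fn0.
have [s [g zu]] := zer (2 * rho) (mulr_gt0 (ltr0Sn R 1) rho0).
have [s' [g' zu']] := zer sig sig0.
set T := nevanlinna_T r f in T1 T2 u1 *.
have T0 : 0 <= T by exact: nevanlinna_T_ent_ge0.
set n := size s; pose nR : R := n%:R.
(* The number of zeros up to [2 * rho], bounded through [N] at [sig]. *)
have nK : nR <= d * (K / l) * (T + 1).
  have le1 : 1 <= 2 * rho by rewrite (le_trans rho1)// ler_peMl ?(ltW rho0)// ler1n.
  have le2 : 2 * rho <= sig.
    by rewrite (le_trans _ rs)// ler_wpM2r ?(ltW rho0)// ler_nat.
  have := zeros_count_le le1 le2 zu zu'.
  have ll : l <= ln sig - ln (2 * rho).
    rewrite lerBrDr -lnM ?posrE ?divr_gt0 ?mulr_gt0// ler_ln ?posrE ?mulr_gt0 ?divr_gt0//.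
    by rewrite (_ : 3 / 2 * (2 * rho) = 3 * rho) //; field.
  move=> /(le_trans (ler_wpM2l (ler0n R n) ll)).
  have uN : nevanlinna_N sig (fun z => (f z)^-1) <= d * nevanlinna_T sig f.
    apply: le_trans u3; rewrite ger0_norm ?addr_ge0//.
    by rewrite (le_trans (ler_norm _))// lerDl.
  move=> /le_trans/(_ uN)/le_trans/(_ (ler_wpM2l (ltW d0) T2)) h.
  rewrite -(ler_pM2r l0) (le_trans h)// le_eqVlt; apply/orP; left; apply/eqP.
  by field; rewrite gt_eqF.
pose kap := 16 * eps * (2 * nevanlinna_T rho f + `|cf| + nR * (2 * ln 3)).
have kap0 : 0 <= kap.
  rewrite mulr_ge0 ?addr_ge0 ?mulr_ge0// ?(ltW eps0)//.
  exact: nevanlinna_T_ent_ge0.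
pose W z := kap + zero_weight rho s z.
have sr := zeros_offcircle zu fr.
have cW : cont_circ r W.
  by move=> z zr; apply: contR_D; [exact: contR_cst|exact: (cont_zero_weight sr zr)].
have W0 z : nc z = r -> 0 <= W z.
  move=> zr; rewrite addr_ge0// zero_weight_ge0//.
  - by rewrite zr (le_trans _ rr1)// ler_peMl ?(ltW r0)// ler1n.
  - exact: zu_le zu.
  - by move=> b /sr br; apply/eqP => zb; move: br; rewrite -zb zr eqxx.
have WP z w : nc z = r -> nc (w - z) <= eps * r -> nc (f w) <= nc (f z) * expR (W z).
  move=> zr wz; have Jrho := Jf _ rho0 frho.
  apply: (@ratio_bound R f rho s g cf c' r eps w z ef fn0 rho1 zu frho Jrho).
  - by rewrite zr ler_pdivlMr// (le_trans _ rr1)// mulrC ler_wpM2r ?(ltW r0)// ler_nat.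
  - have -> : w = (w - z) + z by rewrite subrK.
    rewrite (le_trans (ncD _ _))// zr ler_pdivlMr// (le_trans _ rr1)//.
    rewrite (le_trans (ler_wpM2r _ (lerD wz (lexx _))))//.
    have : eps * r <= 4^-1 * r by rewrite ler_wpM2r// ltW.
    exact: quarter_bound.
  - rewrite (le_trans wz)// ler_wpM2l ?(ltW eps0)// (le_trans _ rr1)//.
    by rewrite ler_peMl ?(ltW r0)// ler1n.
  - exact: fr.
have Wj z j : nc z = r -> (j <= k.+1)%N -> nc (derive1n j f z) <= nc (f z) * expR (W z).
  move=> zr jk; have jd : (2 * j)%:R <= eps * r.
    move: r2; rewrite ler_pdivrMr// mulrC; apply: le_trans.
    by rewrite ler_nat leq_mul2l.
  apply: (derive1n_bound (c := z) ef jd) => [w wz|]; first exact: WP.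
  by rewrite subrr nc0 subr_ge0.
have W1 z : nc z = r -> nc (derive1 f z) <= nc (f z) * expR (W z).
  by move=> zr; rewrite -derive1n1; exact: Wj.
have lW z : nc z = r -> 0 <= W z - ln (nc (derive1 f z)) + ln (nc (f z)).
  move=> zr; rewrite addrAC subr_ge0 -[W z]expRK.
  rewrite addrC -lnM ?posrE ?nc_gt0 ?fr ?expR_gt0//.
  by rewrite ler_ln ?posrE ?mulr_gt0 ?nc_gt0 ?fr ?f1r ?expR_gt0// W1.
pose X z := \sum_(j <- index_enum 'I_k.+1) lnp (nc (a j z)).
have ca j : cont_circ r (fun z => lnp (nc (a j z))).
  by move=> z zr; apply: cont_lnp_nc; exact: holomorphic_cont (ar z zr j).
have cX : cont_circ r X by move=> z zr; apply: contR_sum => j; exact: ca.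
have X0 z : 0 <= X z by apply: sumr_ge0 => j _; exact: lnp_ge0.
have cl : cont_circ r (fun z => ln (nc (f z))).
  by move=> z zr; apply: cont_ln_nc; [exact: fr|exact: ent_cont].
have cl1 : cont_circ r (fun z => ln (nc (derive1 f z))).
  by move=> z zr; apply: cont_ln_nc; [exact: f1r|exact: ent_cont].
(* Adding [W] makes [ln |f / f'|] nonnegative. In the mean, Jensen's formula for [f'] enters with a
   minus sign, so its counting function is simply dropped. *)
pose V z := W z - ln (nc (derive1 f z)) + ln (nc (f z)).
have cWl : cont_circ r (fun z => W z - ln (nc (derive1 f z))).
  by move=> z zr; apply: contR_B; [exact: cW|exact: cl1].
have cV : cont_circ r V by move=> z zr; apply: contR_D; [exact: cWl|exact: cl].
have cXW : cont_circ r (fun z => X z + W z).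
  by move=> z zr; apply: contR_D; [exact: cX|exact: cW].
pose Err z := X z + W z + V z.
have EX z : nc z = r -> X z <= Err z.
  by move=> zr; rewrite /Err -addrA lerDl addr_ge0 ?W0 ?lW.
have EW z : nc z = r -> W z <= Err z.
  by move=> zr; rewrite /Err addrAC lerDr addr_ge0 ?lW.
have EV z : nc z = r -> V z <= Err z.
  by move=> zr; rewrite /Err lerDr addr_ge0 ?W0.
have NT : nevanlinna_N r (fun z => (f z)^-1) <= d * T.
  apply: le_trans u1; rewrite ger0_norm ?addr_ge0//.
  by rewrite (le_trans (ler_norm _))// lerDl.
have N1 : 0 <= nevanlinna_N r (fun z => (derive1 f z)^-1) by exact: N_inv_ge0.
have dT : d * T <= d * (T + 1) by rewrite ler_wpM2l ?(ltW d0)// lerDl.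
exists r, Err; split => //.
- split => //.
  + by move=> z zr; apply: contR_D; [exact: cXW|exact: cV].
  + by move=> z zr; rewrite (le_trans (W0 z zr))// EW.
  + move=> z j zr; apply: (le_trans (le_exp_lnp _)); rewrite ler_expR.
    apply: le_trans (EX z zr); rewrite /X (bigD1_seq j) ?mem_index_enum ?index_enum_uniq//=.
    by rewrite lerDl sumr_ge0// => i _; exact: lnp_ge0.
  + move=> z j zr jk; apply: (le_trans (Wj z j zr (leqW jk))).
    by rewrite ler_wpM2l ?nc_ge0// ler_expR EW.
  + move=> z zr; apply: (le_trans (W1 z zr)).
    by rewrite ler_wpM2l ?nc_ge0// ler_expR EW.
  + move=> z zr; rewrite -ler_ln ?posrE ?mulr_gt0 ?nc_gt0 ?fr ?f1r ?expR_gt0//.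
    rewrite lnM ?posrE ?nc_gt0 ?f1r ?expR_gt0// expRK -lerBlDl.
    apply: le_trans (EV z zr); rewrite /V -addrA [- _ + _]addrC lerDr.
    exact: W0.
  + move=> z w zr wz; apply: (le_trans (WP z w zr wz)).
    by rewrite ler_wpM2l ?nc_ge0// ler_expR EW.
- rewrite (meanD (ltW r0) cXW cV) (meanD (ltW r0) cX cW).
  rewrite /V (meanD (ltW r0) cWl cl) (meanB (ltW r0) cW cl1) (Jf r r0 fr) (Jf1 r r0 f1r).
  have mX : mean r X <= d * T.
    rewrite (mean_sum _ (ltW r0) ca); apply: le_trans u1; rewrite ger0_norm ?addr_ge0//.
    apply: (@le_trans _ _ `|\sum_(i < k.+1) `|nevanlinna_T r (a i)| |); last by rewrite lerDr.
    apply: le_trans (ler_norm _).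
    apply: ler_sum => j _; apply: le_trans (ler_norm _).
    by apply: m_le_T => //; have [] := small_a j.
  have mW : mean r W <= kap + nR * ln 15.
    rewrite (meanD (ltW r0)); last 2 first.
    - by move=> z _; exact: contR_cst.
    - exact: cont_zero_weight.
    rewrite mean_cst lerD2l (le_trans (mean_zero_weight r0 rho0 sr))//.
    rewrite ler_wpM2l// lerBlDr -lnM ?posrE// ler_ln ?posrE ?mulr_gt0//.
    by rewrite (_ : 15 * r = 3 * (5 * r)) ?ler_wpM2l//; ring.
  have kapb : kap <= 16 * eps * (2 * (K * (T + 1)) + `|cf| + (K / l) * (T + 1) * (2 * ln 3)).
    rewrite ler_wpM2l ?mulr_ge0 ?(ltW eps0)// !lerD//; first by rewrite ler_wpM2l.
    rewrite ler_wpM2r ?mulr_ge0// (le_trans nK)// ler_wpM2r ?(addr_ge0 T0)//.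
    by rewrite ler_piMl.
  have nb : nR * ln 15 <= d * (K / l) * (T + 1) * ln 15 by rewrite ler_wpM2r.
  have e1 : eps * `|cf| <= `|cf| by rewrite ler_piMl.
  have a1 := ler_norm cf; have a2 : - cf1 <= `|cf1| by rewrite -normrN ler_norm.
  have dPT : d * P * (T + 1) <= eta / 2 * (T + 1) by rewrite ler_wpM2r ?(addr_ge0 T0).
  have eQT : eps * Q * (T + 1) <= eta / 2 * (T + 1) by rewrite ler_wpM2r ?(addr_ge0 T0).
  move: mX mW kapb nb NT N1 dT e1 a1 a2 dPT eQT.
  rewrite /P /Q; set m1 := mean r X; set m2 := mean r W.
  set N0 := nevanlinna_N r _; set N2 := nevanlinna_N r _.
  move: (K / l) (T + 1) => q t.
  have -> : 16 * eps * (2 * (K * t) + `|cf| + q * t * (2 * ln 3)) =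
    16 * (2 * (eps * K * t) + eps * `|cf| + 2 * (eps * q * t * ln 3)) by ring.
  have -> : d * (2 + 2 * q * ln 15) * t = 2 * (d * t) + 2 * (d * q * t * ln 15) by ring.
  have -> : eps * (32 * (2 * K + q * (2 * ln 3))) * t =
    32 * (2 * (eps * K * t) + 2 * (eps * q * t * ln 3)) by ring.
  have -> : eta / 2 * t = eta * t / 2 by ring.
  move: (eps * K * t) (eps * q * t * ln 3) (eps * `|cf|) (d * t) (d * q * t * ln 15)
    (eta * t) (d * T) `|cf| `|cf1| (nR * ln 15).
  by clear; move=> *; lra.
- rewrite (Jf r r0 fr) lerD//.
    rewrite (le_trans NT)// (le_trans dT)// ler_wpM2r ?(addr_ge0 T0)//.
    apply: (@le_trans _ _ (d * P)); first by rewrite ler_peMr ?(ltW d0)// (le_trans _ P2)// ler1n.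
    by rewrite (le_trans dP)// ler_pdivrMr// ler_peMr ?(ltW eta0)// ler1n.
  by rewrite (le_trans (ler_norm _))// -[leLHS]addr0 lerD// ler_peMl// ler1n.
Qed.

End Control.

(** * The rotation argument *)

Section Polar.
Variable R : realType.
Local Notation C := R[i].

Lemma polar1 (v : C) : nc v = 1 -> exists2 t : R, 0 <= t <= 2 * pi & v = expC (t *i)%C.
Proof.
case: v => x y v1; have xy : x ^+ 2 + y ^+ 2 = 1.
  have := congr1 (fun u => u ^+ 2) v1; rewrite expr1n /= sqr_sqrtr//.
  by rewrite addr_ge0 ?sqr_ge0.
have y2 : 1 - x ^+ 2 = y ^+ 2 by rewrite -xy; ring.
have x1 : -1 <= x <= 1.
  by rewrite -ler_norml -v1; exact: (Re_le_nc (x +i* y)%C).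
have [a0 api] := (acos_ge0 x1, acos_lepi x1); have p0 := pi_ge0 R.
have cx : cos (acos x) = x by rewrite acosK// in_itv.
have sx := sin_acos x1; rewrite y2 sqrtr_sqr in sx.
have [y0|y0] := leP 0 y.
  exists (acos x).
    by rewrite a0 (le_trans api)// ler_peMl// ler1n.
  by rewrite expCE /= expR0 !mul1r cx sx ger0_norm.
exists (2 * pi - acos x).
  by rewrite subr_ge0 gerBl a0 andbT (le_trans api)// ler_peMl// ler1n.
rewrite expCE /= expR0 !mul1r (_ : 2 * pi = pi *+ 2) ?mulr_natl//.
rewrite (cosD _ (- acos x)) (sinD _ (- acos x)) cos2pi sin2pi cosN sinN cx sx.
rewrite ltr0_norm//; apply/eqP; rewrite eq_complex /=.
by apply/andP; split; apply/eqP; ring.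
Qed.

Lemma expC_surj (v : C) : v != 0 -> exists u, expC u = v.
Proof.
move=> v0; have nv : 0 < nc v by rewrite nc_gt0.
have : nc (v / (nc v)%:C%C) = 1.
  by rewrite ncM ncV nc_pos ?ltW// divff// gt_eqF.
move=> /polar1[t _ tE]; exists ((ln (nc v))%:C%C + (t *i)%C).
rewrite expCD expC_real -tE lnK ?posrE// mulrCA divff ?mulr1//.
by rewrite -nc_eq0 nc_pos ?gt_eqF// ltW.
Qed.

End Polar.

(** * Elementary inequalities for the equation *)

Section RealBounds.
Variable R : realType.
Implicit Types (m q X P kap a Z : R).

(** Either [m <= X], or one factor [m] can be cancelled after replacing one factor [X] by [m].
    Applied with [m = |f|], [q = exp Err] and [X^2] a bound for both exponentials. *)
Lemma quadratic_growth m q X P kap : 0 <= m -> 1 <= q -> 1 <= X -> 0 <= P -> 0 <= kap ->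
  m ^+ 2 <= q * (P * X ^+ 2 + kap * (m * q ^+ 2)) -> m <= (1 + P + kap) * (q ^+ 3 * X).
Proof.
move=> m0 q1 X1 P0 k0 H.
have q0 : 0 <= q by rewrite (le_trans ler01).
have X0 : 0 <= X by rewrite (le_trans ler01).
have q3 : q <= q ^+ 3 by rewrite -[leLHS]expr1 ler_weXn2l.
have q31 : 1 <= q ^+ 3 by rewrite (le_trans q1).
have q30 : 0 <= q ^+ 3 by rewrite (le_trans q0).
have qX0 : 0 <= q ^+ 3 * X by rewrite mulr_ge0.
have XqX : X <= q ^+ 3 * X by rewrite ler_peMl.
have [mX|Xm] := leP m X.
  rewrite (le_trans mX)// (le_trans XqX)// ler_peMl//.
  by rewrite -addrA lerDl addr_ge0.
have mp : 0 < m by rewrite (le_lt_trans X0).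
have : m * m <= m * (q * P * X + kap * q ^+ 3).
  rewrite -expr2 (le_trans H)//.
  have -> : q * (P * X ^+ 2 + kap * (m * q ^+ 2)) = (q * P * X) * X + m * (kap * q ^+ 3) by ring.
  rewrite mulrDr lerD2r mulrC ler_wpM2r ?(ltW Xm)//.
  by rewrite !mulr_ge0.
rewrite ler_pM2l// => /le_trans; apply.
rewrite !mulrDl mul1r -[leLHS]add0r -addrA lerD// lerD//.
  by rewrite [q * P]mulrC -mulrA ler_wpM2l// ler_wpM2r.
by rewrite ler_wpM2l// ler_peMr.
Qed.

(** The term linear in [m] is absorbed by completing a square:
    [kap m q^2 <= (kap^2 / a) q^4 m^2 + a / 4]. Applied with [Z = |exp(gamma1 z)|], it bounds the
    exponential by [|f|^2] where it dominates. *)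
Lemma dominant_term a Z m q kap : 0 < a -> 1 <= Z -> 1 <= q ->
  a * Z <= m ^+ 2 * q + a / 2 * Z + kap * (m * q ^+ 2) ->
  Z <= 4 / a * (1 + kap ^+ 2 / a) * (q ^+ 4 * m ^+ 2).
Proof.
move=> a0 Z1 q1 H.
have s0 : 0 <= (kap * (m * q ^+ 2) - a / 2) ^+ 2 / a by rewrite divr_ge0 ?sqr_ge0 ?ltW.
have E : (kap * (m * q ^+ 2) - a / 2) ^+ 2 / a =
  kap ^+ 2 / a * (q ^+ 4 * m ^+ 2) - kap * (m * q ^+ 2) + a / 4.
  by field; rewrite gt_eqF.
have q4 : m ^+ 2 * q <= q ^+ 4 * m ^+ 2.
  by rewrite mulrC ler_wpM2r ?sqr_ge0// -[leLHS]expr1 ler_weXn2l.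
have aZ : a <= a * Z by rewrite ler_peMr// ltW.
have -> : 4 / a * (1 + kap ^+ 2 / a) * (q ^+ 4 * m ^+ 2) =
  (4 * (q ^+ 4 * m ^+ 2) + 4 * (kap ^+ 2 / a * (q ^+ 4 * m ^+ 2))) / a.
  by field; rewrite gt_eqF.
rewrite ler_pdivlMr//; move: s0 H q4 aZ; rewrite E.
have -> : a / 2 * Z = a * Z / 2 by ring.
rewrite [Z * a]mulrC.
move: (a * Z) (m ^+ 2 * q) (kap * (m * q ^+ 2)) (kap ^+ 2 / a * (q ^+ 4 * m ^+ 2)) (q ^+ 4 * m ^+ 2).
by move=> *; lra.
Qed.

End RealBounds.

(** * A homogeneous weight on a sector *)

Section Cone.
Variable R : realType.
Local Notation C := R[i].
Implicit Types (u v z : C) (r : R).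

(** For [u = gamma1] and [v = gamma1 - gamma2] it measures at once the size of [exp(gamma1 z)] and
    its dominance over [exp(gamma2 z)]; it vanishes off the sector where both hold. *)
Definition cone u v z : R :=
  Num.max 0 (Num.min (complex.Re (u * z)) (complex.Re (v * z))).

Lemma cone_ge0 u v z : 0 <= cone u v z. Proof. by rewrite le_max lexx. Qed.

Lemma cone_gt0 u v z : 0 < cone u v z ->
  cone u v z <= complex.Re (u * z) /\ cone u v z <= complex.Re (v * z).
Proof.
rewrite /cone; case: (leP 0 (Num.min _ _)) => _; last by rewrite ltxx.
by split; rewrite ge_min lexx ?orbT.
Qed.

Lemma cont_cone u v z : {for z, continuous (cone u v)}.
Proof.
have -> : cone u v = fun w => 2^-1 * (0 + 2^-1 * (complex.Re (u * w) + complex.Re (v * w) -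
    `|complex.Re (u * w) - complex.Re (v * w)|) +
    `|0 - 2^-1 * (complex.Re (u * w) + complex.Re (v * w) -
    `|complex.Re (u * w) - complex.Re (v * w)|)|).
  apply/funext => w; rewrite /cone maxr_absE minr_absE.
  by rewrite ![_ / 2]mulrC.
have cR c : {for z, continuous (fun w : C => complex.Re (c * w))}.
  by apply: contC_Re; apply: contC_M; [exact: contC_cst|exact: contC_id].
have cm : {for z, continuous (fun w => 2^-1 * (complex.Re (u * w) + complex.Re (v * w) -
    `|complex.Re (u * w) - complex.Re (v * w)|))}.
  apply: contR_M; first exact: contR_cst.
  apply: contR_B; first exact: contR_D.
  by apply: contR_norm; exact: contR_B.
apply: contR_M; first exact: contR_cst.
apply: contR_D; first by apply: contR_D; [exact: contR_cst|exact: cm].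
by apply: contR_norm; apply: contR_B; [exact: contR_cst|exact: cm].
Qed.

Lemma mean_cone u v r : 0 < r -> mean r (cone u v) = r * mean 1 (cone u v).
Proof.
move=> r0; rewrite -(meanZ ler01); last by move=> z _; exact: cont_cone.
congr (_ * _); apply: eq_RI => t _; rewrite /cone maxr_pMr ?ltW// mulr0 minr_pMr ?ltW//.
have E c : complex.Re (c * circ r t) = r * complex.Re (c * circ 1 t).
  have -> : circ r t = (r%:C)%C * circ 1 t by rewrite /circ mul1r.
  by rewrite mulrCA; move: (c * circ 1 t) => q; rewrite cReM /= mul0r subr0.
by rewrite !E.
Qed.

Lemma mean_cone_gt0 u v z : nc z = 1 -> 0 < complex.Re (u * z) ->
  0 < complex.Re (v * z) -> 0 < mean 1 (cone u v).
Proof.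
move=> /polar1[t t2 ->] ut vt; rewrite /mean mulr_gt0 ?invr_gt0 ?twopi_gt0//.
apply: (@RI_gt0 R 0 (2 * pi) t (fun t => cone u v (circ 1 t))) => //.
- exact: twopi_gt0.
- by apply: cont_circ_on ler01 _ => w _; exact: cont_cone.
- by move=> s _; exact: cone_ge0.
- by rewrite /circ mul1r lt_max lt_min ut vt orbT.
Qed.

End Cone.

(** * Functions invariant under small rotations *)

Section SmallRotation.
Variable R : realType.
Local Notation C := R[i].

Lemma small_rotation (d : R) : 0 < d ->
  exists2 t : R, 0 <= t & 0 < nc (expC (t *i)%C - 1 : C) < d.
Proof.
move=> d0; have /contRC/(_ d d0)[e e0 eP] := @circ_continuous R 1 0.
have p0 : 0 < pi :> R := pi_gt0 R.
pose t : R := Num.min (e / 2) (pi / 2).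
have t0 : 0 < t by rewrite lt_min !divr_gt0.
have te : t < e by rewrite gt_min ltr_pdivrMr// ltr_pMr// ltr1n.
have tp : t < pi by rewrite gt_min [pi / 2 < _]ltr_pdivrMr// ltr_pMr ?ltr1n ?orbT.
exists t; first exact: ltW.
have cE s : circ 1 s = expC (s *i)%C :> C by rewrite /circ mul1r.
apply/andP; split.
  rewrite nc_gt0 subr_eq0; apply/eqP => /(congr1 (@complex.Im R)).
  rewrite expCE /= expR0 mul1r => /eqP.
  by rewrite gt_eqF// sin_gt0_pi// t0.
by have := eP t; rewrite subr0 gtr0_norm// => /(_ te); rewrite circ0 cE.
Qed.

(** If [G'] did not vanish at some [z != 0], linear approximation would separate [G(om z)] from
    [G(z)] for a rotation [om != 1] close to 1. At the origin [G' = 0] by continuity. *)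
Lemma rotation_invariant_cst (G : C -> C) (d : R) : 0 < d -> ent G ->
  (forall t : R, 0 <= t -> nc (expC (t *i)%C - 1 : C) <= d ->
    forall z, G (expC (t *i)%C * z) = G z) ->
  forall z, G z = G 0.
Proof.
move=> d0 eG H; have G0 z : z != 0 -> derive1 G z = 0.
  move=> z0; have nz : 0 < nc z by rewrite nc_gt0.
  apply/eqP; apply: contraT => Gz; have nG : 0 < nc (derive1 G z) by rewrite nc_gt0.
  have /is_deriveCP/(_ (nc (derive1 G z) / 2)) := derivable_is_derive (eG z).
  rewrite divr_gt0// => /(_ isT)[e e0 eP].
  have [t t0 /andP[t1 t2]] : exists2 t : R, 0 <= t &
      0 < nc (expC (t *i)%C - 1 : C) < Num.min d (e / nc z).
    by apply: small_rotation; rewrite lt_min d0 divr_gt0.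
  move: t2; rewrite lt_min => /andP[td tz].
  have := eP ((expC (t *i)%C - 1) * z); rewrite ncM -ltr_pdivlMr// => /(_ tz).
  have -> : z + (expC (t *i)%C - 1) * z = expC (t *i)%C * z.
    by move: (expC _) => w; ring.
  rewrite (H t t0 (ltW td)) subrr sub0r ncN !ncM.
  rewrite ler_pM2r ?mulr_gt0// => h; move: nG; rewrite ltNge.
  by move: h; move: (nc _) => u; lra.
have dG : ent (derive1 G) := ent_derive1 eG.
have G00 : derive1 G 0 = 0.
  apply: (punctured_zero ltr01 (@ent_cont _ _ 0 dG)) => w _; exact: G0.
move=> z; apply: (@derive0_cst _ (nc z + 1)).
- exact: (ent_holD eG).
- by move=> w _; have [->|] := eqVneq w 0; [exact: G00|exact: G0].
- by rewrite ltrDl.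
Qed.

End SmallRotation.

(** * Consequences of the differential equation *)

Section Equation.
Variable R : realType.
Local Notation C := R[i].
Implicit Types (w z : C) (r : R).
Variables (f : C -> C) (k : nat) (a : 'I_k.+1 -> C -> C) (p1 p2 g1 g2 : C).
Hypotheses (ef : ent f) (f1n0 : exists z, derive1 f z != 0).
Hypothesis order_f : (growth_order f < +oo)%E.
Hypothesis SN : is_S f (fun r => nevanlinna_N r (fun z => (f z)^-1)).
Hypothesis small_a : forall j, small_function f (a j).
Hypothesis eqn : forall z, (forall j, holomorphic_at (a j) z) ->
  f z * derive1 f z + \sum_(j < k.+1) a j z * derive1n j f z
  = p1 * expC (g1 * z) + p2 * expC (g2 * z).
Hypotheses (p1n0 : p1 != 0) (p2n0 : p2 != 0) (g1n0 : g1 != 0) (g12 : g1 != g2).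
Hypothesis g21 : nc g2 <= nc g1.

Let F z := f z * derive1 f z.
Let b z := \sum_(j < k.+1) a j z * derive1n j f z.
Let x z := complex.Re (g1 * z).
Let y z := complex.Re (g2 * z).
Let P : R := nc p1 + nc p2.
Let kap : R := k.+1%:R.
Let D : R := 1 + P + kap.
Let S := cone g1 (g1 - g2).

Let P0 : 0 <= P. Proof. by rewrite addr_ge0 ?nc_ge0. Qed.
Let kap0 : 0 <= kap. Proof. exact: ler0n. Qed.
Let D0 : 0 < D.
Proof. rewrite /D -addrA; apply: ltr_pwDl; [exact: ltr01|exact: addr_ge0]. Qed.
Let D1 : 1 <= D. Proof. by rewrite /D -addrA lerDl addr_ge0. Qed.

Lemma Re_le_scaled c z r : nc z = r -> complex.Re (c * z) <= nc c * r.
Proof. by move=> <-; rewrite -ncM (le_trans (ler_norm _))// Re_le_nc. Qed.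

Section Pointwise.
Variables (r d : R) (Err : C -> R).
Hypothesis ct : controlled f a r d Err.

Let q1 z : nc z = r -> 1 <= expR (Err z).
Proof. by move=> zr; rewrite -expR0 ler_expR (ct_ge0 ct). Qed.

Lemma linear_part_bound z : nc z = r -> nc (b z) <= kap * (nc (f z) * expR (Err z) ^+ 2).
Proof.
move=> zr; apply: (le_trans (nc_sum _ _ _)).
apply: (@le_trans _ _ (\sum_(j < k.+1) nc (f z) * expR (Err z) ^+ 2)).
  apply: ler_sum => j _; rewrite ncM.
  have := ler_pM (nc_ge0 _) (nc_ge0 _) (ct_aj ct j zr) (ct_fj ct zr (ltn_ord j : (j <= k)%N)).
  by rewrite mulrCA -expr2.
by rewrite sumr_const card_ord /kap mulr_natl.
Qed.

Lemma F_le z : nc z = r -> nc (F z) <= nc (f z) ^+ 2 * expR (Err z).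
Proof.
by move=> zr; rewrite /F ncM expr2 -mulrA ler_wpM2l ?nc_ge0// (ct_log ct).
Qed.

Lemma F_ge z : nc z = r -> nc (f z) ^+ 2 <= nc (F z) * expR (Err z).
Proof.
by move=> zr; rewrite /F ncM expr2 -mulrA ler_wpM2l ?nc_ge0// (ct_invlog ct).
Qed.

Lemma F_eq z : nc z = r -> F z = p1 * expC (g1 * z) + p2 * expC (g2 * z) - b z.
Proof. by move=> zr; rewrite -(eqn (ct_a ct zr)) addrK. Qed.

Lemma f_sq_bound z X : nc z = r -> 0 <= X -> expR (x z) <= X -> expR (y z) <= X ->
  nc (f z) ^+ 2 <= expR (Err z) * (P * X + kap * (nc (f z) * expR (Err z) ^+ 2)).
Proof.
move=> zr X0 xX yX; apply: (le_trans (F_ge zr)); rewrite mulrC ler_wpM2l ?expR_ge0//.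
rewrite (F_eq zr) (le_trans (nc_sub_le _ _))// lerD ?linear_part_bound//.
rewrite (le_trans (ncD _ _))// mulrDl lerD// ncM nc_expC ler_wpM2l ?nc_ge0//.
Qed.

(** Since [f f'] has the size of [f^2] up to [exp Err], [f] is at most of the size of the square
    root of the right-hand side; hence the squares in the hypotheses. *)
Lemma f_bound z X : nc z = r -> 1 <= expR X -> expR (x z) <= expR X ^+ 2 ->
  expR (y z) <= expR X ^+ 2 -> nc (f z) <= D * expR (3 * Err z + X).
Proof.
move=> zr X1 xX yX; have := f_sq_bound zr (sqr_ge0 _) xX yX.
move=> /(quadratic_growth (nc_ge0 _) (q1 zr) X1 P0 kap0).
by rewrite expRD -expRM_natl.
Qed.

Lemma lnp_f_bound z : nc z = r ->
  lnp (nc (f z)) <= 3 * Err z + nc g1 * r + ln D.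
Proof.
move=> zr; have E0 := ct_ge0 ct zr.
have G0 : 0 <= nc g1 * r by rewrite mulr_ge0 ?nc_ge0// -zr nc_ge0.
apply: lnp_le; first by rewrite !addr_ge0 ?(mulr_ge0 _ E0) ?ln_ge0.
rewrite expRD lnK ?posrE ?D0// mulrC; apply: f_bound => //.
- by rewrite -expR0 ler_expR.
- rewrite -expRM_natl ler_expR (le_trans (Re_le_scaled _ zr))//.
  by rewrite ler_peMl// ler1n.
- rewrite -expRM_natl ler_expR (le_trans (Re_le_scaled _ zr))//.
  rewrite (le_trans (ler_wpM2r _ g21)) ?ler_peMl ?ler1n//.
  by rewrite -zr nc_ge0.
Qed.

(* On the sector where [p1 * expC (g1 * z)] dominates, [F] is this term up to a
   factor [1 + O(expR (- s / 2))]. *)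
Lemma remainder_bound z s : nc z = r -> 0 <= s -> s <= x z -> s <= x z - y z ->
  nc (F z - p1 * expC (g1 * z)) <= (nc p2 + kap * D) * expR (5 * Err z + x z - s / 2).
Proof.
move=> zr s0 sx sy; have E0 := ct_ge0 ct zr.
rewrite (F_eq zr) (_ : _ - _ = p2 * expC (g2 * z) - b z); last by ring.
rewrite (le_trans (nc_sub_le _ _))// mulrDl lerD//.
  rewrite ncM nc_expC ler_wpM2l ?nc_ge0// ler_expR -/(y z).
  by move: (x z) (y z) (Err z) sx sy E0 s0; move=> *; lra.
apply: (le_trans (linear_part_bound zr)); rewrite -mulrA ler_wpM2l//.
have x2 : expR (x z / 2) ^+ 2 = expR (x z).
  by rewrite -expRM_natl mulrC divfK// pnatr_eq0.
apply: (@le_trans _ _ (D * expR (3 * Err z + x z / 2) * expR (Err z) ^+ 2)).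
  rewrite ler_wpM2r ?exprn_ge0 ?expR_ge0//; apply: f_bound => //.
  - by rewrite -expR0 ler_expR divr_ge0// (le_trans s0).
  - by rewrite x2.
  - by rewrite x2 ler_expR -subr_ge0 (le_trans s0).
rewrite -expRM_natl -mulrA -expRD ler_wpM2l ?(ltW D0)// ler_expR.
by move: (x z) (Err z) sx E0; move=> *; lra.
Qed.

End Pointwise.

(** The equation bounds [ln+ |f|] by [3 Err + |g1| r + O(1)], so its mean bounds the characteristic
    linearly in [r]. This turns errors relative to [T(r, f)] into errors relative to [r]. *)
Lemma control_r : forall eta : R, 0 < eta -> exists2 eps : R, 0 < eps &
  forall (B : set R) (x0 : R), countable B ->
  exists r Err, [/\ x0 <= r, ~ B r, controlled f a r eps Err,
    mean r Err <= eta * r & mean r (fun z => ln (nc (f z))) <= eta * r].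
Proof.
move=> eta eta0; have [C0 C00 H] := control_T ef f1n0 order_f SN small_a.
(* With [eta' <= 1 / 6], three means of [Err] cost at most half of [T + 1], which is moved to the
   other side; [A * r] bounds what is left, for [r >= 1]. *)
pose A := 2 * (ln D + nc g1 + 3 * C0 + 1) + 1.
have A0 : 0 < A.
  by rewrite ltr_wpDl// mulr_ge0// !addr_ge0 ?nc_ge0 ?ln_ge0 ?mulr_ge0.
pose eta' := Num.min 6^-1 (eta / (2 * A)).
have e0 : 0 < eta' by rewrite lt_min invr_gt0 ltr0n divr_gt0// mulr_gt0.
have e6 : eta' <= 6^-1 by rewrite ge_min lexx.
have eA : eta' * A <= eta / 2.
  rewrite -ler_pdivlMr// -mulrA -invfM ge_min; apply/orP; right.
  by rewrite invfM.
have [eps eps0 He] := H _ e0; exists eps => // B x0 cB.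
have [r [Err [xr nB ct mE mf]]] := He B (Num.max x0 (2 * C0 / eta)) cB.
exists r, Err; have r1 := ct_r ct; have r0 : 0 < r := lt_le_trans ltr01 r1.
move: xr; rewrite ge_max => /andP[xr]; rewrite ler_pdivrMr// => Cr.
have T0 := nevanlinna_T_ent_ge0 ef r0.
have TA : nevanlinna_T r f + 1 <= A * r.
  have cE : cont_circ r (fun z => 3 * Err z).
    by move=> z zr; apply: contR_M; [exact: contR_cst|exact: (ct_cont ct)].
  have cEG : cont_circ r (fun z => 3 * Err z + nc g1 * r).
    by move=> z zr; apply: contR_D; [exact: cE|exact: contR_cst].
  have : nevanlinna_T r f <= 3 * mean r Err + nc g1 * r + ln D.
    rewrite nevanlinna_T_ent// -(meanZ (ltW r0)); last exact: (ct_cont ct).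
    rewrite -[nc g1 * r](@mean_cst R r) -[ln D](@mean_cst R r).
    rewrite -(meanD (ltW r0)); [|exact: cE|by move=> z _; exact: contR_cst].
    rewrite -(meanD (ltW r0)); [|exact: cEG|by move=> z _; exact: contR_cst].
    apply: (mean_le (ltW r0)).
    - by move=> z _; apply: cont_lnp_nc; exact: ent_cont.
    - by move=> z zr; apply: contR_D; [exact: cEG|exact: contR_cst].
    - by move=> z; exact: (lnp_f_bound ct).
  have eT : eta' * (nevanlinna_T r f + 1) <= 6^-1 * (nevanlinna_T r f + 1).
    by rewrite ler_wpM2r ?(addr_ge0 T0).
  have lD : ln D <= ln D * r by rewrite ler_peMr ?ln_ge0.
  have C0r : C0 <= C0 * r by rewrite ler_peMr.
  rewrite /A; move: mE eT lD C0r r1.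
  have -> : (2 * (ln D + nc g1 + 3 * C0 + 1) + 1) * r =
    2 * (ln D * r) + 2 * (nc g1 * r) + 6 * (C0 * r) + 3 * r by ring.
  move: (mean r Err) (nevanlinna_T r f) (eta' * (nevanlinna_T r f + 1)) (ln D) (nc g1 * r) (ln D * r) (C0 * r).
  by move=> *; lra.
have key : eta' * (nevanlinna_T r f + 1) + C0 <= eta * r.
  have h : eta' * (nevanlinna_T r f + 1) <= eta / 2 * r.
    by rewrite (le_trans (ler_wpM2l (ltW e0) TA))// mulrA ler_wpM2r ?(ltW r0).
  move: h Cr; have -> : eta / 2 * r = eta * r / 2 by ring.
  rewrite [r * eta]mulrC; move: (eta * r) (eta' * (nevanlinna_T r f + 1)).
  by move=> *; lra.
split => //; first exact: le_trans mE key.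
exact: le_trans mf key.
Qed.

Lemma Re_rotation c om z r d : nc c <= nc g1 -> nc (om - 1) <= d -> nc z = r ->
  `|complex.Re (c * (om * z)) - complex.Re (c * z)| <= nc g1 * d * r.
Proof.
move=> cg od zr; have -> : complex.Re (c * (om * z)) - complex.Re (c * z) =
    complex.Re (c * ((om - 1) * z)).
  by rewrite -cReN -cReD; congr complex.Re; ring.
rewrite (le_trans (Re_le_nc _))// ncM -mulrA ler_pM ?nc_ge0// ncM zr.
by rewrite ler_wpM2r// -zr nc_ge0.
Qed.

Let K om z := F (om * z) * expC (g1 * z) - F z * expC (g1 * (om * z)).
Let Q := nc p2 + kap * D.
(** When [x z - y z] exceeds [D2], the second exponential term is at most half of the first. [D3] is
    the constant of [dominant_term], and [D4] serves both on and off the sector. *)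
Let D2 := lnp (2 * nc p2 / nc p1).
Let D3 := 4 / nc p1 * (1 + kap ^+ 2 / nc p1).
Let D4 := lnp (2 * Q * D3) + lnp 2 + D2 / 2.

Section Rotation.
Variables (r d : R) (Err : C -> R) (om z : C).
Hypothesis ct : controlled f a r d Err.
Hypotheses (om1 : nc om = 1) (omd : nc (om - 1) <= d) (zr : nc z = r).

Let G := nc g1 * d * r.

Let ozr : nc (om * z) = r. Proof. by rewrite ncM om1 mul1r. Qed.

Let G0 : 0 <= G.
Proof. by rewrite !mulr_ge0 ?nc_ge0 ?(le_trans (nc_ge0 _) omd)// -zr nc_ge0. Qed.

Let xG : `|x (om * z) - x z| <= G. Proof. exact: Re_rotation. Qed.

Let yG : `|y (om * z) - y z| <= G. Proof. exact: Re_rotation. Qed.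

(** Both products are bounded separately, with [ct_near] bringing [f(om z)] back to [f(z)]. As the
    weight is at most [D2 + 2 * G] here, the factor [exp(- S z / 2)] may be inserted at the cost of
    [D2 / 2 + G]. *)
Lemma rotation_bound_off : S z <= D2 + 2 * G -> nc (K om z) <= nc (f z) ^+ 2 *
  expR (x z + D4 + 9 * Err z + 5 * Err (om * z) + 2 * G - S z / 2).
Proof.
move=> Sz; have [E0 E0'] := (ct_ge0 ct zr, ct_ge0 ct ozr).
have fom : nc (f (om * z)) <= nc (f z) * expR (Err z).
  apply: (ct_near ct) => //; rewrite (_ : om * z - z = (om - 1) * z); last by ring.
  by rewrite ncM zr ler_wpM2r// -zr nc_ge0.
have m0 : 0 <= nc (f z) ^+ 2 by rewrite sqr_ge0.
have b1 : nc (F (om * z) * expC (g1 * z)) <=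
    nc (f z) ^+ 2 * expR (2 * Err z + Err (om * z) + x z + G).
  rewrite ncM nc_expC -/(x z).
  rewrite (le_trans (ler_wpM2r (expR_ge0 _) (F_le ct ozr)))//.
  apply: (@le_trans _ _ ((nc (f z) * expR (Err z)) ^+ 2 * expR (Err (om * z)) * expR (x z))).
    rewrite ler_wpM2r ?expR_ge0// ler_wpM2r ?expR_ge0//.
    by apply: lerXn2r; rewrite ?nnegrE ?mulr_ge0 ?nc_ge0 ?expR_ge0.
  rewrite exprMn -expRM_natl; move: (nc (f z) ^+ 2) m0 => m m0.
  rewrite -!mulrA -!expRD ler_wpM2l// ler_expR.
  by rewrite !addrA lerDl.
have b2 : nc (F z * expC (g1 * (om * z))) <=
    nc (f z) ^+ 2 * expR (2 * Err z + Err (om * z) + x z + G).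
  rewrite ncM nc_expC -/(x (om * z)).
  rewrite (le_trans (ler_wpM2r (expR_ge0 _) (F_le ct zr)))//.
  rewrite -mulrA -expRD ler_wpM2l// ler_expR.
  move: (xG) E0 E0'; rewrite ler_norml => /andP[_].
  by move: (x (om * z)) (x z) (Err z) (Err (om * z)) G; move=> *; lra.
rewrite (le_trans (nc_sub_le _ _))// (le_trans (lerD b1 b2))//.
rewrite -mulrDr ler_wpM2l// -mulr2n -[leLHS]mulr_natl.
rewrite (le_trans (ler_wpM2r (expR_ge0 _) (le_exp_lnp 2)))// -expRD ler_expR.
have l0 := lnp_ge0 (2 * Q * D3); move: Sz G0 E0 E0' l0; rewrite /D4.
move: (x z) (S z) (Err z) (Err (om * z)) G (lnp (2 * Q * D3)) (lnp 2) D2.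
by move=> *; lra.
Qed.

(** In [K] the main parts [p1 exp(g1 om z) exp(g1 z)] cancel, which leaves the remainders
    [F - p1 exp(g1 z)] times exponentials, of size [exp(2 x - S / 2)] up to errors. One factor
    [exp(x)] is then traded for [|f|^2]. *)
Lemma rotation_bound_on : D2 + 2 * G < S z -> nc (K om z) <= nc (f z) ^+ 2 *
  expR (x z + D4 + 9 * Err z + 5 * Err (om * z) + 2 * G - S z / 2).
Proof.
move=> Sz; have [E0 E0'] := (ct_ge0 ct zr, ct_ge0 ct ozr).
have D20 : 0 <= D2 by exact: lnp_ge0.
have S0 : 0 < S z by rewrite (le_lt_trans _ Sz)// addr_ge0// mulr_ge0.
have [Sx Sxy] := cone_gt0 S0; rewrite mulrBl cReD cReN -/(x z) -/(y z) in Sx Sxy.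
(* The rotation moves [x] and [y] by at most [G] each, so [s] is a lower bound for [x] and [x - y]
   at both points. *)
pose s := S z - 2 * G.
have s2 : D2 <= s by rewrite lerBrDr ltW.
have s0 : 0 <= s by rewrite (le_trans D20).
have := xG; have := yG; rewrite !ler_norml => /andP[y1 y2] /andP[x1 x2].
have [sx [sxy [sx' sxy']]] : s <= x z /\ (s <= x z - y z /\ (s <= x (om * z) /\
    s <= x (om * z) - y (om * z))).
  move: Sx Sxy y1 y2 x1 x2 (G0); rewrite /s /S.
  move: (x z) (y z) (x (om * z)) (y (om * z)) G (cone _ _ z).
  by move=> *; repeat split; lra.
have r1 := remainder_bound ct zr s0 sx sxy.
have r2 := remainder_bound ct ozr s0 sx' sxy'.
have Q0 : 0 <= Q by rewrite addr_ge0 ?nc_ge0// mulr_ge0// ltW.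
have arith1 (u v e e' g t : R) : v - u <= g -> 0 <= e ->
  5 * e' + v - t + u <= 5 * e + 5 * e' + 2 * u + g - t by lra.
have arith2 (u v e e' g t : R) : v - u <= g -> 0 <= e' ->
  5 * e + u - t + v <= 5 * e + 5 * e' + 2 * u + g - t by lra.
have b1 : nc (K om z) <= 2 * Q * expR (5 * Err z + 5 * Err (om * z) + 2 * x z + G - s / 2).
  have -> : K om z = (F (om * z) - p1 * expC (g1 * (om * z))) * expC (g1 * z) -
    (F z - p1 * expC (g1 * z)) * expC (g1 * (om * z)) by
    rewrite /K; move: (F _) (F z) (expC _) (expC _) => u v e1 e2; ring.
  rewrite (le_trans (nc_sub_le _ _))// ![nc (_ * expC _)]ncM !nc_expC -/(x z) -/(x (om * z)).
  rewrite (le_trans (lerD (ler_wpM2r (expR_ge0 _) r2) (ler_wpM2r (expR_ge0 _) r1)))//.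
  rewrite -!mulrA -!expRD -mulrDr mulrCA ler_wpM2l// [leRHS]mulr_natl mulr2n lerD//.
    by rewrite ler_expR; exact: arith1.
  by rewrite ler_expR; exact: arith2.
have p10 : 0 < nc p1 by rewrite nc_gt0.
(* Since [s >= D2], the [p2] term is at most half of the [p1] term, as [dominant_term] requires. *)
have ex : expR (x z) <= D3 * (expR (Err z) ^+ 4 * nc (f z) ^+ 2).
  apply: dominant_term => //.
  - by rewrite -expR0 ler_expR (le_trans s0).
  - by rewrite -expR0 ler_expR.
  have -> : nc p1 * expR (x z) = nc (F z - (p2 * expC (g2 * z) - b z)).
    rewrite -nc_expC -ncM (F_eq ct zr); congr nc.
    by move: (p1 * _) (p2 * _) (b z) => u v t; ring.
  rewrite (le_trans (nc_sub_le _ _))// -addrA lerD ?(F_le ct zr)//.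
  rewrite (le_trans (nc_sub_le _ _))// lerD ?(linear_part_bound ct)//.
  rewrite ncM nc_expC -/(y z).
  have : 2 * nc p2 / nc p1 <= expR (x z - y z).
    rewrite (le_trans (le_exp_lnp _))// ler_expR (le_trans s2)//.
  rewrite ler_pdivrMr// expRD expRN => h.
  rewrite -(ler_pM2l (ltr0n R 2)) // mulrA (le_trans (ler_wpM2r (expR_ge0 _) h))//.
  rewrite le_eqVlt; apply/orP; left; apply/eqP; field; rewrite gt_eqF//.
  exact: expR_gt0.
apply: (le_trans b1).
rewrite (_ : _ + G - s / 2 = x z + (5 * Err z + 5 * Err (om * z) + x z + G - s / 2)); last by ring.
rewrite expRD mulrCA.
rewrite (le_trans (ler_wpM2r _ ex)) ?mulr_ge0 ?expR_ge0//.
rewrite -expRM_natl; set W := _ - s / 2; set m := nc (f z) ^+ 2.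
apply: (@le_trans _ _ (m * (2 * Q * D3 * expR (4 * Err z + W)))).
  rewrite (expRD (4 * Err z) W) le_eqVlt; apply/orP; left; apply/eqP.
  by move: m (expR (4 * Err z)) (expR W) Q D3 => *; ring.
rewrite ler_wpM2l ?sqr_ge0// (le_trans (ler_wpM2r (expR_ge0 _) (le_exp_lnp _)))//.
rewrite -expRD ler_expR /W /s /D4.
have l0 := lnp_ge0 (2 : R); move: D20 l0 E0 E0'.
move: (x z) (S z) (Err z) (Err (om * z)) G (lnp (2 * Q * D3)) (lnp 2) D2.
by move=> *; lra.
Qed.

Lemma rotation_bound : K om z != 0 -> ln (nc (K om z)) <= 2 * ln (nc (f z)) +
  x z + 9 * Err z + 5 * Err (om * z) + (D4 + 2 * G) - 2^-1 * S z.
Proof.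
move=> K0; have fz : 0 < nc (f z) by rewrite nc_gt0 (ct_f ct).
rewrite -ler_expR lnK ?posrE ?nc_gt0//.
have [Sz|Sz] := leP (S z) (D2 + 2 * G).
  apply: (le_trans (rotation_bound_off Sz)).
  rewrite -{1}(lnK fz) -expRM_natl -expRD ler_expR le_eqVlt; apply/orP; left; apply/eqP; ring.
apply: (le_trans (rotation_bound_on Sz)).
rewrite -{1}(lnK fz) -expRM_natl -expRD ler_expR le_eqVlt; apply/orP; left; apply/eqP; ring.
Qed.

End Rotation.

Lemma controlled_le r d eps Err : d <= eps -> controlled f a r eps Err -> controlled f a r d Err.
Proof.
move=> de [r1 fr f1r ar cE E0 aE jE lE iE nE]; split => // z w zr wz.
by apply: nE => //; rewrite (le_trans wz)// ler_wpM2r// (le_trans ler01).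
Qed.

(** In the direction [conjc g1] both linear forms have positive real part: expanding
    [|g1 - g2|^2 > 0] with [|g2| <= |g1|] gives [Re(g2 conjc g1) < |g1|^2]. *)
Lemma S_mean_gt0 : 0 < mean 1 S.
Proof.
have n0 : 0 < nc g1 by rewrite nc_gt0.
have R1 c : complex.Re (c * (conjc g1 * ((nc g1)^-1)%:C%C)) =
    complex.Re (c * conjc g1) / nc g1.
  by rewrite mulrA; move: (c * _) => w; rewrite cReM /= mulr0 subr0.
have R2 : complex.Re (g1 * conjc g1) = nc g1 ^+ 2 by rewrite mul_conj.
apply: (@mean_cone_gt0 _ _ _ (conjc g1 * ((nc g1)^-1)%:C%C)).
- by rewrite ncM nc_conj nc_pos ?invr_ge0 ?(ltW n0)// divff// gt_eqF.
- by rewrite R1 divr_gt0// R2 exprn_gt0.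
rewrite R1 divr_gt0// mulrBl cReD cReN R2 subr_gt0.
have d0 : 0 < nc (g1 - g2) ^+ 2 by rewrite exprn_gt0// nc_gt0 subr_eq0.
have dE : nc (g1 - g2) ^+ 2 = nc g1 ^+ 2 + nc g2 ^+ 2 - 2 * complex.Re (g2 * conjc g1).
  have sq (w : C) : nc w ^+ 2 = complex.Re w ^+ 2 + complex.Im w ^+ 2.
    by case: w => u v /=; rewrite sqr_sqrtr// addr_ge0 ?sqr_ge0.
  by rewrite !sq; case: (g1) (g2) => [u1 v1] [u2 v2] /=; ring.
have g22 : nc g2 ^+ 2 <= nc g1 ^+ 2 by apply: lerXn2r; rewrite ?nnegrE ?nc_ge0.
by move: d0 g22; rewrite dE; move: (complex.Re _) (nc g1 ^+ 2) (nc g2 ^+ 2) => *; lra.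
Qed.

Lemma ent_F : ent F. Proof. by apply: entM; [exact: ef|exact: (ent_derive1 ef)]. Qed.

Lemma ent_K om : ent (K om).
Proof.
apply: entB; apply: entM.
- by apply: (@ent_comp _ (fun z => om * z) F); [exact: ent_scale|exact: ent_F].
- exact: ent_expCM.
- exact: ent_F.
- apply: (@ent_comp _ (fun z => om * z) (fun z => expC (g1 * z))).
    exact: ent_scale.
  exact: ent_expCM.
Qed.

(** Jensen's formula bounds the mean of [ln |K|] below by a constant, while [rotation_bound] gives
    at most [D4 - m0 * r / 4]; these are incompatible for large [r]. *)
Theorem rotation_eq0 : exists2 d : R, 0 < d & forall t : R, 0 <= t ->
  nc (expC (t *i)%C - 1) <= d -> forall z, K (expC (t *i)%C) z = 0.
Proof.
have m00 := S_mean_gt0; set m0 := mean 1 S in m00.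
(* The weights 2, 9 and 5 of the means of [ln |f|] and [Err] sum to 16, costing [m0 * r / 8]; the
   displacement [2 * G] costs another [m0 * r / 8]. Together they use half of the gain
   [m0 * r / 2]. *)
have eta0 : 0 < m0 / 128 by rewrite divr_gt0.
have [eps eps0 H] := control_r eta0.
have n0 : 0 < nc g1 by rewrite nc_gt0.
exists (Num.min eps (m0 / (16 * nc g1))).
  by rewrite lt_min eps0 divr_gt0// mulr_gt0.
set d := Num.min _ _ => t t0 td; set om := expC _ in td *.
have om1 : nc om = 1 by rewrite nc_expC /= expR0.
have de : d <= eps by rewrite ge_min lexx.
have d16 : nc g1 * d <= m0 / 16.
  rewrite mulrC -ler_pdivlMr// -mulrA -invfM ge_min; apply/orP; right.
  by rewrite lexx.
move=> z0; apply/eqP; apply: contrapT => /negP Kz0.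
have Kn0 : exists z, K om z != 0 by exists z0.
have [cK JK] := jensen (@ent_K om) Kn0.
(* The circle also avoids the zeros of [K om], so that [ln |K|] is continuous on it. *)
have [r [Err [xr nB /(controlled_le de) ct mE mf]]] := H
  [set r | exists2 z, nc z = r & K om z = 0] (4 * (D4 - cK) / m0 + 1)
  (isolated_radii (zeros_isolated (@ent_K om) Kn0)).
have r1 := ct_r ct; have r0 : 0 < r := lt_le_trans ltr01 r1.
have Kr z : nc z = r -> K om z != 0.
  by move=> zr; apply/eqP => Kz; apply: nB; exists z.
have := JK r r0 Kr; have NK := N_inv_ge0 (@ent_K om) Kn0 r1 => JKr.
have cEo : cont_circ r (fun z => Err (om * z)).
  move=> z zr; apply: (@continuous_comp _ _ _ (fun w : C => om * w) Err).
    by apply: contC_M; [exact: contC_cst|exact: contC_id].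
  by apply: (ct_cont ct); rewrite ncM om1 mul1r.
have cl : cont_circ r (fun z => ln (nc (f z))).
  by move=> z zr; apply: cont_ln_nc; [exact: (ct_f ct)|exact: ent_cont].
have c1 : cont_circ r (fun z => 2 * ln (nc (f z))).
  by move=> z zr; apply: contR_M; [exact: contR_cst|exact: cl].
have cx : cont_circ r x.
  by move=> z zr; apply: contC_Re; apply: contC_M; [exact: contC_cst|exact: contC_id].
have c2 : cont_circ r (fun z => 2 * ln (nc (f z)) + x z).
  by move=> z zr; apply: contR_D; [exact: c1|exact: cx].
have cE9 : cont_circ r (fun z => 9 * Err z).
  by move=> z zr; apply: contR_M; [exact: contR_cst|exact: (ct_cont ct)].
have cE5 : cont_circ r (fun z => 5 * Err (om * z)).
  by move=> z zr; apply: contR_M; [exact: contR_cst|exact: cEo].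
have c3 : cont_circ r (fun z => 2 * ln (nc (f z)) + x z + 9 * Err z).
  by move=> z zr; apply: contR_D; [exact: c2|exact: cE9].
have c4 : cont_circ r (fun z => 2 * ln (nc (f z)) + x z + 9 * Err z + 5 * Err (om * z)).
  by move=> z zr; apply: contR_D; [exact: c3|exact: cE5].
have cc (q : R) : cont_circ r (fun=> q) by move=> z _; exact: contR_cst.
pose q := D4 + 2 * (nc g1 * d * r).
have c5 : cont_circ r (fun z => 2 * ln (nc (f z)) + x z + 9 * Err z + 5 * Err (om * z) + q).
  by move=> z zr; apply: contR_D; [exact: c4|exact: cc].
have cS : cont_circ r S by move=> z _; exact: cont_cone.
have cS2 : cont_circ r (fun z => 2^-1 * S z).
  by move=> z zr; apply: contR_M; [exact: contR_cst|exact: cS].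
have : mean r (fun z => ln (nc (K om z))) <= mean r (fun z => 2 * ln (nc (f z)) + x z +
    9 * Err z + 5 * Err (om * z) + q - 2^-1 * S z).
  apply: (mean_le (ltW r0)).
  - by move=> z zr; apply: cont_ln_nc; [exact: Kr|exact: ent_cont (@ent_K om)].
  - by move=> z zr; apply: contR_B; [exact: c5|exact: cS2].
  - by move=> z zr; apply: (rotation_bound ct om1 td zr); exact: Kr.
rewrite JKr (meanB (ltW r0) c5 cS2) (meanD (ltW r0) c4 (cc q)) (meanD (ltW r0) c3 cE5).
rewrite (meanD (ltW r0) c2 cE9) (meanD (ltW r0) c1 cx) (meanZ (ltW r0) _ cl).
rewrite (mean_Re_linear g1 r0) mean_cst (meanZ (ltW r0) _ (ct_cont ct)) (meanZ (ltW r0) _ cEo).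
rewrite (meanZ (ltW r0) _ cS) (mean_rotation (ltW r0) t0 (ct_cont ct)) (mean_cone _ _ r0).
rewrite -/S -/m0 /q.
have Gr : nc g1 * d * r <= m0 / 16 * r by rewrite ler_wpM2r// ltW.
have : 4 * (D4 - cK) + m0 <= m0 * r.
  have := ler_wpM2r (ltW m00) xr; move: (D4 - cK) => u.
  by rewrite [(_ + 1) * m0]mulrDl divfK ?(gt_eqF m00)// mul1r [r * m0]mulrC.
move: NK mE mf Gr.
have -> : m0 / 128 * r = m0 * r / 128 by ring.
have -> : m0 / 16 * r = m0 * r / 16 by ring.
rewrite [r * m0]mulrC.
move: (mean r Err) (mean r (fun z => ln (nc (f z)))) (nc g1 * d * r) (m0 * r)
  (nevanlinna_N r _) D4.
by move=> *; lra.
Qed.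

Lemma F_exp : exists2 c : C, c != 0 & forall z, F z = c * expC (g1 * z).
Proof.
have [d d0 H] := rotation_eq0.
pose G z := F z * expC (- g1 * z).
have eG : ent G by apply: entM; [exact: ent_F|exact: ent_expCM].
have FG z : F z = G z * expC (g1 * z).
  by rewrite /G -mulrA -expCD mulNr addNr expC0 mulr1.
have GF : forall z, G z = G 0.
  apply: (rotation_invariant_cst d0 eG) => t t0 td z.
  have /eqP := H t t0 td z; rewrite /K subr_eq0 !FG => /eqP E.
  apply: (mulIf (expC_neq0 (g1 * (expC (t *i)%C * z)))).
  by apply: (mulIf (expC_neq0 (g1 * z))); rewrite E mulrAC.
exists (G 0); last by move=> z; rewrite FG GF.
(* On one controlled circle neither [f] nor [f'] vanishes, hence the constant is nonzero. *)
have [eps eps0 /(_ set0 0 (countable0 _))[r [Err [_ _ ct _ _]]]] := control_r (ltr01 : 0 < 1 :> R).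
have rr : nc (r%:C)%C = r by rewrite nc_pos// (le_trans ler01 (ct_r ct)).
rewrite -(GF (r%:C)%C) /G mulf_neq0 ?expC_neq0// mulf_neq0//.
  exact: (ct_f ct rr).
exact: (ct_f1 ct rr).
Qed.

(* The conclusion is the excluded ratio: in every other case the equation,
   divided by its dominant exponential, bounds a [cone] by [Err]. *)
Lemma half_exponent_of_eqn : g2 = g1 / 2.
Proof.
have [c c0 Fc] := F_exp.
have ef1 := ent_derive1 ef.
pose h z := f z * f z - (2 * c / g1) * expC (g1 * z).
have dh z : is_derive z 1 h 0.
  have df := derivable_is_derive (@ef z).
  have H := is_deriveCB (is_deriveCM df df) (is_deriveCZ (2 * c / g1) (is_derive_expCM g1 z)).
  apply: is_deriveC_eq H.
  have -> : 2 * c / g1 * (g1 * expC (g1 * z)) = 2 * (c * expC (g1 * z)).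
    by move: (expC _) => w; field.
  by rewrite -Fc /F; ring.
have h0 z : h z = h 0.
  apply: (@derive0_cst _ (nc z + 1)).
  - by apply: ent_holD; apply: ent_is_derive => w; exists 0; exact: dh.
  - by move=> w _; exact: derive1_is_derive (dh w).
  - by rewrite ltrDl.
have F0 z : f z != 0.
  have : F z != 0 by rewrite Fc mulf_neq0// expC_neq0.
  by rewrite /F mulf_eq0 negb_or => /andP[].
(* [f] has no zeros, because [F] has none. A nonzero constant [h 0] would make [f] vanish where the
   exponential takes the value [- h 0 * g1 / (2 * c)]. *)
have h00 : h 0 = 0.
  apply/eqP; apply: contraT => hn0.
  have [u uE] : exists u, expC u = - h 0 * g1 / (2 * c).
    by apply: expC_surj; rewrite !mulf_neq0 ?oppr_eq0// invr_eq0 mulf_neq0// pnatr_eq0.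
  have := h0 (u / g1); rewrite {1}/h (_ : g1 * (u / g1) = u) ?uE => [E|]; last by rewrite mulrC divfK.
  have : f (u / g1) * f (u / g1) = 0.
    move: E => /(canRL (subrK _)) ->; move: (h 0) => v; field.
    by rewrite g1n0 c0.
  by move/eqP; rewrite mulf_eq0 orbb (negbTE (F0 _)).
have fsq z : f z * f z = (2 * c / g1) * expC (g1 * z).
  by apply/eqP; rewrite -subr_eq0 -/(h z) h0 h00.
have f1 z : derive1 f z = g1 / 2 * f z.
  apply: (mulfI (F0 z)); transitivity (g1 / 2 * (f z * f z)); last by ring.
  rewrite fsq -[LHS]/(F z) Fc.
  by move: (expC _) => w; field.
have fn j z : derive1n j f z = (g1 / 2) ^+ j * f z.
  elim: j z => [|j IH] z; first by rewrite expr0 mul1r.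
  rewrite derive1nS (_ : derive1n j f = fun w => (g1 / 2) ^+ j * f w); last exact/funext.
  rewrite (derive1_is_derive (is_deriveCZ _ (derivable_is_derive (@ef z)))) f1.
  by rewrite exprSr mulrA.
pose e z := expR (x z / 2).
pose A : R := Num.sqrt (nc (2 * c / g1)).
have A0 : 0 <= A by exact: sqrtr_ge0.
have fe z : nc (f z) = A * e z.
  have : nc (f z) ^+ 2 = (A * e z) ^+ 2.
    rewrite -ncX expr2 fsq ncM nc_expC exprMn sqr_sqrtr ?nc_ge0// /e -expRM_natl.
    by congr (_ * expR _); rewrite -/(x z); move: (x z) => u; field.
  move=> /eqP; rewrite eqrXn2 ?nc_ge0 ?mulr_ge0 ?expR_ge0// => /eqP.
  by [].
pose M := \sum_(j < k.+1) nc (g1 / 2) ^+ j.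
have M0 : 0 <= M by apply: sumr_ge0 => j _; rewrite exprn_ge0// nc_ge0.
have bM r d Err z : controlled f a r d Err -> nc z = r ->
    nc (b z) <= M * A * expR (Err z + x z / 2).
  move=> ct zr; apply: (le_trans (nc_sum _ _ _)).
  rewrite -mulrA mulr_suml; apply: ler_sum => j _.
  rewrite fn ncM (ncM (_ ^+ j)) ncX fe mulrCA ler_wpM2l ?exprn_ge0 ?nc_ge0//.
  rewrite expRD mulrCA ler_wpM2l// ler_wpM2r ?expR_ge0//.
  exact: (ct_aj ct).
have E r d Err z : controlled f a r d Err -> nc z = r ->
    (p1 - c) * expC (g1 * z) + p2 * expC (g2 * z) = b z.
  move=> ct zr; have := F_eq ct zr; rewrite Fc => E.
  rewrite mulrBl; move: (p1 * _) (p2 * _) (b z) (c * _) E => u v w q ->; ring.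
(* Each alternative leaves an exponential in [(p1 - c) exp(g1 z) + p2 exp(g2 z) = b(z)] that is too
   large on some sector, as [b] has only the size of [exp(g1 z / 2)] up to [exp Err]. *)
suff : p1 - c != 0 \/ g2 != g1 / 2 -> False.
  by move=> H; apply/eqP; apply: contraT => g2n; exfalso; apply: H; right.
move=> cases.
have [u [v [B [m0 B0 HB]]]] : exists u v (B : R), [/\ 0 < mean 1 (cone u v), 0 <= B &
    forall r d Err z, controlled f a r d Err -> nc z = r ->
    cone u v z <= 2 * Err z + B].
  (* If [p1 = c], the sector is the half-plane where [exp(g2 z)] exceeds [exp(g1 z / 2)]; otherwise
     it is the sector of [S], where [exp(g1 z)] dominates. *)
  have [pc|pc] := eqVneq (p1 - c) 0.
    have gh : g2 - g1 / 2 != 0.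
      by rewrite subr_eq0; case: cases => //; rewrite pc eqxx.
    exists (g2 - g1 / 2), (g2 - g1 / 2), (lnp (M * A / nc p2)); split.
    - have n0 : 0 < nc (g2 - g1 / 2) by rewrite nc_gt0.
      have R0 : 0 < complex.Re ((g2 - g1 / 2) *
          (conjc (g2 - g1 / 2) * ((nc (g2 - g1 / 2))^-1)%:C%C)).
        rewrite mulrA mul_conj cReM /= mul0r subr0.
        by rewrite mulr_gt0 ?exprn_gt0 ?invr_gt0.
      apply: (mean_cone_gt0 _ R0 R0).
      by rewrite ncM nc_conj nc_pos ?invr_ge0 ?(ltW n0)// divff// gt_eqF.
    - exact: lnp_ge0.
    move=> r d Err z ct zr; have E0 := ct_ge0 ct zr.
    have [C0|C0] := ltP 0 (cone (g2 - g1 / 2) (g2 - g1 / 2) z); last first.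
      by rewrite (le_trans C0)// addr_ge0 ?mulr_ge0// lnp_ge0.
    have [h1 _] := cone_gt0 C0; apply: (le_trans h1).
    have -> : complex.Re ((g2 - g1 / 2) * z) = y z - x z / 2.
      rewrite mulrBl cReD cReN; congr (_ - _).
      have -> : g1 / 2 * z = (g1 * z) * (2^-1)%:C%C.
        by rewrite mulrAC; congr (_ * _); rewrite fmorphV rmorph_nat.
      by rewrite cReM /= mulr0 subr0.
    have p20 : 0 < nc p2 by rewrite nc_gt0.
    have := bM _ _ _ _ ct zr; rewrite -(E _ _ _ _ ct zr) pc mul0r add0r ncM nc_expC -/(y z).
    rewrite mulrC -ler_pdivlMr// mulrAC => /le_trans/(_ (ler_wpM2r (expR_ge0 _) (le_exp_lnp _))).
    rewrite -expRD ler_expR.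
    by move: (y z) (x z) (Err z) (lnp _) E0 => *; lra.
  exists g1, (g1 - g2), (2 * lnp ((nc p2 + M * A) / nc (p1 - c))); split.
  - exact: S_mean_gt0.
  - by rewrite mulr_ge0// lnp_ge0.
  move=> r d Err z ct zr; have E0 := ct_ge0 ct zr.
  have [C0|C0] := ltP 0 (cone g1 (g1 - g2) z); last first.
    by rewrite (le_trans C0)// addr_ge0 ?mulr_ge0// lnp_ge0.
  have [Sx Sxy] := cone_gt0 C0; rewrite mulrBl cReD cReN -/(x z) -/(y z) in Sx Sxy.
  move: C0 Sx Sxy; set s := cone _ _ z => s0 Sx Sxy.
  have pc0 : 0 < nc (p1 - c) by rewrite nc_gt0.
  have : nc (p1 - c) * expR (x z) <= (nc p2 + M * A) * expR (Err z + x z - s / 2).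
    have -> : nc (p1 - c) * expR (x z) = nc (b z - p2 * expC (g2 * z)).
      by rewrite -nc_expC -ncM -(E _ _ _ _ ct zr) addrK.
    rewrite (le_trans (nc_sub_le _ _))// addrC mulrDl lerD//.
      rewrite ncM nc_expC -/(y z) ler_wpM2l ?nc_ge0// ler_expR.
      by move: (x z) (y z) (Err z) s s0 E0 Sx Sxy => *; lra.
    rewrite (le_trans (bM _ _ _ _ ct zr))// ler_wpM2l ?mulr_ge0// ler_expR.
    by move: (x z) (y z) (Err z) s s0 E0 Sx Sxy => *; lra.
  rewrite mulrC -ler_pdivlMr// mulrAC => /le_trans/(_ (ler_wpM2r (expR_ge0 _) (le_exp_lnp _))).
  rewrite -expRD ler_expR.
  by move: (x z) (y z) (Err z) (lnp _) s s0 E0 Sx Sxy => *; lra.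
set m := mean 1 _ in m0.
(* Taking means yields [m * r <= m * r / 2 + B], against [m * r >= 2 * B + m]. *)
have eta0 : 0 < m / 4 by rewrite divr_gt0.
have [eps _ /(_ set0 (2 * B / m + 1) (countable0 _))[r [Err [xr _ ct mE _]]]] := control_r eta0.
have r0 : 0 < r := lt_le_trans ltr01 (ct_r ct).
have cE : cont_circ r (fun z => 2 * Err z).
  by move=> z zr; apply: contR_M; [exact: contR_cst|exact: (ct_cont ct)].
have cB : cont_circ r (fun=> B) by move=> z _; exact: contR_cst.
have : mean r (cone u v) <= mean r (fun z => 2 * Err z + B).
  apply: (mean_le (ltW r0)) => [z _|z zr|z zr].
  - exact: cont_cone.
  - by apply: contR_D; [exact: cE|exact: cB].
  - exact: HB ct zr.
rewrite (meanD (ltW r0) cE cB) (meanZ (ltW r0) _ (ct_cont ct)) mean_cst (mean_cone _ _ r0) -/m.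
have : 2 * B + m <= m * r.
  have := ler_wpM2r (ltW m0) xr.
  by rewrite [(_ + 1) * m]mulrDl divfK ?(gt_eqF m0)// mul1r [r * m]mulrC.
move: mE; rewrite [r * m]mulrC.
have -> : m / 4 * r = m * r / 4 by ring.
move=> h1 h2 h3.
suff m00 : m <= 0 by move: m0; rewrite ltNge m00.
by move: h1 h2 h3; move: (m * r) (mean r Err) => *; lra.
Qed.

End Equation.

Unset Implicit Arguments.
Set Strict Implicit.
Set Printing Implicit Defensive.

Theorem theorem5 (R : realType) (p1 p2 gamma1 gamma2 : R[i])
  (hp1 : p1 != 0) (hp2 : p2 != 0) (hg1 : gamma1 != 0) (hg2 : gamma2 != 0)
  (hg12 : gamma1 != gamma2) (hratio : gamma2 / gamma1 != 2) (hratioV : gamma2 / gamma1 != 2^-1) :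
  ~ exists f : R[i] -> R[i],
      [/\ transcendental_entire f,
          (growth_order f < +oo)%E,
          is_S f (fun r => nevanlinna_N r (fun z => (f z)^-1)) &
          exists (k : nat) (a : 'I_k.+1 -> R[i] -> R[i]),
            (forall j, small_function f (a j)) /\
            forall z, (forall j, holomorphic_at (a j) z) ->
              f z * derive1 f z + \sum_(j < k.+1) a j z * derive1n j f z
              = p1 * expC (gamma1 * z) + p2 * expC (gamma2 * z)].
Proof.
move=> [f [[entf trans] order_f SN [k [a [small_a eqn]]]]].
have ef := entire_ent entf.
(* Transcendence enters here: with [f' = 0] everywhere, [f] would be a constant polynomial. *)
have f1n0 : exists z, derive1 f z != 0.
  apply: contrapT => H; apply: trans; exists (f 0)%:P => z; rewrite hornerC.
  apply: (@derive0_cst R (nc z + 1)).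
  - exact: ent_holD.
  - by move=> w _; apply/eqP; apply: contrapT => /negP fw; apply: H; exists w.
  - by rewrite ltrDl.
(* The exponent of larger modulus takes the role of the dominant one. The equation is symmetric in
   the two exponential terms, and each of the two cases yields one of the excluded ratios. *)
have [g21|/ltW g12] := leP (nc gamma2) (nc gamma1).
  move: hratio hratioV.
  have -> : gamma2 = gamma1 / 2.
    exact: half_exponent_of_eqn ef f1n0 order_f SN small_a eqn hp1 hp2 hg1 hg12 g21.
  by rewrite mulrAC divff// mul1r eqxx.
have eqn' z : (forall j, holomorphic_at (a j) z) ->
    f z * derive1 f z + \sum_(j < k.+1) a j z * derive1n j f z
    = p2 * expC (gamma2 * z) + p1 * expC (gamma1 * z).
  by move=> hz; rewrite eqn// addrC.
have hg21 : gamma2 != gamma1 by rewrite eq_sym.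
move: hratio.
have -> : gamma1 = gamma2 / 2.
  exact: half_exponent_of_eqn ef f1n0 order_f SN small_a eqn' hp2 hp1 hg2 hg21 g12.
by rewrite invfM invrK mulrA divff// mul1r eqxx.
Qed.
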